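(* Let $r$ be a real rational function with non-constant numerator for which there are disks as described in the context, let $J\in\mathbb R^{p\times p}$ be a signature matrix, and let $w_0$ be a point on the unit circle which is not a pole of $r$, the disks being chosen so that $w_0\in A(r,w_0)$. Let $\mathfrak P$ be a reproducing kernel Pontryagin space of $\mathbb C^p$-valued functions analytic in $r^{-1}(A(r,w_0))$. Then the following are equivalent. (1) For all $\alpha,\beta\in\Omega(r)\cap A(r,w_0)$ with $\alpha\ne\overline\beta$, the operators $R_\alpha^{(r)}$ and $R_\beta^{(r)}$ map $\mathfrak P$ into itself and, for all $f,g\in\mathfrak P$, $$[f,g]_{\mathfrak P}+\overline\beta[f,R^{(r)}_\beta g]_{\mathfrak P}+\alpha[R^{(r)}_\alpha f,g]_{\mathfrak P}-(1-\alpha\overline\beta)[R^{(r)}_\alpha f,R^{(r)}_\beta g]_{\mathfrak P}=(\alpha-\overline\beta)\sum_{i,j=1}^N\frac{g(v_j)^*}{\overline{r'(v_j)}}\,J\,\frac{f(u_i)}{r'(u_i)}\,\frac1{u_i-\overline{v_j}},$$ where $u_1,\ldots,u_N$ are the roots of $r(u)=\alpha$ and $v_1,\ldots,v_N$ are the roots of $r(v)=\beta$. (2) The reproducing kernel of $\mathfrak P$ is of the form $$(Z_r(z)\otimes I_p)\,\frac{X(J,r)^{-1}-\Theta(r(z))\,X(J,r)\,\Theta(r(w))^*}{1-r(z)\overline{r(w)}}\,(Z_r(w)\otimes I_p)^*,$$ where $\Theta$ is a $\mathbb C^{Np\times Np}$-valued function analytic in a neighborhood of the origin.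
   Context: Setting: $r=P/Q$ with $P,Q$ coprime polynomials, $\deg P\ge\deg Q$, $N=\deg P$. Real means $r(z)=\overline{r(\overline z)}$. A signature matrix is a matrix $J$ with $J=J^*=J^{-1}$. $\mathfrak L(r)$ is the $N$-dimensional linear span of the functions $z\mapsto\frac{r(z)-r(a)}{z-a}$, $a$ a point of analyticity of $r$; $e_1,\ldots,e_N$ is a fixed basis of $\mathfrak L(r)$ consisting of real rational functions, and $Z_r(z)=(e_1(z)\ \cdots\ e_N(z))$. $\Omega(r)$ is the set of $\alpha\in\mathbb C$ for which $r(z)=\alpha$ has $N$ pairwise different roots $w_1,\ldots,w_N$. For $\alpha\in\Omega(r)$ and $f$ analytic in a neighborhood of these roots, $$(R^{(r)}_\alpha f)(z)=\frac{f(z)}{r(z)-\alpha}-\sum_{n=1}^N\frac{f(w_n)}{r'(w_n)(z-w_n)},\quad r(z)\ne\alpha,$$ extended analytically across the removable singularities $w_1,\ldots,w_N$. $X(J,r)=\sum_{n=1}^N\frac{(Z_r(w_n)\otimes I_p)^tJ(Z_r(w_n)\otimes I_p)}{r'(w_n)}\in\mathbb R^{Np\times Np}$, where $w_1,\ldots,w_N$ are the roots of $r(z)=\alpha$ for any $\alpha\in\Omega(r)$; it is real symmetric, invertible and independent of $\alpha\in\Omega(r)$. Disks: $D_1,\ldots,D_L$ are pairwise disjoint open disks around the distinct zeros of $r$; neither the $D_\ell$ nor their boundaries contain poles of $r$, and, with $\rho=\min_{s\in\bigcup_\ell\partial D_\ell}|r(s)|$, one has $\{z:|r(z)|<\rho\}\subset\bigcup_\ell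 D_\ell$. They are chosen small enough that none of the roots of $r(z)=w_0$ lies in $\bigcup_\ell\overline{D_\ell}$, and for this choice $A(r,w_0)=\mathbb C\setminus\bigcup_{\ell=1}^L r(\partial D_\ell)$, an open set containing $0$ and $w_0$. Convention: the functions considered on $r^{-1}(A(r,w_0))$ are those of the form $f(z)=(Z_r(z)\otimes I_p)F(r(z))$ with $F$ a $\mathbb C^{Np}$-valued function analytic in $A(r,w_0)$. *)

(* Defs.v *)
From HB Require Import structures.
From mathcomp Require Import all_boot all_order all_algebra.
From mathcomp Require Import all_classical all_reals.
From mathcomp Require Import topology normedtype sequences derive.
From mathcomp Require Import complex mxtens.
Set Implicit Arguments.
Unset Strict Implicit.
Unset Printing Implicit Defensive.
Import Order.TTheory GRing.Theory Num.Theory.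
Import numFieldNormedType.Exports.
Local Open Scope classical_set_scope.
Local Open Scope card_scope.
Local Open Scope ring_scope.

(* Naming R[i] as a numClosedFieldType selects the generic topology of a
   numFieldType on it. *)
Definition Cplx (R : realType) : numClosedFieldType := R[i].

Section Complex.
Variable C : numClosedFieldType.

Definition adjmx m n (M : 'M[C]_(m, n)) : 'M[C]_(n, m) := map_mx Num.conj M^T.

Definition signature_mx p (J : 'M[C]_p) : Prop :=
  [/\ J = adjmx J, J \in unitmx & J = invmx J].

Definition analytic_at (f : C -> C) (c : C) : Prop :=
  exists (a : nat -> C) (rho : C), 0 < rho /\
    forall z, `|z - c| < rho ->
      series (fun k => a k * (z - c) ^+ k) @ \oo --> f z.

Definition analytic_on m n (U : set C) (F : C -> 'M[C]_(m, n)) : Prop :=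
  forall c, U c -> forall i j, analytic_at (fun z => F z i j) c.

Record ratfun := Ratfun {
  rnum : {poly C};
  rden : {poly C};
  rden_neq0 : rden != 0;
  rnum_rden_coprime : coprimep rnum rden }.

(* The value at a pole is the junk value 0; all uses below are guarded by
   [regular]. *)
Definition rat_eval (r : ratfun) (z : C) : C := (rnum r).[z] / (rden r).[z].
Coercion rat_eval : ratfun >-> Funclass.

Definition regular (r : ratfun) : set C := [set z | (rden r).[z] != 0].

Definition real_ratfun (r : ratfun) : Prop :=
  forall z, regular r z -> regular r z^* -> r z = (r z^*)^*.

(* z |-> (r z - r a) / (z - a), with its removable singularity at a filled. *)
Definition diff_quot (r : ratfun) (a z : C) : C :=
  if z == a then derive1 r a else (r z - r a) / (z - a).

(* Functions are compared away from the poles of r only. *)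
Definition Lspace (r : ratfun) : set (C -> C) :=
  [set f | exists m (a c : 'I_m -> C), (forall k, regular r (a k)) /\
     forall z, regular r z -> f z = \sum_k c k * diff_quot r (a k) z].

Definition real_basis N (r : ratfun) (e : 'I_N -> C -> C) : Prop :=
  [/\ forall n, Lspace r (e n),
      forall f, Lspace r f -> exists c : 'I_N -> C,
        forall z, regular r z -> f z = \sum_n c n * e n z,
      forall c : 'I_N -> C,
        (forall z, regular r z -> \sum_n c n * e n z = 0) ->
        forall n, c n = 0
    & forall n z, regular r z -> regular r z^* -> e n z = (e n z^*)^*].

(* The matrix Z_r(z) \otimes I_p. *)
Definition ZI N p (e : 'I_N -> C -> C) (z : C) : 'M[C]_(p, N * p) :=
  castmx (mul1n p, erefl) (tensmx (\row_n e n z) (1%:M : 'M[C]_p)).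

Definition roots_of (r : ratfun) (alpha : C) : set C :=
  [set w | regular r w /\ r w = alpha].

Definition Omega N (r : ratfun) : set C :=
  [set alpha | roots_of r alpha #= `I_N].

Definition Xmx N p (r : ratfun) (J : 'M[C]_p) (e : 'I_N -> C -> C)
    (alpha : C) : 'M[C]_(N * p) :=
  \sum_(w \in roots_of r alpha)
    (derive1 r w)^-1 *: ((ZI p e w)^T *m J *m ZI p e w).

Definition Rformula (r : ratfun) (alpha : C) (f : C -> C) (z : C) : C :=
  f z / (r z - alpha)
  - \sum_(w \in roots_of r alpha) f w / (derive1 r w * (z - w)).

(* Functions on D are represented by total functions vanishing outside D. *)
Definition restr p (D : set C) (f : C -> 'cV[C]_p) : C -> 'cV[C]_p :=
  fun z => if z \in D then f z else 0.

Definition Rop p (D : set C) (r : ratfun) (alpha : C) (f : C -> 'cV[C]_p) :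
    C -> 'cV[C]_p :=
  restr D (fun z => \col_i
    let g := Rformula r alpha (fun x => f x i 0) in
    if r z == alpha then lim (g x @[x --> z^']) else g z).

Section Pontryagin.
Variable E : lmodType C.

Definition lin_subspace (V : set E) : Prop :=
  V 0 /\ forall (a : C) f g, V f -> V g -> V (a *: f + g).

Definition hermitian_form (V : set E) (ip : E -> E -> C) : Prop :=
  (forall (a : C) f g h, V f -> V g -> V h ->
     ip (a *: f + g) h = a * ip f h + ip g h) /\
  (forall f g, V f -> V g -> ip f g = (ip g f)^*).

Definition complete_for (V : set E) (ip : E -> E -> C) : Prop :=
  forall u : nat -> E, (forall n, V (u n)) ->
    (forall eps : C, 0 < eps -> exists M, forall m n, (M <= m)%N -> (M <= n)%N ->
       ip (u m - u n) (u m - u n) < eps) ->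
    exists2 l, V l & forall eps : C, 0 < eps -> exists M, forall n, (M <= n)%N ->
       ip (u n - l) (u n - l) < eps.

Definition finite_dim (V : set E) : Prop :=
  exists k (b : 'I_k -> E), forall f, V f ->
    exists c : 'I_k -> C, f = \sum_i c i *: b i.

(* V is a Pontryagin space: it has an orthogonal decomposition Vp [+] Vm with
   Vp a Hilbert space and Vm a finite-dimensional anti-Hilbert space. *)
Definition pontryagin (V : set E) (ip : E -> E -> C) : Prop :=
  [/\ lin_subspace V, hermitian_form V ip
    & exists Vp Vm : set E,
      [/\ lin_subspace Vp /\ lin_subspace Vm,
          Vp `<=` V /\ Vm `<=` V,
          forall f, V f -> exists g h, [/\ Vp g, Vm h & f = g + h],
          forall g h, Vp g -> Vm h -> ip g h = 0
        & [/\ forall g, Vp g -> g != 0 -> 0 < ip g g,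
              complete_for Vp ip,
              forall h, Vm h -> h != 0 -> ip h h < 0
            & finite_dim Vm]]].

End Pontryagin.

Definition reproducing_kernel p (D : set C) (V : set (C -> 'cV[C]_p))
    (ip : (C -> 'cV[C]_p) -> (C -> 'cV[C]_p) -> C)
    (K : C -> C -> 'M[C]_p) : Prop :=
  forall w (c : 'cV[C]_p), D w ->
    let Kwc := restr D (fun z => K z w *m c) in
    V Kwc /\ forall f, V f -> ip f Kwc = (adjmx c *m f w) 0 0.

(* K is the kernel of the space (V, ip) of functions on D. *)
Definition rk_pontryagin p (D : set C) (V : set (C -> 'cV[C]_p))
    (ip : (C -> 'cV[C]_p) -> (C -> 'cV[C]_p) -> C)
    (K : C -> C -> 'M[C]_p) : Prop :=
  [/\ forall f z, V f -> ~ D z -> f z = 0,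
      pontryagin V ip
    & reproducing_kernel D V ip K].

Definition disk (c d : C) : set C := [set z | `|z - c| < d].
Definition cdisk (c d : C) : set C := [set z | `|z - c| <= d].
Definition circle (c d : C) : set C := [set z | `|z - c| = d].

(* The disks have centers zeta l and radii delta l. *)
Definition admissible_disks (r : ratfun) (w0 : C) L (zeta delta : 'I_L -> C) :
    Prop :=
  [/\ injective zeta /\ range zeta = roots_of r 0,
      (forall l, 0 < delta l) /\
        trivIset setT (fun l => disk (zeta l) (delta l)),
      forall l, cdisk (zeta l) (delta l) `<=` regular r,
      exists rho : C,
        [/\ exists l s, circle (zeta l) (delta l) s /\ `|r s| = rho,
            forall l s, circle (zeta l) (delta l) s -> rho <= `|r s|
          & forall z, regular r z -> `|r z| < rho ->
              exists l, disk (zeta l) (delta l) z]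
    & forall l z, roots_of r w0 z -> ~ cdisk (zeta l) (delta l) z].

Definition Aset (r : ratfun) L (zeta delta : 'I_L -> C) : set C :=
  ~` \bigcup_l (r @` circle (zeta l) (delta l)).

Definition rat_preimage (r : ratfun) (A : set C) : set C :=
  [set z | regular r z /\ A (r z)].

End Complex.

(* Main.v *)
Require Import Defs.
From HB Require Import structures.
From mathcomp Require Import all_boot all_order all_algebra finmap.
From mathcomp Require Import all_classical all_reals.
From mathcomp Require Import topology normedtype sequences derive.
From mathcomp Require Import complex mxtens cyclic separable cyclotomic.
From mathcomp Require Import ring lra.

(** Partial fractions turn the statement into one about functions on the value
    side of [r]. Let [S] be the set of points of [A] that [r] attains [N] times.
    For [s] in [S], the vector [F s] of a function [f z = Z_r z (F (r z))] is
    a combination of the values of [f] at the [N] roots of [r = s]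
    ([value_atE]), and every element [e] of the space of difference quotients
    satisfies [sum_u e u / (r' u (z - u)) = e z / (r z - a)], where [u] runs
    over the roots of [r = a] ([partial_fraction]). Three things follow: [X]
    does not depend on the chosen value ([Xlist_indep]); the operator at [a]
    acts on [F] as the difference quotient [s |-> (F s - F a) / (s - a)]
    ([isR_Rop], [Rop_isR]); and the double sum equals
    [(G b)^* X (F a) / (a - b^* )] ([double_sum]). Thus the space becomes a
    reproducing kernel Pontryagin space of functions on [S] ([space_model]),
    with a kernel [kap], and the claim becomes the equivalence of

      [(1 - s t^* ) kap s t = X^-1 - Theta s X (Theta t)^*]

    with the identity, for the difference quotient operators [R_a],

      [(F, G) + b^* (F, R_b G) + a (R_a F, G) - (1 - a b^* ) (R_a F, R_b G)
         = (G b)^* X (F a)].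

    From the identity to the kernel ([identity_kernel_formula]): take [a = b]
    on the unit circle, not real, close to [w0]. The last product drops out,
    and the identity for two kernel functions expresses [kap s t] by the values
    [kap s a] and [kap a t], which is the formula with
    [Theta s = X^-1 + a^* (s - a) kap s a]. The formula extends from the points
    over [S] to the whole domain by continuity, as only finitely many values
    are attained fewer than [N] times ([Omega_cofinite]).

    From the kernel to the identity ([kernel_formula_identity]), the main point
    is that the operators act on the space at all. There are three steps.
    First, take two different points with [a b^* = 1]. There the kernel
    formula gives [1 + b^* R_b^* + a R_a = ev_b^* X ev_a] on kernel functions
    ([kernel_pair]). With the resolvent identity this bounds [R_b^*] on
    combinations of kernel functions, in the Hilbert norm obtained by reversing
    the negative part of the form ([pontryagin_majorant], [Ys_bound]); by the
    Riesz theorem [R_b] is everywhere defined and bounded ([R_bounded]), and by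
    density the identity holds for the pair ([pair_identity]). The resolvent
    identity carries it over to all other points at which the operators are
    defined ([R_identity_transfer]). Second, let [a] be any point off the unit
    circle and [c] the one of the two points on the same side. By the identity,
    [(1 - |c|^2) R_c - c^*] is isometric on the functions vanishing at [c], so
    it is a Hilbert space contraction up to finite rank, and the equation for
    [R_a F] has the form [f - b W f = g] with such a [W] and [|b| < 1]. Its
    solution is unique, hence exists by the Fredholm alternative ([fredholm],
    [R_off_circle]). Third, at a point on the circle, [R_a F] is obtained as a
    weak limit of weighted averages of vectors [R_z F] over a small circle
    around [a]. The weight vanishes where the bound of [R_z F] blows up, and
    the averages converge because [F] has a Taylor series at [a]
    ([average_diff_quot], [R_on_circle]). *)

Set Implicit Arguments.
Unset Strict Implicit.
Unset Printing Implicit Defensive.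
Import Order.TTheory GRing.Theory Num.Theory.
Import numFieldNormedType.Exports.
Local Open Scope classical_set_scope.
Local Open Scope ring_scope.

(** * Real-valued modulus on the complex field *)

Section Modulus.
Variable R : realType.
Local Notation C := (Cplx R).

(** Working with moduli in [R] instead of norms in [Cplx R] keeps estimates
    within a real field. *)
Definition cabs (z : C) : R := complex.Re `|z|.

Lemma cabsE (z : C) : `|z| = real_complex R (cabs z) :> C.
Proof.
rewrite /cabs; have : 0 <= `|z| by apply: normr_ge0.
by move=> /(@ger0_Im R); case: (`|z|) => a b /= ->.
Qed.

Lemma cabs_ge0 z : 0 <= cabs z.
Proof. by rewrite -(@lecR R) -cabsE normr_ge0. Qed.

Lemma cabs0 : cabs 0 = 0.
Proof. by rewrite /cabs normr0. Qed.

Lemma cabs1 : cabs 1 = 1.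
Proof. by rewrite /cabs normr1. Qed.

Lemma cabs_eq0 z : (cabs z == 0) = (z == 0).
Proof.
rewrite -(inj_eq (@complexI R)) -cabsE.
by rewrite (_ : real_complex R 0 = 0 :> C) // normr_eq0.
Qed.

Lemma cabs_gt0 z : (0 < cabs z) = (z != 0).
Proof. by rewrite lt0r cabs_ge0 andbT cabs_eq0. Qed.

Lemma cabsM z w : cabs (z * w) = cabs z * cabs w.
Proof. by apply: (@complexI R); rewrite rmorphM /= -!cabsE normrM. Qed.

Lemma cabsV z : cabs z^-1 = (cabs z)^-1.
Proof. by apply: (@complexI R); rewrite fmorphV /= -!cabsE normfV. Qed.

Lemma cabsX z n : cabs (z ^+ n) = cabs z ^+ n.
Proof. by elim: n => [|n IH]; rewrite ?expr0 ?cabs1 // !exprS cabsM IH. Qed.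

Lemma cabsN z : cabs (- z) = cabs z.
Proof. by rewrite /cabs normrN. Qed.

Lemma cabsC z w : cabs (z - w) = cabs (w - z).
Proof. by rewrite -cabsN opprB. Qed.

Lemma cabsJ z : cabs z^* = cabs z.
Proof. by rewrite /cabs norm_conjC. Qed.

Lemma cabsD z w : cabs (z + w) <= cabs z + cabs w.
Proof. by rewrite -(@lecR R) rmorphD /= -!cabsE ler_normD. Qed.

Lemma cabsB z w : cabs (z - w) <= cabs z + cabs w.
Proof. by rewrite -[cabs w]cabsN cabsD. Qed.

Lemma cabs_sub z w : cabs z - cabs w <= cabs (z - w).
Proof. by rewrite lerBlDr -{1}(subrK w z) cabsD. Qed.

Lemma cabs_real_norm (x : R) : cabs (real_complex R x : C) = `|x|.
Proof.
apply: (@complexI R); rewrite -cabsE normc_def /=.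
by rewrite expr0n /= addr0 sqrtr_sqr.
Qed.

Lemma cabs_real (x : R) : 0 <= x -> cabs (real_complex R x) = x.
Proof. by move=> x0; rewrite cabs_real_norm ger0_norm. Qed.

Lemma cabs_nat (n : nat) : cabs n%:R = n%:R.
Proof. by rewrite -(@cabs_real n%:R) ?ler0n // rmorph_nat. Qed.

Lemma cabs_sum (I : Type) (s : seq I) (P : pred I) (F : I -> C) :
  cabs (\sum_(i <- s | P i) F i) <= \sum_(i <- s | P i) cabs (F i).
Proof.
elim/big_rec2: _ => [|i x y _ H]; first by rewrite cabs0.
by apply: le_trans (cabsD _ _) _; rewrite lerD2l.
Qed.

Lemma Re_le_cabs_norm (z : C) : `|complex.Re z| <= cabs z.
Proof. by rewrite -(@lecR R) -cabsE; exact: (@normc_ge_Re R z). Qed.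

Lemma Re_le_cabs (z : C) : complex.Re z <= cabs z.
Proof. exact: le_trans (ler_norm _) (Re_le_cabs_norm z). Qed.

Lemma cabs_sqr (z : C) : real_complex R (cabs z ^+ 2) = z * z^* :> C.
Proof. by rewrite rmorphXn /= -cabsE normCK. Qed.

Lemma real_complexE0 (z : C) : 0 <= z -> z = real_complex R (complex.Re z).
Proof. by move=> /(@ger0_Im R); case: z => a b /= ->. Qed.

Lemma cReD (z w : C) : complex.Re (z + w) = complex.Re z + complex.Re w.
Proof. by case: z w => [? ?] [? ?]. Qed.

Lemma cReN (z : C) : complex.Re (- z) = - complex.Re z.
Proof. by case: z. Qed.

Lemma cReJ (z : C) : complex.Re z^* = complex.Re z.
Proof. by case: z. Qed.

Lemma cReMl (x : R) (z : C) : complex.Re (real_complex R x * z) = x * complex.Re z.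
Proof. by case: z => a b /=; rewrite mul0r subr0. Qed.

Lemma inv_nat_small (eps : R) : 0 < eps ->
  exists K, forall k, (K <= k)%N -> k.+1%:R^-1 < eps.
Proof.
move=> eps0.
have := archi_boundP (ltW (_ : 0 < eps^-1)); rewrite invr_gt0 => /(_ eps0).
set j := Num.bound _ => Hj; exists j => m jm.
rewrite -[ltRHS]invrK ltf_pV2 ?posrE ?invr_gt0 ?ltr0n //.
by apply: lt_le_trans Hj _; rewrite ler_nat ltnW.
Qed.

Lemma finite_pos_bound L (D : 'I_L -> R) : (forall l, 0 < D l) ->
  exists2 d, 0 < d & forall l, d <= D l.
Proof.
move=> D0; have s0 : 0 <= \sum_l (D l)^-1 by apply: sumr_ge0 => i _; rewrite invr_ge0 ltW.
have s1 : 0 < 1 + \sum_l (D l)^-1 by rewrite ltr_wpDr.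
exists (1 + \sum_l (D l)^-1)^-1 => [|l]; first by rewrite invr_gt0.
rewrite -[leRHS]invrK lef_pV2 ?posrE ?invr_gt0 //.
rewrite (bigD1 l) //= addrCA lerDl addr_ge0 // sumr_ge0 // => j _.
by rewrite invr_ge0 ltW.
Qed.

End Modulus.

(** * Hermitian forms *)

Section HermitianForm.
Variables (R : realType) (U : lmodType (Cplx R)).
Local Notation C := (Cplx R).

Definition herm_form (ip : U -> U -> C) : Prop :=
  (forall (a : C) f g h, ip (a *: f + g) h = a * ip f h + ip g h) /\
  (forall f g, ip f g = (ip g f)^*).

Variable ip : U -> U -> C.
Hypothesis ipH : herm_form ip.

Lemma ipC f g : ip f g = (ip g f)^*. Proof. exact: ipH.2. Qed.

Lemma ip0l g : ip 0 g = 0.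
Proof.
have := ipH.1 1 0 0 g; rewrite scale1r add0r mul1r => /eqP.
by rewrite -subr_eq0 opprD addNKr oppr_eq0 => /eqP.
Qed.

Lemma ipZl a f g : ip (a *: f) g = a * ip f g.
Proof. by rewrite -[a *: f]addr0 ipH.1 ip0l addr0. Qed.

Lemma ipDl f g h : ip (f + g) h = ip f h + ip g h.
Proof. by rewrite -{1}[f]scale1r ipH.1 mul1r. Qed.

Lemma ipNl f g : ip (- f) g = - ip f g.
Proof. by rewrite -scaleN1r ipZl mulN1r. Qed.

Lemma ipBl f g h : ip (f - g) h = ip f h - ip g h.
Proof. by rewrite ipDl ipNl. Qed.

Lemma ip_suml I (s : seq I) P (F : I -> U) g :
  ip (\sum_(i <- s | P i) F i) g = \sum_(i <- s | P i) ip (F i) g.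
Proof. by elim/big_rec2: _ => [|i x y _ H]; rewrite ?ip0l // ipDl H. Qed.

Lemma ip0r f : ip f 0 = 0.
Proof. by rewrite ipC ip0l conjC0. Qed.

Lemma ipZr a f g : ip f (a *: g) = a^* * ip f g.
Proof. by rewrite ipC ipZl rmorphM /= -ipC. Qed.

Lemma ipDr f g h : ip f (g + h) = ip f g + ip f h.
Proof. by rewrite ipC ipDl rmorphD /= -!ipC. Qed.

Lemma ipNr f g : ip f (- g) = - ip f g.
Proof. by rewrite ipC ipNl rmorphN /= -ipC. Qed.

Lemma ipBr f g h : ip f (g - h) = ip f g - ip f h.
Proof. by rewrite ipDr ipNr. Qed.

Lemma ip_sumr I (s : seq I) P (F : I -> U) g :
  ip g (\sum_(i <- s | P i) F i) = \sum_(i <- s | P i) ip g (F i).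
Proof. by elim/big_rec2: _ => [|i x y _ H]; rewrite ?ip0r // ipDr H. Qed.

Lemma cabs_ipC f g : cabs (ip f g) = cabs (ip g f).
Proof. by rewrite ipC cabsJ. Qed.

End HermitianForm.

Lemma linear0E (K : pzRingType) (U W : lmodType K) (T : U -> W) :
  linear T -> T 0 = 0.
Proof.
move=> lT; have := lT 1 0 0; rewrite !scale1r addr0 => /eqP.
by rewrite -subr_eq0 opprD addNKr oppr_eq0 => /eqP.
Qed.

Lemma linearDE (K : pzRingType) (U W : lmodType K) (T : U -> W) f g :
  linear T -> T (f + g) = T f + T g.
Proof. by move=> lT; rewrite -{1}[f]scale1r lT scale1r. Qed.

Lemma linearZE (K : pzRingType) (U W : lmodType K) (T : U -> W) a f :
  linear T -> T (a *: f) = a *: T f.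
Proof. by move=> lT; rewrite -[a *: f]addr0 lT (linear0E lT) addr0. Qed.

Lemma linearNE (K : pzRingType) (U W : lmodType K) (T : U -> W) f :
  linear T -> T (- f) = - T f.
Proof. by move=> lT; rewrite -scaleN1r linearZE // scaleN1r. Qed.

Lemma linearBE (K : pzRingType) (U W : lmodType K) (T : U -> W) f g :
  linear T -> T (f - g) = T f - T g.
Proof. by move=> lT; rewrite linearDE // linearNE. Qed.

Lemma linear_sumE (K : pzRingType) (U W : lmodType K) (T : U -> W) I
    (s : seq I) (F : I -> U) :
  linear T -> T (\sum_(i <- s) F i) = \sum_(i <- s) T (F i).
Proof.
move=> lT; elim/big_rec2: _ => [|i x y _ H]; first exact: linear0E.
by rewrite linearDE // H.
Qed.

(** * Hilbert spaces *)

Section Hilbert.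
Variables (R : realType) (U : lmodType (Cplx R)).
Local Notation C := (Cplx R).

Definition hilbert (hp : U -> U -> C) : Prop :=
  [/\ herm_form hp, forall f, f != 0 -> 0 < hp f f & complete_for setT hp].

Variable hp : U -> U -> C.
Hypothesis hilb : hilbert hp.

Let hpH : herm_form hp. Proof. by case: hilb. Qed.

Definition nm (f : U) : R := Num.sqrt (complex.Re (hp f f)).

Lemma hp_ge0 f : 0 <= hp f f.
Proof.
have [->|f0] := eqVneq f 0; first by rewrite (ip0l hpH).
by case: hilb => _ /(_ _ f0) /ltW.
Qed.

Lemma nm_ge0 f : 0 <= nm f. Proof. exact: sqrtr_ge0. Qed.

Lemma nm_sqr f : nm f ^+ 2 = complex.Re (hp f f).
Proof. by rewrite sqr_sqrtr // -(@lecR R) -real_complexE0 hp_ge0. Qed.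

Lemma hp_nm f : hp f f = real_complex R (nm f ^+ 2).
Proof. by rewrite nm_sqr -real_complexE0 // hp_ge0. Qed.

Lemma nm0 : nm 0 = 0.
Proof. by rewrite /nm (ip0l hpH) /= sqrtr0. Qed.

Lemma nm_eq0 f : nm f = 0 -> f = 0.
Proof.
move=> nf; apply/eqP; apply/negP => /negP f0.
case: hilb => _ /(_ _ f0) + _; rewrite hp_nm nf expr0n /=.
by rewrite (@ltcR R 0 0) ltxx.
Qed.

Lemma nm_gt0 f : f != 0 -> 0 < nm f.
Proof.
move=> f0; rewrite lt0r nm_ge0 andbT; apply/negP => /eqP /nm_eq0 /eqP.
by rewrite (negbTE f0).
Qed.

Lemma nmZ a f : nm (a *: f) = cabs a * nm f.
Proof.
apply/eqP; rewrite -(@eqrXn2 _ 2) ?nm_ge0 ?mulr_ge0 ?cabs_ge0 ?nm_ge0 //.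
rewrite -(inj_eq (@complexI R)) -hp_nm (ipZl hpH) (ipZr hpH) mulrA.
by rewrite exprMn rmorphM /= -hp_nm cabs_sqr.
Qed.

Lemma nmN f : nm (- f) = nm f.
Proof. by rewrite -scaleN1r nmZ cabsN cabs1 mul1r. Qed.

Lemma nmBC f g : nm (f - g) = nm (g - f).
Proof. by rewrite -nmN opprB. Qed.

Lemma nm_sqrD f g : nm (f + g) ^+ 2 = nm f ^+ 2 + 2 * complex.Re (hp f g) + nm g ^+ 2.
Proof.
rewrite !nm_sqr (ipDl hpH) !(ipDr hpH) !cReD (ipC hpH g f) cReJ; ring.
Qed.

Lemma cauchy_schwarz f g : cabs (hp f g) <= nm f * nm g.
Proof.
have [->|g0] := eqVneq g 0; first by rewrite (ip0r hpH) cabs0 nm0 mulr0.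
have ng := nm_gt0 g0.
rewrite -(@ler_pXn2r _ 2) ?nnegrE ?mulr_ge0 ?cabs_ge0 ?nm_ge0 //.
have ngC : real_complex R (nm g ^+ 2) != 0 :> C.
  by rewrite (inj_eq (@complexI R) _ 0) expf_neq0 // gt_eqF.
pose a : C := - (hp f g / real_complex R (nm g ^+ 2)).
have H : 0 <= hp (f + a *: g) (f + a *: g) := hp_ge0 _.
have E : hp (f + a *: g) (f + a *: g) * real_complex R (nm g ^+ 2) =
   real_complex R (nm f ^+ 2 * nm g ^+ 2 - cabs (hp f g) ^+ 2).
  rewrite (ipDl hpH) !(ipDr hpH) !(ipZl hpH) !(ipZr hpH) !hp_nm (ipC hpH g f).
  rewrite [RHS]rmorphB /= cabs_sqr [X in _ = X - _](rmorphM (real_complex R)) /=.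
  have aJ : a^* = - ((hp f g)^* / real_complex R (nm g ^+ 2)).
    by rewrite /a rmorphN rmorphM fmorphV /= -hp_nm -(ipC hpH g g).
  rewrite aJ /a; move: ngC.
  move: (real_complex R (nm g ^+ 2)) (real_complex R (nm f ^+ 2)) => G F G0.
  by move: (hp f g) => x; field.
have := mulr_ge0 H (_ : 0 <= real_complex R (nm g ^+ 2) :> C).
rewrite E !(@ler0c R) subr_ge0 exprMn => -> //; exact: sqr_ge0.
Qed.

Lemma nmD f g : nm (f + g) <= nm f + nm g.
Proof.
rewrite -(@ler_pXn2r _ 2) ?nnegrE ?addr_ge0 ?nm_ge0 // nm_sqrD sqrrD.
have := le_trans (Re_le_cabs _) (cauchy_schwarz f g); lra.
Qed.

Lemma nmB f g : nm (f - g) <= nm f + nm g.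
Proof. by rewrite -[nm g]nmN nmD. Qed.

Lemma nm_sum (I : Type) (s : seq I) (F : I -> U) :
  nm (\sum_(i <- s) F i) <= \sum_(i <- s) nm (F i).
Proof.
elim/big_rec2: _ => [|i x y _ H]; first by rewrite nm0.
by apply: le_trans (nmD _ _) _; rewrite lerD2l.
Qed.

Lemma hilbert_complete (u : nat -> U) :
  (forall eps : R, 0 < eps -> exists M, forall m n, (M <= m)%N -> (M <= n)%N ->
     nm (u m - u n) < eps) ->
  exists l, forall eps : R, 0 < eps -> exists M, forall n, (M <= n)%N ->
     nm (u n - l) < eps.
Proof.
move=> cu; case: hilb => _ _ /(_ u) [] //.
  move=> eps eps0.
  have er : eps = real_complex R (complex.Re eps) by apply/real_complexE0/ltW.
  have er0 : 0 < complex.Re eps by rewrite -(@ltcR R) -er.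
  have [|M HM] := cu (Num.sqrt (complex.Re eps)); first by rewrite sqrtr_gt0.
  exists M => m n mM nM; rewrite hp_nm er (@ltcR R).
  rewrite -[ltRHS]sqr_sqrtr ?ltW // ltr_pXn2r ?nnegrE ?nm_ge0 ?sqrtr_ge0 //.
  exact: HM.
move=> l _ Hl; exists l => eps eps0.
have [|M HM] := Hl (real_complex R (eps ^+ 2)).
  by rewrite (@ltcR R 0) exprn_gt0.
exists M => n /HM; rewrite hp_nm (@ltcR R).
by rewrite ltr_pXn2r ?nnegrE ?nm_ge0 // ltW.
Qed.

(** Riesz representation for a bounded functional given as a linear relation:
    the relation need not be presented as a function on a subspace, because the
    bound makes the second component a function of the first. The representing
    vector is the limit of a minimizing sequence of
    [`|f|^2 - 2 Re (phi f)], so it also lies in the closure of the domain. *)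
Lemma riesz (M : U -> C -> Prop) (B : R) :
  M 0 0 ->
  (forall a f x g y, M f x -> M g y -> M (a *: f + g) (a * x + y)) ->
  (forall f x, M f x -> cabs x <= B * nm f) ->
  exists H, (forall f x, M f x -> x = hp f H) /\
    (forall eps, 0 < eps -> exists f x, M f x /\ nm (H - f) < eps).
Proof.
move=> M0 Ml MB.
pose Jf f (x : C) : R := nm f ^+ 2 - 2 * complex.Re x.
pose E := [set t | exists f x, M f x /\ t = Jf f x].
have lbE : lbound E (- B ^+ 2).
  move=> _ [f [x [Mfx ->]]]; rewrite /Jf.
  have := le_trans (Re_le_cabs x) (MB _ _ Mfx).
  have := sqr_ge0 (nm f - B); nra.
have hiE : has_inf E.
  by split; [exists (Jf 0 0), 0, 0 | exists (- B ^+ 2)].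
have infE f x : M f x -> inf E <= Jf f x.
  by move=> Mfx; apply: ge_inf; [exists (- B ^+ 2) | exists f, x].
have step (k : nat) : exists p : U * C, M p.1 p.2 /\ Jf p.1 p.2 < inf E + k.+1%:R^-1.
  have [|t [f [x [Mfx ->]]] lt] := @inf_adherent _ E k.+1%:R^-1 _ hiE.
    by rewrite invr_gt0 ltr0n.
  by exists (f, x).
have [p Hp] := boolp.choice step.
have par f x g y : M f x -> M g y ->
    nm (f - g) ^+ 2 <= 2 * (Jf f x - inf E) + 2 * (Jf g y - inf E).
  move=> Mf Mg.
  have Mh := Ml 2^-1 _ _ _ _ (Ml 1 _ _ _ _ Mf Mg) M0.
  have := infE _ _ Mh; rewrite /Jf !addr0 scale1r mul1r.
  rewrite nmZ cabsV cabs_nat exprMn.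
  have -> : (2^-1 : C) = real_complex R 2^-1 by rewrite fmorphV /= rmorph_nat.
  rewrite cReMl cReD !nm_sqrD nmN (ipNr hpH) cReN.
  set a := nm f ^+ 2; set b := nm g ^+ 2; set c := complex.Re (hp f g).
  set s := complex.Re x; set t := complex.Re y; rewrite exprVn; lra.
have cu : forall eps : R, 0 < eps -> exists M, forall m n, (M <= m)%N -> (M <= n)%N ->
     nm ((p m).1 - (p n).1) < eps.
  move=> eps eps0.
  have e4 : 0 < eps ^+ 2 / 4 by rewrite divr_gt0 ?exprn_gt0 ?ltr0n.
  have [k Hk] := inv_nat_small e4; exists k => m n km kn.
  have Hpar := par _ _ _ _ (Hp m).1 (Hp n).1.
  rewrite -(@ltr_pXn2r _ 2) ?nnegrE ?nm_ge0 ?(ltW eps0) //.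
  apply: le_lt_trans Hpar _.
  move: (Hp m).2 (Hp n).2 (Hk _ km) (Hk _ kn).
  move: (Jf _ _) (Jf _ _) (inf E) (m.+1%:R^-1) (n.+1%:R^-1).
  by move=> a b c d e; move: (eps ^+ 2) => g; lra.
have [H HH] := hilbert_complete cu.
exists H; split; last first.
  move=> eps /HH [n /(_ n (leqnn n))]; rewrite nmBC => Hn.
  by exists (p n).1, (p n).2; split => //; exact: (Hp n).1.
move=> f x Mfx; apply/eqP; rewrite -subr_eq0 -cabs_eq0.
(* The first variation of the functional at its minimum vanishes. *)
set D := x - hp f H.
have key : forall eps : R, 0 < eps -> forall k : R, 0 < k ->
    2 * k * cabs D ^+ 2 <= k ^+ 2 * (cabs D * nm f) ^+ 2 + eps.
  move=> eps eps0 k k0.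
  pose e := Num.min (eps / (2 * (1 + 2 * k * cabs D * nm f))) 1.
  have den : 0 < 1 + 2 * k * cabs D * nm f.
    have : 0 <= 2 * k * cabs D * nm f.
      by rewrite !mulr_ge0 ?cabs_ge0 ?nm_ge0 // ltW.
    by move=> ?; rewrite ltr_wpDr ?ltr01.
  have e0 : 0 < e.
    rewrite /e lt_min ltr01 andbT divr_gt0 // mulr_gt0 //.
  have [n1 Hn1] := HH e e0.
  have [n2 Hn2] := inv_nat_small e0.
  pose n := maxn n1 n2.
  have Hn := Hn1 n (leq_maxl _ _); have Hn' := Hn2 n (leq_maxr _ _).
  pose c := real_complex R k * D^*.
  have := infE _ _ (Ml c _ _ _ _ Mfx (Hp n).1).
  rewrite /Jf nm_sqrD nmZ (ipZl hpH) cReD.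
  have -> : hp f (p n).1 = hp f ((p n).1 - H) - D + x.
    by rewrite (ipBr hpH) /D opprB addrA subrK subrK.
  have cc : cabs c = k * cabs D.
    by rewrite /c cabsM cabsJ cabs_real // ltW.
  rewrite cc mulrDr mulrBr !cReD !cReN.
  have -> : complex.Re (c * D) = k * cabs D ^+ 2.
    by rewrite /c -mulrA cReMl mulrC [D^* * D]mulrC -cabs_sqr /= mulrC.
  have B1 : complex.Re (c * hp f ((p n).1 - H)) <= k * cabs D * (nm f * e).
    apply: le_trans (Re_le_cabs _) _; rewrite cabsM cc.
    apply: ler_wpM2l; first by rewrite mulr_ge0 ?cabs_ge0 // ltW.
    apply: le_trans (cauchy_schwarz _ _) _.
    by apply: ler_wpM2l; rewrite ?nm_ge0 // ltW.
  have := (Hp n).2; rewrite /Jf.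
  have eb : e * (2 * (1 + 2 * k * cabs D * nm f)) <= eps.
    by rewrite -ler_pdivlMr ?mulr_gt0 // /e ge_min lexx.
  have -> : (k * cabs D * nm f) ^+ 2 = k ^+ 2 * (cabs D * nm f) ^+ 2 by ring.
  move: B1 eb; set A1 := complex.Re _; set A2 := complex.Re (c * x).
  set A3 := complex.Re (p n).2; set A4 := inf E; move: Hn'.
  set ee := _.+1%:R^-1; nra.
have lim k : 0 < k -> 2 * k * cabs D ^+ 2 <= k ^+ 2 * (cabs D * nm f) ^+ 2.
  by move=> k0; apply/ler_addgt0Pr => eps eps0; exact: key.
rewrite -sqrf_eq0; apply/eqP/le_anti; rewrite sqr_ge0 andbT.
set c := (cabs D * nm f) ^+ 2 in lim.
have c0 : 0 <= c by exact: sqr_ge0.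
have := lim (cabs D ^+ 2 / (1 + c)).
have [->//|D0] := eqVneq (cabs D ^+ 2) 0.
have d0 : 0 < cabs D ^+ 2 by rewrite lt0r D0 sqr_ge0.
have c1 : 0 < 1 + c by rewrite ltr_wpDr ?ltr01.
rewrite divr_gt0 // => /(_ isT); move: (cabs D ^+ 2) d0 => d d0.
rewrite expr_div_n -subr_ge0.
have -> : d ^+ 2 / (1 + c) ^+ 2 * c - 2 * (d / (1 + c)) * d =
   - (d ^+ 2 * (c + 2) / (1 + c) ^+ 2) by field; rewrite gt_eqF.
rewrite oppr_ge0 => H0; exfalso; move: H0; apply/negP; rewrite -ltNge.
by rewrite divr_gt0 ?exprn_gt0 // mulr_gt0 ?exprn_gt0 // ltr_wpDl.
Qed.

End Hilbert.

(** * The Fredholm alternative for finite-rank perturbations of contractions *)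

Lemma unitmx_inj (F : fieldType) n (A : 'M[F]_n) :
  (forall v : 'cV_n, A *m v = 0 -> v = 0) -> A \in unitmx.
Proof.
move=> inj; rewrite -unitmx_tr -row_free_unit -kermx_eq0.
apply/eqP/eqP/rowV0P => v /sub_kermxP vA.
apply: trmx_inj; rewrite trmx0; apply: inj.
by rewrite -[A]trmxK -trmx_mul vA trmx0.
Qed.

Lemma geometric_small (R : realType) (q B eps : R) : 0 <= q -> q < 1 -> 0 < eps ->
  exists N, forall n, (N <= n)%N -> q ^+ n * B < eps.
Proof.
move=> q0 q1 eps0.
have : (fun n => q ^+ n * B) @ \oo --> 0 * B.
  by apply: cvgMl; apply: cvg_expr; rewrite ger0_norm.
rewrite mul0r => /cvgrPdist_lt /(_ _ eps0) [N _ HN].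
exists N => n /HN /=; rewrite sub0r normrN; exact: le_lt_trans (ler_norm _).
Qed.

Section Fredholm.
Variables (R : realType) (U : lmodType (Cplx R)).
Local Notation C := (Cplx R).

Definition scalar_form (psi : U -> C) : Prop :=
  forall (a : C) f g, psi (a *: f + g) = a * psi f + psi g.

(** Injectivity of [L] makes the finite system for the unknown coefficients
    [psi i f] invertible; solving it reduces [L f = h] to the surjective
    operator [L0]. *)
Lemma finite_rank_surj (L0 L : U -> U) m (x : 'I_m -> U) (psi : 'I_m -> U -> C) :
  linear L0 -> (forall i, scalar_form (psi i)) ->
  (forall h, exists f, L0 f = h) ->
  (forall f, L f = L0 f - \sum_i psi i f *: x i) ->
  (forall f, L f = 0 -> f = 0) ->
  forall h, exists f, L f = h.
Proof.
move=> lL0 lpsi sL0 LE iL h.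
have psiD i f g : psi i (f + g) = psi i f + psi i g.
  by rewrite -{1}[f]scale1r lpsi mul1r.
have psi0 i : psi i 0 = 0.
  have := psiD i 0 0; rewrite addr0 => /eqP.
  by rewrite -subr_eq0 opprD addNKr oppr_eq0 => /eqP.
have psiZ i a f : psi i (a *: f) = a * psi i f.
  by rewrite -[a *: f]addr0 lpsi psi0 addr0.
have psi_sum i (c : 'I_m -> C) (F : 'I_m -> U) :
    psi i (\sum_j c j *: F j) = \sum_j c j * psi i (F j).
  by elim/big_rec2: _ => [|j a b _ H]; rewrite ?psi0 // psiD psiZ H.
have [y Hy] := boolp.choice (fun i => sL0 (x i)).
have L0sum (c : 'I_m -> C) : L0 (\sum_j c j *: y j) = \sum_j c j *: x j.
  by rewrite linear_sumE //; apply: eq_bigr => j _; rewrite linearZE // Hy.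
pose A : 'M[C]_m := \matrix_(i, j) ((i == j)%:R - psi i (y j)).
have AE (c : 'cV[C]_m) i : (A *m c) i 0 = c i 0 - \sum_j c j 0 * psi i (y j).
  rewrite mxE; transitivity (\sum_j ((i == j)%:R * c j 0 - c j 0 * psi i (y j))).
    by apply: eq_bigr => j _; rewrite mxE mulrBl [psi i _ * _]mulrC.
  rewrite sumrB; congr (_ - _).
  rewrite (bigD1 i) //= eqxx mul1r big1 ?addr0 // => j /negbTE.
  by rewrite eq_sym => ->; rewrite mul0r.
have uA : A \in unitmx.
  apply: unitmx_inj => c Ac.
  have cE i : c i 0 = \sum_j c j 0 * psi i (y j).
    by apply/eqP; rewrite -subr_eq0 -AE Ac mxE.
  have F0 : \sum_j c j 0 *: y j = 0.
    apply: iL; rewrite LE L0sum; apply/eqP; rewrite subr_eq0; apply/eqP.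
    by apply: eq_bigr => i _; rewrite psi_sum -cE.
  by apply/matrixP => i j; rewrite ord1 cE -psi_sum F0 psi0 mxE.
have [g Hg] := sL0 h.
pose c : 'cV[C]_m := invmx A *m \col_i psi i g.
exists (g + \sum_j c j 0 *: y j).
rewrite LE linearDE // Hg L0sum -addrA -[RHS]addr0; congr (_ + _).
apply/eqP; rewrite subr_eq0; apply/eqP; apply: eq_bigr => i _; congr (_ *: _).
have := AE c i; rewrite mulKVmx // mxE psiD psi_sum => ->.
by rewrite subrK.
Qed.

Variable hp : U -> U -> C.
Hypothesis hilb : hilbert hp.
Let hpH : herm_form hp. Proof. by case: hilb. Qed.
Local Notation nm := (nm hp).

(** The solution is the limit of the iterates of [f |-> h + T f]. *)
Lemma neumann (T : U -> U) (q : R) : linear T -> 0 <= q -> q < 1 ->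
  (forall f, nm (T f) <= q * nm f) -> forall h, exists f, f - T f = h.
Proof.
move=> lT q0 q1 Tq h.
pose u n := iter n (fun f => h + T f) 0.
have uS n : u n.+1 = h + T (u n) by [].
have q10 : 0 < 1 - q by rewrite subr_gt0.
pose B := nm h / (1 - q).
have uB k : nm (u k) <= B.
  elim: k => [|k IH]; first by rewrite /= nm0 // divr_ge0 ?nm_ge0 // ltW.
  rewrite uS; apply: le_trans (nmD hilb _ _) _.
  have : nm h + q * B <= B.
    by rewrite [leLHS](_ : _ = B) // /B; field; rewrite gt_eqF.
  apply: le_trans; rewrite lerD2l; apply: le_trans (Tq _) _.
  by rewrite ler_wpM2l.
have ud n k : nm (u (n + k)%N - u n) <= q ^+ n * B.
  elim: n => [|n IH]; first by rewrite expr0 mul1r add0n subr0.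
  rewrite addSn !uS opprD addrACA subrr add0r -linearBE //; apply: le_trans (Tq _) _.
  by rewrite exprS -mulrA ler_wpM2l.
have [l Hl] : exists l, forall eps : R, 0 < eps -> exists M, forall n,
    (M <= n)%N -> nm (u n - l) < eps.
  apply: hilbert_complete => // eps eps0.
  have [M HM] := geometric_small B q0 q1 eps0.
  exists M => m n Mm Mn.
  have [mn|/ltnW nm] := leqP m n.
    rewrite nmBC // -(subnKC mn); exact: le_lt_trans (ud _ _) (HM _ Mm).
  rewrite -(subnKC nm); exact: le_lt_trans (ud _ _) (HM _ Mn).
exists l; apply/eqP; rewrite -subr_eq0; apply/eqP; apply: (nm_eq0 hilb).
apply/le_anti; rewrite nm_ge0 andbT; apply/ler_addgt0Pr => eps eps0.
have [M HM] := Hl (eps / 2) (divr_gt0 eps0 (ltr0n _ 2)).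
have -> : l - T l - h = T (u M - l) - (u M.+1 - l).
  rewrite uS (linearBE _ _ lT) opprB opprD !addrA [RHS](ACl (3*2*4*1*5)) /=.
  by rewrite addrK.
rewrite add0r; apply: le_trans (nmB hilb _ _) _.
have := HM _ (leqnn M); have := HM _ (leqnSn M); have := Tq (u M - l).
have := nm_ge0 hp (u M - l); nra.
Qed.

(** An operator that is contractive on the common kernel of finitely many
    functionals becomes contractive everywhere after precomposition with the
    orthogonal projections along these functionals, one at a time. *)
Lemma contraction_mod_finite k (g : 'I_k -> U) (W : U -> U) : linear W ->
  (forall f, (forall i, hp f (g i) = 0) -> nm (W f) <= nm f) ->
  exists W' : U -> U, [/\ linear W', forall f, nm (W' f) <= nm f &
    exists m (x : 'I_m -> U) (psi : 'I_m -> U -> C),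
      (forall i, scalar_form (psi i)) /\
      forall f, W f = W' f + \sum_i psi i f *: x i].
Proof.
elim: k g W => [|k IH] g W lW HW.
  exists W; split=> //; first by move=> f; apply: HW => -[].
  exists 0%N, (fun _ => 0), (fun _ _ => 0); split; first by move=> [].
  by move=> f; rewrite big_ord0 addr0.
have [g0|g0] := eqVneq (g ord0) 0.
  apply: (IH (fun i => g (lift ord0 i))) => // f Hf; apply: HW => i.
  case: (unliftP ord0 i) => [j ->|->]; first exact: Hf.
  by rewrite g0 (ip0r hpH).
pose v := real_complex R (nm (g ord0))^-1 *: g ord0.
have ng := nm_gt0 hilb g0.
have nv : nm v = 1.
  by rewrite nmZ // cabs_real ?invr_ge0 ?ltW // mulVf // gt_eqF.
have vv : hp v v = 1 by rewrite (hp_nm hilb) nv expr1n.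
have gv : g ord0 = real_complex R (nm (g ord0)) *: v.
  by rewrite scalerA -rmorphM /= divff ?scale1r // gt_eqF.
move: v nv vv gv => v nv vv gv; pose P f := f - hp f v *: v.
have lP : linear P.
  move=> a f h; rewrite /P hpH.1 scalerDl scalerBr !scalerA opprD !addrA.
  by congr (_ - _); rewrite addrAC.
have Pv f : hp (P f) v = 0 by rewrite (ipBl hpH) (ipZl hpH) vv mulr1 subrr.
have PP f h : hp (P f) h = hp f (P h).
  by rewrite /P (ipBl hpH) (ipBr hpH) (ipZl hpH) (ipZr hpH) (ipC hpH v h) mulrC.
have nP f : nm (P f) <= nm f.
  rewrite -(@ler_pXn2r _ 2) ?nnegrE ?nm_ge0 //.
  have {2}-> : f = P f + hp f v *: v by rewrite subrK.
  rewrite [leRHS]nm_sqrD // (ipZr hpH) Pv mulr0 /= mulr0 addr0 lerDl.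
  exact: sqr_ge0.
have [||W' [lW' cW' [m [x [psi [lpsi HE]]]]]] :=
    IH (fun i => P (g (lift ord0 i))) (fun f => W (P f)).
- by move=> a f h; rewrite lP lW.
- move=> f Hf; apply: le_trans (nP f); apply: HW => i.
  case: (unliftP ord0 i) => [j ->|->]; first by rewrite PP Hf.
  by rewrite gv (ipZr hpH) Pv mulr0.
exists W'; split=> //; exists m.+1.
exists (fun i => if unlift ord0 i is Some j then x j else W v).
exists (fun i => if unlift ord0 i is Some j then psi j else hp ^~ v).
split=> [i|f]; first by case: (unlift ord0 i) => [j|] // a f h; rewrite hpH.1.
rewrite big_ord_recl unlift_none.
under eq_bigr => i _ do rewrite liftK.
rewrite addrCA -HE -linearZE // -linearDE //.
by rewrite /P addrCA subrr addr0.
Qed.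

(** For [b] inside the unit disk, [b W] is a strict contraction up to finite
    rank, so that injectivity of [1 - b W] implies its surjectivity. *)
Lemma fredholm k (g : 'I_k -> U) (W : U -> U) (b : C) : linear W ->
  (forall f, (forall i, hp f (g i) = 0) -> nm (W f) <= nm f) ->
  cabs b < 1 -> (forall f, f - b *: W f = 0 -> f = 0) ->
  forall h, exists f, f - b *: W f = h.
Proof.
move=> lW HW b1 inj.
have [W' [lW' cW' [m [x [psi [lpsi HE]]]]]] := contraction_mod_finite lW HW.
have lbW : linear (fun f => b *: W' f).
  by move=> a f h; rewrite lW' scalerDr !scalerA mulrC.
have bW f : nm (b *: W' f) <= cabs b * nm f.
  by rewrite nmZ // ler_wpM2l ?cabs_ge0.
apply: (@finite_rank_surj (fun f => f - b *: W' f) _ m (fun i => b *: x i) psi) => //.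
- move=> a f h; rewrite lbW scalerBr opprD !addrA; congr (_ - _).
  by rewrite addrAC.
- exact: neumann lbW (cabs_ge0 b) b1 bW.
- move=> f; rewrite HE scalerDr opprD addrA; congr (_ - _).
  rewrite scaler_sumr; apply: eq_bigr => i _.
  by rewrite !scalerA mulrC.
Qed.

End Fredholm.

(** * The Hilbert majorant of a Pontryagin space *)

Section ComplexComplete.
Variable R : realType.
Local Notation C := (Cplx R).

Lemma cabs_ReIm (z : C) : cabs z <= `|complex.Re z| + `|complex.Im z|.
Proof.
rewrite {1}[z]complexE; apply: le_trans (cabsD _ _) _.
rewrite cabsM !cabs_real_norm (_ : cabs _ = 1) ?mul1r //.
apply: (@complexI R); rewrite -cabsE normc_def /=.
by rewrite expr0n /= add0r expr1n sqrtr1.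
Qed.

Lemma Im_le_cabs (z : C) : `|complex.Im z| <= cabs z.
Proof.
rewrite -(@lecR R) -cabsE normc_def lecR -sqrtr_sqr ler_sqrt ?lerDr ?sqr_ge0 //.
by rewrite addr_ge0 ?sqr_ge0.
Qed.

Lemma real_cauchy (a : nat -> R) :
  (forall eps, 0 < eps -> exists M, forall m n, (M <= m)%N -> (M <= n)%N ->
     `|a m - a n| < eps) ->
  exists l, forall eps, 0 < eps -> exists M, forall n, (M <= n)%N -> `|a n - l| < eps.
Proof.
move=> ca; have : cvg (a @ \oo).
  apply/cauchy_cvgP/cauchy_exP => e e0; have [M HM] := ca e e0.
  by exists (a M); exists M => // n /= Mn; apply: HM.
move=> /cvg_ex [l Hl]; exists l => eps eps0.
move/cvgrPdist_lt: Hl => /(_ _ eps0) [M _ HM].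
by exists M => n /HM /=; rewrite distrC.
Qed.

Lemma complex_cauchy (a : nat -> C) :
  (forall eps, 0 < eps -> exists M, forall m n, (M <= m)%N -> (M <= n)%N ->
     cabs (a m - a n) < eps) ->
  exists l, forall eps, 0 < eps -> exists M, forall n, (M <= n)%N -> cabs (a n - l) < eps.
Proof.
move=> ca.
have [x Hx] : exists l, forall eps, 0 < eps -> exists M, forall n, (M <= n)%N ->
    `|complex.Re (a n) - l| < eps.
  apply: real_cauchy => eps /ca [M HM]; exists M => m n Mm Mn.
  rewrite -cReN -cReD; exact: le_lt_trans (Re_le_cabs_norm _) (HM _ _ Mm Mn).
have [y Hy] : exists l, forall eps, 0 < eps -> exists M, forall n, (M <= n)%N ->
    `|complex.Im (a n) - l| < eps.
  apply: real_cauchy => eps /ca [M HM]; exists M => m n Mm Mn.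
  have -> : complex.Im (a m) - complex.Im (a n) = complex.Im (a m - a n).
    by case: (a m) (a n) => [? ?] [].
  exact: le_lt_trans (Im_le_cabs _) (HM _ _ Mm Mn).
exists (Complex x y) => eps eps0.
have e2 : 0 < eps / 2 by rewrite divr_gt0.
have [M1 H1] := Hx _ e2; have [M2 H2] := Hy _ e2.
exists (maxn M1 M2) => n; rewrite geq_max => /andP[/H1 h1 /H2 h2].
apply: le_lt_trans (cabs_ReIm _) _.
move: h1 h2; case: (a n) => [u v] /=; lra.
Qed.

End ComplexComplete.

Lemma independent_bound (F : fieldType) (E : lmodType F) k m
    (b : 'I_k -> E) (h : 'I_m -> E) :
  (forall i, exists c : 'I_k -> F, h i = \sum_j c j *: b j) ->
  (forall x : 'I_m -> F, \sum_i x i *: h i = 0 -> forall i, x i = 0) -> (m <= k)%N.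
Proof.
move=> span indep; have [c Hc] := boolp.choice span.
rewrite leqNgt; apply/negP => km.
pose M : 'M[F]_(m, k) := \matrix_(i, j) c i j.
have : kermx M != 0.
  rewrite kermx_eq0; apply/negP => /eqP rM.
  by have := rank_leq_col M; rewrite rM leqNgt km.
case/rowV0Pn => v /sub_kermxP vM /negP; apply; apply/eqP.
apply/rowP => l; rewrite mxE; apply: (indep (fun j => v 0 j)).
transitivity (\sum_i (v *m M) 0 i *: b i); last first.
  by rewrite vM big1 // => i _; rewrite mxE scale0r.
under eq_bigr => j _ do rewrite Hc scaler_sumr.
rewrite exchange_big /=; apply: eq_bigr => i _.
rewrite mxE scaler_suml; apply: eq_bigr => j _.
by rewrite scalerA mxE.
Qed.

(** A maximal independent family of vectors of [W] generates [W]. *)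
Lemma finite_dim_basis (C : numClosedFieldType) (E : lmodType C) (W : set E) :
  lin_subspace W -> finite_dim W -> exists m (h : 'I_m -> E),
    (forall i, W (h i)) /\
    forall f, W f -> exists c : 'I_m -> C, f = \sum_i c i *: h i.
Proof.
move=> [W0 Wl] [k [b Hb]].
pose free m (h : 'I_m -> E) :=
  forall x : 'I_m -> C, \sum_i x i *: h i = 0 -> forall i, x i = 0.
pose P m := `[< exists h : 'I_m -> E, (forall i, W (h i)) /\ free m h >].
have P0 : exists m, P m.
  by exists 0%N; apply/asboolP; exists (fun=> 0); split=> [[]|x _ []].
have Pk m : P m -> (m <= k)%N.
  by move=> /asboolP [h [Wh fh]]; apply: (independent_bound (fun i => Hb _ (Wh i))).
have [m /asboolP [h [Wh fh]] mmax] := ex_maxnP P0 Pk.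
exists m, h; split=> // f Wf; apply: contrapT => nspan.
pose h' (i : 'I_m.+1) := if unlift ord0 i is Some j then h j else f.
have : P m.+1.
  apply/asboolP; exists h'; split=> [i|x].
    by rewrite /h'; case: (unlift ord0 i).
  rewrite big_ord_recl /h' unlift_none.
  under eq_bigr => i _ do rewrite liftK.
  move=> E0; have x0 : x ord0 = 0.
    apply: contrapT => /eqP x0; apply: nspan.
    exists (fun i => - (x ord0)^-1 * x (lift ord0 i)).
    move/eqP: E0; rewrite addr_eq0 => /eqP E0.
    rewrite -[f]scale1r -(mulVf x0) -scalerA E0 scalerN scaler_sumr -sumrN.
    by apply: eq_bigr => i _; rewrite scalerA mulNr scaleNr.
  move: E0; rewrite x0 scale0r add0r => /fh xl i.
  by case: (unliftP ord0 i) => [j ->|->]; [exact: xl | exact: x0].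
by move=> /mmax; rewrite ltnn.
Qed.

Section Pontryagin.
Variables (R : realType) (U : lmodType (Cplx R)).
Local Notation C := (Cplx R).
Variable ip : U -> U -> C.
Hypothesis ipH : herm_form ip.

Section NegativeBasis.
Variable Vm : set U.
Hypothesis Vm_lin : lin_subspace Vm.
Hypothesis Vm_neg : forall h, Vm h -> h != 0 -> ip h h < 0.
Hypothesis Vm_fin : finite_dim Vm.

Definition negative_orthonormal m (h : 'I_m -> U) : Prop :=
  forall i j, ip (h i) (h j) = - (i == j)%:R.

Lemma negative_orthonormal_coord m (h : 'I_m -> U) (c : 'I_m -> C) i :
  negative_orthonormal h -> ip (\sum_j c j *: h j) (h i) = - c i.
Proof.
move=> oh; rewrite (ip_suml ipH) (bigD1 i) //= (ipZl ipH) oh eqxx mulrN1.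
rewrite big1 ?addr0 // => j /negbTE ji.
by rewrite (ipZl ipH) oh ji oppr0 mulr0.
Qed.

Lemma subspace_sum m (c : 'I_m -> C) (h : 'I_m -> U) :
  (forall i, Vm (h i)) -> Vm (\sum_i c i *: h i).
Proof.
move=> Vh; elim/big_ind: _ => [|x y Vx Vy|i _]; first exact: Vm_lin.1.
  by have := Vm_lin.2 1 _ _ Vx Vy; rewrite scale1r.
by have := Vm_lin.2 (c i) _ _ (Vh i) Vm_lin.1; rewrite addr0.
Qed.

Lemma negative_orthonormal_bound : exists k, forall m (h : 'I_m -> U),
  (forall i, Vm (h i)) -> negative_orthonormal h -> (m <= k)%N.
Proof.
have [k [b Hb]] := Vm_fin; exists k => m h Vh oh.
apply: (independent_bound (fun i => Hb _ (Vh i))) => x x0 i.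
have := negative_orthonormal_coord x i oh.
by rewrite x0 (ip0l ipH) => /esym/eqP; rewrite oppr_eq0 => /eqP.
Qed.

(** A maximal orthonormal family works: the remainder of the expansion of a
    vector could otherwise be normalized and added to the family. *)
Lemma negative_orthonormal_basis : exists k (h : 'I_k -> U),
  [/\ forall i, Vm (h i), negative_orthonormal h &
      forall f, Vm f -> f = - \sum_i ip f (h i) *: h i].
Proof.
have [k Hk] := negative_orthonormal_bound.
pose P m := `[< exists h : 'I_m -> U, (forall i, Vm (h i)) /\ negative_orthonormal h >].
have P0 : exists m, P m by exists 0%N; apply/asboolP; exists (fun=> 0); split; case.
have Pk m : P m -> (m <= k)%N by move=> /asboolP [h [Vh oh]]; exact: Hk Vh oh.
have [m /asboolP [h [Vh oh]] mmax] := ex_maxnP P0 Pk.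
exists m, h; split=> // f Vf; apply/eqP; rewrite -addr_eq0; apply/negP => /negP g0.
set g := _ + _ in g0.
have Vg : Vm g.
  by have := Vm_lin.2 1 _ _ Vf (subspace_sum (fun i => ip f (h i)) Vh); rewrite scale1r.
have gh i : ip g (h i) = 0.
  by rewrite (ipDl ipH) negative_orthonormal_coord // subrr.
have hg i : ip (h i) g = 0 by rewrite (ipC ipH) gh conjC0.
have n0 : 0 < - ip g g by rewrite oppr_gt0 Vm_neg.
pose s := sqrtC (- ip g g).
have s0 : 0 < s by rewrite sqrtC_gt0.
pose h' (i : 'I_m.+1) := if unlift ord0 i is Some j then h j else s^-1 *: g.
have : P m.+1.
  apply/asboolP; exists h'; split=> [i|i j].
    rewrite /h'; case: (unlift ord0 i) => [j|] //.
    by have := Vm_lin.2 s^-1 _ _ Vg Vm_lin.1; rewrite addr0.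
  rewrite /h'; case: (unliftP ord0 i) => [i' ->|->];
    case: (unliftP ord0 j) => [j' ->|->]; rewrite ?liftK ?unlift_none.
  - by rewrite oh (inj_eq (@lift_inj _ _)).
  - by rewrite (ipZr ipH) hg mulr0 eq_sym (negbTE (neq_lift _ _)) oppr0.
  - by rewrite (ipZl ipH) gh mulr0 (negbTE (neq_lift _ _)) oppr0.
  - rewrite (ipZl ipH) (ipZr ipH) eqxx.
    have -> : (s^-1)^* = s^-1.
      by apply: (@conj_Creal C); rewrite realV ger0_real // ltW.
    have -> : ip g g = - s ^+ 2 by rewrite sqrtCK opprK.
    by rewrite /=; field; rewrite gt_eqF.
by move=> /mmax; rewrite ltnn.
Qed.

End NegativeBasis.

(** Adding twice the squared components along an orthonormal basis of the
    negative part changes its sign, which turns the indefinite form into a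
    Hilbert space inner product. *)
Definition majorant k (h : 'I_k -> U) (f g : U) : C :=
  ip f g + 2 * \sum_i ip f (h i) * ip (h i) g.

Lemma majorant_herm k (h : 'I_k -> U) : herm_form (majorant h).
Proof.
split=> [a f g x|f g]; rewrite /majorant.
  rewrite ipH.1.
  have -> : \sum_i ip (a *: f + g) (h i) * ip (h i) x =
      a * \sum_i ip f (h i) * ip (h i) x + \sum_i ip g (h i) * ip (h i) x.
    rewrite mulr_sumr -big_split /=; apply: eq_bigr => i _.
    by rewrite ipH.1 mulrDl mulrA.
  ring.
rewrite rmorphD rmorphM /= -(ipC ipH) rmorph_sum /= rmorph_nat.
congr (_ + _ * _); apply: eq_bigr => i _.
by rewrite rmorphM /= -!(ipC ipH) mulrC.
Qed.

(** With [P] the projection along the negative vectors [h i], the majorant of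
    [f] is [|P f|^2 + sum_i |(f, h i)|^2]. A Cauchy sequence for it therefore
    converges in the positive summand, which is complete, and in finitely many
    coordinates. *)
Lemma pontryagin_majorant : pontryagin setT ip ->
  exists k (h : 'I_k -> U), negative_orthonormal h /\ hilbert (majorant h).
Proof.
case=> _ _ [Vp [Vm [[Vp_lin Vm_lin] _ dec orth [Vp_pos Vp_comp Vm_neg Vm_fin]]]].
have [k [h [Vh oh hspan]]] := negative_orthonormal_basis Vm_lin Vm_neg Vm_fin.
exists k, h; split=> //.
pose P f := f + \sum_i ip f (h i) *: h i.
have VP f : Vp (P f).
  have [g [m [Vg Vm' ->]]] := dec f I.
  have -> : P (g + m) = g; last by [].
  rewrite /P {1}(hspan _ Vm') -addrA addrC -[RHS]add0r; congr (_ + _).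
  rewrite addrC; apply/eqP; rewrite subr_eq0; apply/eqP; apply: eq_bigr => i _.
  by rewrite (ipDl ipH) (orth _ _ Vg (Vh i)) add0r.
have Ph f i : ip (P f) (h i) = 0.
  by rewrite (ipDl ipH) negative_orthonormal_coord // subrr.
have PPE f : majorant h f f = ip (P f) (P f) + \sum_i `|ip f (h i)| ^+ 2.
  have -> : ip (P f) (P f) = ip (P f) f.
    rewrite {2}/P (ipDr ipH) (ip_sumr ipH) big1 ?addr0 // => i _.
    by rewrite (ipZr ipH) Ph mulr0.
  rewrite /P (ipDl ipH) (ip_suml ipH) /majorant -addrA; congr (_ + _).
  rewrite mulr_natl mulr2n; congr (_ + _); apply: eq_bigr => i _.
    by rewrite (ipZl ipH).
  by rewrite normCK -(ipC ipH).
have sq_ge0 f : 0 <= \sum_i `|ip f (h i)| ^+ 2 by apply: sumr_ge0 => i _; rewrite exprn_ge0.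
have Pp_ge0 f : 0 <= ip (P f) (P f).
  have [->|/(Vp_pos _ (VP f))/ltW //] := eqVneq (P f) 0.
  by rewrite (ip0l ipH).
split; first exact: majorant_herm.
  move=> f f0; rewrite PPE lt0r addr_ge0 // andbT.
  apply/negP; rewrite paddr_eq0 // => /andP[Pf0].
  rewrite psumr_eq0 => [/allP Hi|i _]; last by rewrite exprn_ge0.
  have Pf : P f = f.
    rewrite /P big1 ?addr0 // => i _.
    have := Hi i (mem_index_enum _) => /=; rewrite expf_eq0 /= normr_eq0 => /eqP ->.
    by rewrite scale0r.
  have Vf : Vp f by rewrite -Pf; exact: VP.
  by move: (Vp_pos _ Vf f0) Pf0; rewrite Pf => /gt_eqF ->.
move=> u _ cu.
have PB f g : P (f - g) = P f - P g.
  rewrite /P opprD addrACA -sumrB; congr (_ + _); apply: eq_bigr => i _.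
  by rewrite (ipBl ipH) scalerBl.
have [l Vl Hl] : exists2 l, Vp l & forall eps : C, 0 < eps -> exists M, forall n,
    (M <= n)%N -> ip (P (u n) - l) (P (u n) - l) < eps.
  apply: Vp_comp => // eps /cu [M HM]; exists M => m n Mm Mn.
  rewrite -PB; apply: le_lt_trans (HM _ _ Mm Mn).
  by rewrite PPE lerDl.
have Hc i : exists c : C, forall eps, 0 < eps -> exists M, forall n, (M <= n)%N ->
    cabs (ip (u n) (h i) - c) < eps.
  apply: complex_cauchy => eps eps0.
  have [|M HM] := cu (real_complex R (eps ^+ 2)).
    by rewrite (@ltcR R 0) exprn_gt0.
  exists M => m n Mm Mn.
  rewrite -(@ltr_pXn2r _ 2) ?nnegrE ?cabs_ge0 ?(ltW eps0) // -(@ltcR R).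
  apply: le_lt_trans (HM _ _ Mm Mn).
  rewrite PPE rmorphXn /= -cabsE -(ipBl ipH) (bigD1 i) //= addrCA lerDl.
  by rewrite addr_ge0 // sumr_ge0 // => j _; rewrite exprn_ge0.
have [c Hc'] := boolp.choice Hc.
pose L := l - \sum_i c i *: h i.
have lh i : ip l (h i) = 0 by exact: orth.
have Lh i : ip L (h i) = c i.
  by rewrite (ipBl ipH) lh sub0r negative_orthonormal_coord // opprK.
have PL : P L = l.
  rewrite /P; under eq_bigr => i _ do rewrite Lh.
  by rewrite subrK.
exists L => // eps eps0.
have er := real_complexE0 (ltW eps0); have er0 : 0 < complex.Re eps.
  by rewrite -(@ltcR R) -er.
set e := complex.Re eps in er er0.
have k0 : 0 < k.+1%:R :> R by rewrite ltr0n.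
pose d := e / 2 / k.+1%:R.
have d0 : 0 < d by rewrite !divr_gt0.
have [|M1 H1] := Hl (real_complex R (e / 2)); first by rewrite (@ltcR R 0) divr_gt0.
have [M2 H2] : exists M, forall i n, (M <= n)%N -> cabs (ip (u n) (h i) - c i) < Num.sqrt d.
  have sd : 0 < Num.sqrt d by rewrite sqrtr_gt0.
  have [M HM] := boolp.choice (fun i => Hc' i _ sd).
  exists (\max_i M i)%N => i n Mn; apply: HM; apply: leq_trans Mn.
  exact: (leq_bigmax i).
exists (maxn M1 M2) => n; rewrite geq_max => /andP[/H1 h1 Mn].
rewrite PPE PB PL er.
have : \sum_i `|ip (u n - L) (h i)| ^+ 2 <= real_complex R (e / 2) :> C.
  apply: (@le_trans _ _ (\sum_(i < k) real_complex R d)).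
    apply: ler_sum => i _; rewrite (ipBl ipH) Lh cabsE -rmorphXn /= (@lecR R).
    rewrite -[leRHS]sqr_sqrtr ?(ltW d0) // ler_pXn2r ?nnegrE ?cabs_ge0 ?sqrtr_ge0 //.
    exact/ltW/H2.
  rewrite sumr_const card_ord -rmorphMn /= (@lecR R) /d -mulr_natr -[leLHS]mulrA.
  rewrite ger_pMr ?divr_gt0 // mulrC ler_pdivrMr // mul1r ler_nat //.
move=> h2; have -> : real_complex R e = real_complex R (e / 2) + real_complex R (e / 2) :> C.
  by rewrite -rmorphD /= -splitr.
exact: ltr_leD.
Qed.

End Pontryagin.

(** * Power series *)

Section PowerSeries.
Variable R : realType.
Local Notation C := (Cplx R).

Lemma cvg_cabs (u : nat -> C) (l : C) : u @ \oo --> l ->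
  forall eps : R, 0 < eps -> exists M, forall n, (M <= n)%N -> cabs (u n - l) < eps.
Proof.
move=> /cvgrPdist_lt ul eps eps0.
have [|M _ HM] := ul (real_complex R eps); first by rewrite (@ltcR R 0).
exists M => n /HM /=; rewrite cabsC cabsE.
by rewrite (@ltcR R).
Qed.

(** Uniform control of the tails of a power series; most uses of analyticity
    below only need the Taylor coefficients [a] and this estimate. *)
Definition taylor (f : C -> C) (c : C) (a : nat -> C) (rho B : R) : Prop :=
  [/\ 0 < rho, 0 <= B, forall k, cabs (a k) * rho ^+ k <= B &
   forall N z, cabs (z - c) < rho ->
     cabs (f z - \sum_(j < N) a j * (z - c) ^+ j) <=
       B * (cabs (z - c) / rho) ^+ N / (1 - cabs (z - c) / rho)].

Lemma geometric_sum_le (q : R) (N n : nat) : 0 <= q -> q < 1 ->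
  \sum_(N <= j < n) q ^+ j <= q ^+ N / (1 - q).
Proof.
move=> q0 q1; have p0 : 0 < 1 - q by rewrite subr_gt0.
have [nN|/ltnW Nn] := leqP n N.
  by rewrite big_geq // divr_ge0 ?exprn_ge0 // ltW.
rewrite ler_pdivlMr //.
have -> : (\sum_(N <= j < n) q ^+ j) * (1 - q) = q ^+ N - q ^+ n.
  rewrite mulr_suml -(opprB (q ^+ n)) -(telescope_sumr _ Nn) -sumrN.
  by apply: eq_bigr => j _; rewrite exprS; ring.
by rewrite gerBl exprn_ge0.
Qed.

(** The terms of a series convergent at the radius [rho] are bounded there,
    which makes the series geometric inside. *)
Lemma analytic_taylor f c : analytic_at f c ->
  exists a rho B, taylor f c a rho B.
Proof.
move=> [a [rho' [rho0 Hf]]]; exists a.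
have rr := real_complexE0 (ltW rho0).
set r1 := complex.Re rho' in rr.
have r10 : 0 < r1 by rewrite -(@ltcR R) -rr.
pose rho := r1 / 2; have rho_gt0 : 0 < rho by rewrite divr_gt0.
have in_disk z : cabs (z - c) <= rho -> `|z - c| < rho'.
  move=> H; rewrite cabsE rr (@ltcR R); apply: le_lt_trans H _.
  by rewrite ltr_pdivrMr // ltr_pMr // ltr1n.
have cvg_part z : cabs (z - c) <= rho -> forall eps : R, 0 < eps ->
    exists M, forall n, (M <= n)%N ->
      cabs (\sum_(0 <= j < n) a j * (z - c) ^+ j - f z) < eps.
  by move=> /in_disk/Hf; exact: cvg_cabs.
pose z1 := c + real_complex R rho.
have z1c : z1 - c = real_complex R rho by rewrite /z1 addrC addKr.
have cz1 : cabs (z1 - c) = rho by rewrite z1c cabs_real // ltW.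
have cz1' : cabs (z1 - c) <= rho by rewrite cz1.
have [M HM] := cvg_part z1 cz1' 1 ltr01.
pose B := 2 + \sum_(0 <= k < M) cabs (a k) * rho ^+ k.
have s0 : 0 <= \sum_(0 <= k < M) cabs (a k) * rho ^+ k.
  by apply: sumr_ge0 => k _; rewrite mulr_ge0 ?cabs_ge0 ?exprn_ge0 // ltW.
have Ba k : cabs (a k) * rho ^+ k <= B.
  have [Mk|kM] := leqP M k.
    have -> : cabs (a k) * rho ^+ k = cabs (a k * (z1 - c) ^+ k).
      by rewrite cabsM cabsX cz1.
    have := HM _ Mk; have := HM _ (leqW Mk).
    rewrite big_nat_recr //=; set S := \sum_(_ <= _ < _) _ => h1 h2.
    have -> : a k * (z1 - c) ^+ k = (S + a k * (z1 - c) ^+ k - f z1) - (S - f z1).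
      by move: (f z1) (a k * _) => x y; ring.
    apply: le_trans (cabsB _ _) _; apply: le_trans (lerD (ltW h1) (ltW h2)) _.
    by rewrite /B -[1 + 1]/(2%:R) lerDl.
  rewrite /B (big_cat_nat (n := k)) ?leq0n ?(ltnW kM) //= [X in _ <= 2 + (_ + X)]big_ltn //.
  have pos m n' : 0 <= \sum_(m <= j < n') cabs (a j) * rho ^+ j.
    by apply: sumr_ge0 => j _; rewrite mulr_ge0 ?cabs_ge0 ?exprn_ge0 // ltW.
  move: (pos 0%N k) (pos k.+1 M).
  move: (\sum_(0 <= j < k) _) (\sum_(k.+1 <= j < M) _) (_ * _) => x y z; lra.
exists rho, B; split=> //; first by rewrite addr_ge0.
move=> N z zr; set q := cabs (z - c) / rho.
have q0 : 0 <= q by rewrite divr_ge0 ?cabs_ge0 // ltW.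
have q1 : q < 1 by rewrite ltr_pdivrMr // mul1r.
apply/ler_addgt0Pr => eps eps0.
have [M' HM'] := cvg_part z (ltW zr) eps eps0.
pose n := maxn N M'.
have := HM' n (leq_maxr _ _).
rewrite (big_cat_nat (n := N)) ?leq0n ?leq_maxl //=.
rewrite big_mkord; set S := \sum_(j < N) _; set T := \sum_(_ <= _ < _) _ => h.
have -> : f z - S = T - (S + T - f z).
  by clear; move: (f z) S T => x y t; ring.
apply: le_trans (cabsB _ _) _; apply: lerD; last exact: ltW.
apply: le_trans (cabs_sum _ _ _) _.
apply: (@le_trans _ _ (\sum_(N <= j < n) B * q ^+ j)).
  apply: ler_sum => j _; rewrite cabsM cabsX /q expr_div_n mulrA mulrAC.
  by rewrite ler_wpM2r ?exprn_ge0 ?cabs_ge0 // ler_pdivlMr ?exprn_gt0 // Ba.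
rewrite -mulr_sumr -mulrA ler_wpM2l ?addr_ge0 //.
exact: geometric_sum_le.
Qed.

Lemma taylor_coef0 f c a rho B : taylor f c a rho B -> a 0%N = f c.
Proof.
case=> rho0 B0 _ /(_ 1%N c); rewrite subrr cabs0 => /(_ rho0).
rewrite big_ord_recl big_ord0 expr0 mulr1 addr0 mul0r expr1 mulr0 mul0r => H.
apply/eqP; rewrite eq_sym -subr_eq0 -cabs_eq0.
by apply/eqP/le_anti; rewrite H cabs_ge0.
Qed.

Lemma analytic_cont f c : analytic_at f c ->
  forall eps : R, 0 < eps -> exists d : R, 0 < d /\
    forall z : C, cabs (z - c) < d -> cabs (f z - f c) < eps.
Proof.
move=> /analytic_taylor [a [rho [B tf]]] eps eps0.
have a0 := taylor_coef0 tf; case: tf => rho0 B0 _ H.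
pose d := Num.min (rho / 2) (rho * eps / (2 * (B + 1))).
have B1 : 0 < B + 1 by rewrite ltr_wpDl.
have d0 : 0 < d by rewrite lt_min !divr_gt0 ?mulr_gt0.
exists d; split=> // z; rewrite lt_min => /andP[z1 z2].
have zr : cabs (z - c) < rho by apply: lt_trans z1 _; rewrite ltr_pdivrMr // ltr_pMr // ltr1n.
have := H 1%N z zr; rewrite big_ord_recl big_ord0 expr0 mulr1 addr0 a0 expr1.
move=> h; apply: le_lt_trans h _.
have {}z2 : cabs (z - c) * (2 * (B + 1)) < rho * eps by rewrite -ltr_pdivlMr // mulr_gt0.
have z1' : cabs (z - c) * 2 < rho by rewrite -ltr_pdivlMr.
have q1 : cabs (z - c) / rho < 1 / 2.
  by rewrite ltr_pdivrMr // mulrC mulrA mulr1 ltr_pdivlMr.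
have p0 : 0 < 1 - cabs (z - c) / rho by lra.
rewrite ltr_pdivrMr // mulrA ltr_pdivrMr //.
have -> : eps * (1 - cabs (z - c) / rho) * rho = eps * (rho - cabs (z - c)).
  by field; rewrite gt_eqF.
have := cabs_ge0 (z - c); nra.
Qed.

End PowerSeries.

(** * Averages over roots of unity *)

Section RootsOfUnity.
Variable R : realType.
Local Notation C := (Cplx R).

Lemma prim_root_exists n : (n > 0)%N -> exists z : C, n.-primitive_root z.
Proof.
pose p : {poly C} := 'X^n - 1; have [r Dp] := closed_field_poly_normal p.
move=> n_gt0; rewrite (monicP _) ?monicXnsubC // scale1r in Dp.
have rn1 : all n.-unity_root r by apply/allP=> z; rewrite -root_prod_XsubC -Dp.
have sz_r : (n < (size r).+1)%N.
  by rewrite -(size_prod_XsubC r id) -Dp size_XnsubC.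
have [|z] := hasP (has_prim_root n_gt0 rn1 _ sz_r); last by exists z.
by rewrite -separable_prod_XsubC -Dp separable_Xn_sub_1 // pnatr_eq0 -lt0n.
Qed.

Definition uroot (n : nat) : C :=
  if pselect (n > 0)%N is left n0 then projT1 (cid (prim_root_exists n0)) else 1.

Lemma urootP n : (n > 0)%N -> n.-primitive_root (uroot n).
Proof.
by move=> n0; rewrite /uroot; case: pselect => // n0'; case: (cid _).
Qed.

Lemma cabs_uroot n k : (n > 0)%N -> cabs (uroot n ^+ k) = 1.
Proof.
move=> n0; have un := prim_expr_order (urootP n0).
have : cabs (uroot n) ^+ n == 1 by rewrite -cabsX un cabs1.
by rewrite pexpr_eq1 ?cabs_ge0 // cabsX => /eqP ->; rewrite expr1n.
Qed.

Definition average n (F : C -> C) : C := n%:R^-1 * \sum_(k < n) F (uroot n ^+ k).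

(** The powers of a primitive root of unity sum to zero. *)
Lemma average_expr n j : (j < n)%N -> average n (fun u => u ^+ j) = (j == 0%N)%:R.
Proof.
move=> jn; have n0 : (n > 0)%N by apply: leq_trans jn.
have [->|j0] := eqVneq j 0%N.
  rewrite /average; under eq_bigr => k _ do rewrite expr0.
  by rewrite sumr_const card_ord mulVf // pnatr_eq0 -lt0n.
have zj : uroot n ^+ j != 1.
  rewrite -(prim_order_dvd (urootP n0)); apply/negP => /(dvdn_leq _).
  by rewrite lt0n j0 leqNgt jn => /(_ isT).
rewrite /average; under eq_bigr => k _ do rewrite -exprM mulnC exprM.
apply/eqP; rewrite mulf_eq0; apply/orP; right.
have := subrX1 (uroot n ^+ j) n.
rewrite -exprM mulnC exprM (prim_expr_order (urootP n0)) expr1n subrr => /esym/eqP.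
by rewrite mulf_eq0 subr_eq0 (negbTE zj).
Qed.

End RootsOfUnity.

Section AverageDiffQuot.
Variable R : realType.
Local Notation C := (Cplx R).

Lemma average_ext n (F G : C -> C) : (0 < n)%N ->
  (forall u, cabs u = 1 -> F u = G u) -> average n F = average n G.
Proof.
move=> n0 FG; congr (_ * _); apply: eq_bigr => k _.
by apply: FG; apply: cabs_uroot.
Qed.

Lemma averageD n (F G : C -> C) :
  average n (fun u => F u + G u) = average n F + average n G.
Proof. by rewrite /average big_split mulrDr. Qed.

Lemma averageZ n (a : C) (F : C -> C) :
  average n (fun u => a * F u) = a * average n F.
Proof. by rewrite /average -mulr_sumr mulrCA. Qed.

Lemma average_sum n N (F : 'I_N -> C -> C) :
  average n (fun u => \sum_i F i u) = \sum_i average n (F i).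
Proof. by rewrite /average exchange_big /= mulr_sumr. Qed.

Lemma cabs_average n (F : C -> C) (e : R) : (0 < n)%N ->
  (forall u, cabs u = 1 -> cabs (F u) <= e) -> cabs (average n F) <= e.
Proof.
move=> n0 HF; rewrite /average cabsM cabsV cabs_nat.
have n0' : 0 < n%:R :> R by rewrite ltr0n.
rewrite ler_pdivrMl //; apply: le_trans (cabs_sum _ _ _) _.
apply: (@le_trans _ _ (\sum_(k < n) e)).
  by apply: ler_sum => k _; apply: HF; apply: cabs_uroot.
by rewrite sumr_const card_ord mulr_natl.
Qed.

Lemma bernoulli_ineq (h : R) N : 0 <= h -> 1 + N%:R * h <= (1 + h) ^+ N.
Proof.
move=> h0; elim: N => [|N IH]; first by rewrite mul0r addr0 expr0.
rewrite exprS; apply: (@le_trans _ _ ((1 + h) * (1 + N%:R * h))).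
  rewrite -natr1; have : 0 <= N%:R :> R by rewrite ler0n.
  move: (N%:R : R) => x x0; nra.
by rewrite ler_wpM2l // addr_ge0.
Qed.

(** Bernoulli's inequality for a ratio [s] between [q] and [1] absorbs the
    linear factor. *)
Lemma nat_geometric_small (q B eps : R) : 0 < q -> q < 1 -> 0 <= B -> 0 < eps ->
  exists N0, forall N, (N0 <= N)%N -> N%:R * q ^+ N * B < eps.
Proof.
move=> q0 q1 B0 eps0.
pose s := (1 + q) / 2; pose h := s / q - 1.
have qs : q < s by rewrite /s; lra.
have s1 : s < 1 by rewrite /s; lra.
have s0 : 0 < s by apply: lt_trans qs.
have h0 : 0 < h by rewrite subr_gt0 ltr_pdivlMr // mul1r.
have [N0 HN] := geometric_small (B / h) (ltW s0) s1 eps0.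
exists N0 => N /HN; apply: le_lt_trans.
rewrite [leRHS]mulrA [leRHS]mulrAC ler_wpM2r //.
rewrite ler_pdivlMr //.
have -> : N%:R * q ^+ N * h = (N%:R * h) * q ^+ N by ring.
have -> : s = (1 + h) * q by rewrite /h addrC subrK divfK // gt_eqF.
rewrite exprMn ler_wpM2r ?exprn_ge0 ?(ltW q0) //.
by apply: le_trans (bernoulli_ineq N (ltW h0)); rewrite lerDr.
Qed.

(** Telescoping a difference quotient leaves the remainder term bounded here;
    this is the case of a point [c + v] outside the circle of radius [d],
    where the value [fw] is unrelated to the Taylor coefficients [a]. *)
Lemma poly_remainder_small (a : nat -> C) (rho B d : R) (fw v : C) :
  0 < d -> d < rho -> 0 <= B -> d < cabs v ->
  (forall k, cabs (a k) * rho ^+ k <= B) ->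
  forall eps, 0 < eps -> exists N0, forall N, (N0 <= N)%N ->
    cabs (fw - \sum_(j < N) a j * v ^+ j) * (d / cabs v) ^+ N < eps.
Proof.
move=> d0 dr B0 dv aB eps eps0.
have v0 : 0 < cabs v by apply: lt_trans dv.
have r0 : 0 < rho by apply: lt_trans dr.
pose s := Num.max (d / rho) (d / cabs v).
have s0 : 0 < s by rewrite lt_max divr_gt0.
have s1 : s < 1 by rewrite gt_max !ltr_pdivrMr // !mul1r dr.
have e2 : 0 < eps / 2 by rewrite divr_gt0.
have [N1 H1] := geometric_small (cabs fw) (ltW s0) s1 e2.
have [N2 H2] := nat_geometric_small s0 s1 B0 e2.
exists (maxn N1 N2) => N; rewrite geq_max => /andP[/H1 h1 /H2 h2].
have q0 : 0 <= d / cabs v by rewrite divr_ge0 // ltW.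
have q1 : 0 <= d / rho by rewrite divr_ge0 // ltW.
apply: (@le_lt_trans _ _ (s ^+ N * cabs fw + N%:R * s ^+ N * B)); last by lra.
apply: le_trans (ler_wpM2r (exprn_ge0 _ q0) (cabsB _ _)) _.
rewrite mulrDl; apply: lerD.
  rewrite mulrC ler_wpM2r ?cabs_ge0 //.
  by apply: lerXn2r; rewrite ?nnegrE ?(ltW s0) // le_max lexx orbT.
apply: le_trans (ler_wpM2r (exprn_ge0 _ q0) (cabs_sum _ _ _)) _.
rewrite mulr_suml -mulrA mulr_natl -[N in leRHS]card_ord -sumr_const.
apply: ler_sum => j _; rewrite cabsM cabsX.
move: (nat_of_ord j) (ltnW (ltn_ord j)) => {}j jN.
have -> : cabs (a j) * cabs v ^+ j * (d / cabs v) ^+ N =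
    (cabs (a j) * rho ^+ j) * ((d / rho) ^+ j * (d / cabs v) ^+ (N - j)).
  rewrite -{1}(subnKC jN) exprD !expr_div_n; field.
  by rewrite !expf_neq0 ?gt_eqF.
rewrite mulrC card_ord; have -> : s ^+ N = s ^+ j * s ^+ (N - j) by rewrite -exprD subnKC.
apply: ler_pM => //.
- by rewrite mulr_ge0 ?exprn_ge0.
- by rewrite mulr_ge0 ?cabs_ge0 ?exprn_ge0 // ltW.
- apply: ler_pM; rewrite ?exprn_ge0 //.
    by apply: lerXn2r; rewrite ?nnegrE ?(ltW s0) // le_max lexx.
  by apply: lerXn2r; rewrite ?nnegrE ?(ltW s0) // le_max lexx orbT.
Qed.

(** The case of a point [c + v] inside the circle, where the remainder of the
    Taylor series of [f] decays fast enough to beat [(d / |v|) ^ N]. *)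
Lemma taylor_remainder_small (f : C -> C) c a (rho B d : R) (v : C) :
  taylor f c a rho B -> 0 < d -> d < rho -> v != 0 -> cabs v < d ->
  forall eps, 0 < eps -> exists N0, forall N, (N0 <= N)%N ->
    cabs (f (c + v) - \sum_(j < N) a j * v ^+ j) * (d / cabs v) ^+ N < eps.
Proof.
case=> r0 B0 _ tf d0 dr v0 vd eps eps0.
have av0 : 0 < cabs v by rewrite cabs_gt0.
have q1 : d / rho < 1 by rewrite ltr_pdivrMr // mul1r.
have q0 : 0 <= d / rho by rewrite divr_ge0 // ltW.
have vr : cabs v < rho by apply: lt_trans vd dr.
have p0 : 0 < 1 - cabs v / rho by rewrite subr_gt0 ltr_pdivrMr // mul1r.
have [N0 H] := geometric_small (B / (1 - cabs v / rho)) q0 q1 eps0.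
exists N0 => N /H; apply: le_lt_trans.
have := tf N (c + v); rewrite [c + v]addrC addrK => /(_ vr) tN.
apply: le_trans (ler_wpM2r (exprn_ge0 _ (_ : 0 <= d / cabs v)) tN) _.
  by rewrite divr_ge0 // ltW.
rewrite le_eqVlt; apply/orP; left; apply/eqP.
rewrite !expr_div_n; clear - r0 av0 vr; move: (cabs v) av0 vr => w w0 wr.
by field; rewrite !expf_neq0 ?gt_eqF // subr_gt0.
Qed.

(** Averaging a difference quotient over a circle around [c], with the weight
    [1 + d u + u^2] normalized at the centre, reproduces its value at the
    centre. The weight has modulus [|2 Re u + d|] on the unit circle, so it
    damps exactly the points [xi (1 + d u)] close to the unit circle. *)
Lemma average_diff_quot (f : C -> C) c a (rho B d : R) (xi v fw : C) :
  taylor f c a rho B -> 0 < d -> d < rho -> cabs xi = 1 ->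
  v != 0 -> cabs v != d -> (cabs v < d -> fw = f (c + v)) ->
  forall eps, 0 < eps -> exists N0, forall N, (N0 <= N)%N ->
   let x u := xi * real_complex R d * u in
   cabs (average N.+3 (fun u => (1 + real_complex R d * u + u ^+ 2) *
        ((fw - f (c + x u)) / (v - x u))) - (fw - f c) / v) < eps.
Proof.
move=> tf d0 dr xi1 v0 vd fwE eps eps0.
have [r0 B0 aB tB] := tf.
have av0 : 0 < cabs v by rewrite cabs_gt0.
pose D := xi * real_complex R d.
have cD : cabs D = d by rewrite /D cabsM xi1 mul1r cabs_real // ltW.
pose g := `|cabs v - d|.
have g0 : 0 < g by rewrite normr_gt0 subr_eq0.
have gap u : cabs u = 1 -> g <= cabs (v - D * u).
  move=> u1; have Du : cabs (D * u) = d by rewrite cabsM cD u1 mulr1.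
  have := cabs_sub (D * u) v; have := cabs_sub v (D * u).
  rewrite Du [cabs (D * u - v)]cabsC /g ler_norml.
  by move: (cabs (v - D * u)) (cabs v) => y z; lra.
pose S N := fw - \sum_(j < N) a j * v ^+ j.
pose b m := S m.+1 / v ^+ m.+1.
(* The [b m] are the coefficients of the formal quotient of [fw - f (c + x)]
   by [v - x]. *)
have tele N x : (v - x) * \sum_(m < N) b m * x ^+ m =
    fw - \sum_(m < N) a m * x ^+ m - S N * (x / v) ^+ N.
  elim: N => [|N IH]; first by rewrite !big_ord0 /S big_ord0; ring.
  rewrite !big_ord_recr /= mulrDr IH /b /S big_ord_recr /=.
  rewrite !expr_div_n !exprS.
  move: (\sum_(i < N) a i * x ^+ i) (\sum_(i < N) a i * v ^+ i) => s1 s2.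
  have vN : v ^+ N != 0 by rewrite expf_neq0.
  by field; rewrite vN.
pose K := 2 + d; have K0 : 0 < K by rewrite addr_gt0.
pose e4 := eps * g / (4 * K).
have e40 : 0 < e4 by rewrite !(mulr_gt0, invr_gt0).
have [N1 H1] : exists N0, forall N, (N0 <= N)%N ->
    cabs (S N) * (d / cabs v) ^+ N < e4.
  have [vd'|vd'] := ltP (cabs v) d.
    by have := taylor_remainder_small tf d0 dr v0 vd' e40; rewrite -(fwE vd').
  have {}vd' : d < cabs v by rewrite lt_neqAle eq_sym vd.
  exact: poly_remainder_small d0 dr B0 vd' aB _ e40.
have q1 : d / rho < 1 by rewrite ltr_pdivrMr // mul1r.
have q0 : 0 <= d / rho by rewrite divr_ge0 // ltW.
have [N2 H2] := geometric_small (B / (1 - d / rho)) q0 q1 e40.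
exists (maxn (maxn N1 N2) 1) => N; rewrite !geq_max => /andP[/andP[/H1 h1 /H2 h2] Npos] /=.
pose q u : C := 1 + real_complex R d * u + u ^+ 2.
pose t (u : C) := f (c + D * u) - \sum_(m < N) a m * (D * u) ^+ m.
pose rem u := q u * ((S N * (D * u / v) ^+ N - t u) / (v - D * u)).
have qle u : cabs u = 1 -> cabs (q u) <= K.
  move=> u1; apply: le_trans (cabsD _ _) _; rewrite cabsX u1 expr1n.
  have := cabsD 1 (real_complex R d * u).
  rewrite cabs1 cabsM u1 mulr1 cabs_real ?(ltW d0) // /K.
  by move: (cabs _) => y; lra.
have remle u : cabs u = 1 -> cabs (rem u) <= eps / 2.
  move=> u1; have gp := gap u u1.
  have Du : cabs (D * u) = d by rewrite cabsM cD u1 mulr1.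
  rewrite /rem cabsM cabsM cabsV.
  have n1 : cabs (S N * (D * u / v) ^+ N - t u) <= 2 * e4.
    apply: le_trans (cabsB _ _) _.
    have -> : cabs (S N * (D * u / v) ^+ N) = cabs (S N) * (d / cabs v) ^+ N.
      by rewrite cabsM cabsX [cabs (D * u / v)]cabsM cabsV Du.
    have := tB N (c + D * u); rewrite [c + _]addrC addrK Du => /(_ dr).
    rewrite -/(t u) [D * u + c]addrC -/(t u) => tN.
    have : cabs (t u) <= e4.
      by apply: le_trans tN _; rewrite -mulrA mulrCA ltW.
    lra.
  apply: (@le_trans _ _ (K * (2 * e4 / g))).
    apply: ler_pM; rewrite ?cabs_ge0 ?qle //.
      by rewrite mulr_ge0 ?cabs_ge0 // invr_ge0 cabs_ge0.
    apply: ler_pM; rewrite ?cabs_ge0 ?invr_ge0 ?cabs_ge0 //.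
    by rewrite lef_pV2 ?posrE //; apply: lt_le_trans gp.
  rewrite le_eqVlt; apply/orP; left; apply/eqP; rewrite /e4; field.
  by rewrite !gt_eqF.
have n0 : (0 < N.+3)%N by [].
have -> : average N.+3 (fun u => q u * ((fw - f (c + D * u)) / (v - D * u))) =
    (fw - f c) / v + average N.+3 rem.
  have {1}-> : (fw - f c) / v = average N.+3 (fun u => \sum_(m < N)
      (b m * D ^+ m) * (u ^+ m + (real_complex R d * u ^+ m.+1 + u ^+ m.+2))).
    have avm m : (m < N)%N -> average N.+3 (fun u : C =>
        u ^+ m + (real_complex R d * u ^+ m.+1 + u ^+ m.+2)) = (m == 0%N)%:R.
      move=> mN; have m3 : (m < N.+3)%N by rewrite (leq_trans mN) // -addn3 leq_addr.
      have m2 : (m.+1 < N.+3)%N by rewrite ltnS (leq_trans mN) // -addn2 leq_addr.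
      have m1 : (m.+2 < N.+3)%N by rewrite !ltnS ltnW.
      by rewrite !averageD averageZ !average_expr //= mulr0 !addr0.
    rewrite average_sum; under eq_bigr => m _ do rewrite averageZ avm ?ltn_ord //.
    case: N {h1 h2 t rem remle n0 avm} Npos => // N _.
    rewrite big_ord_recl big1 => [|m _]; last by rewrite /= mulr0.
    rewrite /= addr0 mulr1 expr0 mulr1 /b /S big_ord_recl big_ord0 expr0 addr0 expr1.
    by rewrite (taylor_coef0 tf) mulr1.
  rewrite -averageD; apply: average_ext => // u u1.
  have dv : v - D * u != 0 by rewrite -cabs_gt0; apply: lt_le_trans (gap u u1).
  have tl := tele N (D * u).
  have -> : fw - f (c + D * u) = (v - D * u) * (\sum_(m < N) b m * (D * u) ^+ m) +
     (S N * (D * u / v) ^+ N - t u).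
    by rewrite tl /t; ring.
  rewrite /rem; set RR := _ - t u; set Sg := \sum_(m < N) _.
  have -> : ((v - D * u) * Sg + RR) / (v - D * u) = Sg + RR / (v - D * u).
    by rewrite mulrDl mulrAC divff // mul1r.
  rewrite mulrDr; congr (_ + _); rewrite mulr_sumr; apply: eq_bigr => m _.
  by rewrite exprMn !exprS /q; ring.
rewrite addrC addKr.
apply: le_lt_trans (cabs_average n0 remle) _; lra.
Qed.

End AverageDiffQuot.

(** * Adjoint matrices and continuous matrix functions *)

Section Adjoint.
Variable C : numClosedFieldType.

Lemma adjmxK m n (M : 'M[C]_(m, n)) : adjmx (adjmx M) = M.
Proof. by apply/matrixP => i j; rewrite !mxE conjCK. Qed.

Lemma adjmxM m n q (M : 'M[C]_(m, n)) (L : 'M[C]_(n, q)) :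
  adjmx (M *m L) = adjmx L *m adjmx M.
Proof. by rewrite /adjmx trmx_mul map_mxM. Qed.

Lemma adjmxD m n (M L : 'M[C]_(m, n)) : adjmx (M + L) = adjmx M + adjmx L.
Proof. by apply/matrixP => i j; rewrite !mxE rmorphD. Qed.

Lemma adjmxN m n (M : 'M[C]_(m, n)) : adjmx (- M) = - adjmx M.
Proof. by apply/matrixP => i j; rewrite !mxE rmorphN. Qed.

Lemma adjmxB m n (M L : 'M[C]_(m, n)) : adjmx (M - L) = adjmx M - adjmx L.
Proof. by rewrite adjmxD adjmxN. Qed.

Lemma adjmxZ m n a (M : 'M[C]_(m, n)) : adjmx (a *: M) = a^* *: adjmx M.
Proof. by apply/matrixP => i j; rewrite !mxE rmorphM. Qed.

Lemma adjmx0 m n : adjmx (0 : 'M[C]_(m, n)) = 0.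
Proof. by apply/matrixP => i j; rewrite !mxE conjC0. Qed.

Lemma adjmx_sum m n I (s : seq I) P (F : I -> 'M[C]_(m, n)) :
  adjmx (\sum_(i <- s | P i) F i) = \sum_(i <- s | P i) adjmx (F i).
Proof. by elim/big_rec2: _ => [|i x y _ H]; rewrite ?adjmx0 // adjmxD H. Qed.

Lemma adjmx_unit n (M : 'M[C]_n) : (adjmx M \in unitmx) = (M \in unitmx).
Proof. by rewrite /adjmx map_unitmx unitmx_tr. Qed.

Lemma adjmx_inv n (M : 'M[C]_n) : adjmx (invmx M) = invmx (adjmx M).
Proof. by rewrite /adjmx trmx_inv map_invmx. Qed.

Definition dot n (c v : 'cV[C]_n) : C := (adjmx c *m v) 0 0.

Lemma dotDr n (c v w : 'cV[C]_n) : dot c (v + w) = dot c v + dot c w.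
Proof. by rewrite /dot mulmxDr mxE. Qed.

Lemma dotNr n (c v : 'cV[C]_n) : dot c (- v) = - dot c v.
Proof. by rewrite /dot mulmxN mxE. Qed.

Lemma dotBr n (c v w : 'cV[C]_n) : dot c (v - w) = dot c v - dot c w.
Proof. by rewrite dotDr dotNr. Qed.

Lemma dotZr n a (c v : 'cV[C]_n) : dot c (a *: v) = a * dot c v.
Proof. by rewrite /dot -scalemxAr mxE. Qed.

Lemma dot0r n (c : 'cV[C]_n) : dot c 0 = 0.
Proof. by rewrite /dot mulmx0 mxE. Qed.

Lemma dotC n (c v : 'cV[C]_n) : dot c v = (dot v c)^*.
Proof.
rewrite /dot !mxE rmorph_sum; apply: eq_bigr => i _.
by rewrite !mxE rmorphM /= conjCK mulrC.
Qed.

Lemma dotDl n (c v w : 'cV[C]_n) : dot (v + w) c = dot v c + dot w c.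
Proof. by rewrite dotC dotDr rmorphD /= -!dotC. Qed.

Lemma dotZl n a (c v : 'cV[C]_n) : dot (a *: v) c = a^* * dot v c.
Proof. by rewrite dotC dotZr rmorphM /= -dotC. Qed.

Lemma dot_mulmx m n (c : 'cV[C]_m) (M : 'M_(m, n)) v :
  dot c (M *m v) = dot (adjmx M *m c) v.
Proof. by rewrite /dot adjmxM adjmxK mulmxA. Qed.

Lemma dotBl n (c v w : 'cV[C]_n) : dot (v - w) c = dot v c - dot w c.
Proof. by rewrite dotC dotBr rmorphB /= -!dotC. Qed.

Lemma dot_mulmxl m n (c : 'cV[C]_m) (M : 'M_(m, n)) v :
  dot (M *m v) c = dot v (adjmx M *m c).
Proof. by rewrite dot_mulmx adjmxK. Qed.

Lemma dot_delta n (v : 'cV[C]_n) i : dot (delta_mx i 0) v = v i 0.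
Proof.
rewrite /dot mxE (bigD1 i) //= !mxE !eqxx conjC1 mul1r big1 ?addr0 // => j ji.
by rewrite !mxE (negbTE ji) conjC0 mul0r.
Qed.

Lemma dot_eq0 n (v : 'cV[C]_n) : (forall c, dot c v = 0) -> v = 0.
Proof. by move=> H; apply/colP => i; rewrite -dot_delta H mxE. Qed.

Lemma mulmx_delta_inj m n (M L : 'M[C]_(m, n)) :
  (forall v : 'cV_n, M *m v = L *m v) -> M = L.
Proof.
move=> H; apply/matrixP => i j; have /colP/(_ i) := H (delta_mx j 0).
by rewrite -!colE !mxE.
Qed.

End Adjoint.

Section Continuity.
Variable R : realType.
Local Notation C := (Cplx R).

Lemma continuous_cabsP (g : C -> C) s : {for s, continuous g} <->
  forall eps : R, 0 < eps -> exists d : R, 0 < d /\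
    forall z, cabs (z - s) < d -> cabs (g z - g s) < eps.
Proof.
split=> [/cvgrPdist_lt gc eps eps0|H].
  have := gc (real_complex R eps); rewrite (@ltcR R 0) => /(_ eps0).
  move=> /nbhs_ballP [d d0 Hd].
  have dr := real_complexE0 (ltW (d0 : 0 < (d : C))).
  exists (complex.Re d); split; first by rewrite -(@ltcR R) -dr.
  move=> z zs; have /Hd /= : ball s d z by rewrite /ball /= cabsE dr (@ltcR R) cabsC.
  by rewrite cabsE (@ltcR R) cabsC.
have FF : Filter (nbhs s) by exact: nbhs_filter.
apply: (cvgrPdist_lt (FF := FF) g (g s)).2 => eps eps0.
have er := real_complexE0 (ltW eps0).
have [|d [d0 Hd]] := H (complex.Re eps); first by rewrite -(@ltcR R) -er.
apply/nbhs_ballP; exists (real_complex R d); first by rewrite /= (@ltcR R 0).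
move=> z; rewrite /ball /= => zs; rewrite er cabsE (@ltcR R) cabsC.
by apply: Hd; rewrite cabsC -(@ltcR R) -cabsE.
Qed.

Lemma analytic_continuous (f : C -> C) c : analytic_at f c -> {for c, continuous f}.
Proof. by move=> fa; apply/continuous_cabsP; exact: analytic_cont. Qed.

Lemma continuous_local (f g : C -> C) s (d : R) : 0 < d ->
  (forall z, cabs (z - s) < d -> f z = g z) ->
  {for s, continuous f} -> {for s, continuous g}.
Proof.
move=> d0 fg /continuous_cabsP fc; apply/continuous_cabsP => eps /fc [d' [d'0 H]].
exists (Num.min d d'); split; first by rewrite lt_min d0.
move=> z; rewrite lt_min => /andP[zd zd'].
by rewrite -!fg ?subrr ?cabs0 // H.
Qed.

Lemma continuous_zero (g : C -> C) s : {for s, continuous g} ->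
  (forall d : R, 0 < d -> exists t, cabs (t - s) < d /\ g t = 0) -> g s = 0.
Proof.
move=> /continuous_cabsP gc H; apply/eqP; rewrite -cabs_eq0; apply/negP => /negP g0.
have gs : 0 < cabs (g s) by rewrite lt0r g0 cabs_ge0.
have [d [d0 Hd]] := gc _ gs; have [t [ts gt]] := H d d0.
by have := Hd t ts; rewrite gt sub0r cabsN ltxx.
Qed.

(** Continuity is entrywise, which keeps the topology of matrices out of the
    arguments. *)
Definition mcont m n (F : C -> 'M[C]_(m, n)) (s : C) : Prop :=
  forall i j, {for s, continuous (fun z => F z i j)}.

Lemma mcont_const m n (M : 'M[C]_(m, n)) s : mcont (fun=> M) s.
Proof. by move=> i j; exact: cst_continuous. Qed.

Lemma mcontD m n (F G : C -> 'M[C]_(m, n)) s :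
  mcont F s -> mcont G s -> mcont (fun z => F z + G z) s.
Proof.
move=> Fc Gc i j; have -> : (fun z => (F z + G z) i j) = (fun z => F z i j + G z i j).
  by apply/funext => z; rewrite mxE.
by apply: continuousD; [exact: Fc | exact: Gc].
Qed.

Lemma mcontZ m n (a : C -> C) (F : C -> 'M[C]_(m, n)) s :
  {for s, continuous a} -> mcont F s -> mcont (fun z => a z *: F z) s.
Proof.
move=> ac Fc i j; have -> : (fun z => (a z *: F z) i j) = (fun z => a z * F z i j).
  by apply/funext => z; rewrite mxE.
by apply: continuousM; [exact: ac | exact: Fc].
Qed.

Lemma mcontB m n (F G : C -> 'M[C]_(m, n)) s :
  mcont F s -> mcont G s -> mcont (fun z => F z - G z) s.
Proof.
move=> Fc Gc; apply: (@mcontD _ _ F (fun z => - G z) s Fc) => i j.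
have -> : (fun z => (- G z) i j) = (fun z => - G z i j).
  by apply/funext => z; rewrite mxE.
by apply: continuousN; exact: Gc.
Qed.

Lemma continuous_sum (I : Type) (r : seq I) (F : I -> C -> C) s :
  (forall i, {for s, continuous (F i)}) ->
  {for s, continuous (fun z => \sum_(i <- r) F i z)}.
Proof.
move=> Fc; elim: r => [|i r IH].
  have -> : (fun z => \sum_(i <- [::]) F i z) = (fun=> 0 : C).
    by apply/funext => z; rewrite big_nil.
  exact: cst_continuous.
have -> : (fun z => \sum_(j <- i :: r) F j z) = (fun z => F i z + \sum_(j <- r) F j z).
  by apply/funext => z; rewrite big_cons.
by apply: continuousD; [exact: Fc | exact: IH].
Qed.

Lemma mcontM m n q (F : C -> 'M[C]_(m, n)) (G : C -> 'M[C]_(n, q)) s :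
  mcont F s -> mcont G s -> mcont (fun z => F z *m G z) s.
Proof.
move=> Fc Gc i j.
have -> : (fun z => (F z *m G z) i j) = (fun z => \sum_k F z i k * G z k j).
  by apply/funext => z; rewrite mxE.
apply: continuous_sum => k; apply: continuousM; [exact: Fc | exact: Gc].
Qed.

Lemma mcont_local m n (F G : C -> 'M[C]_(m, n)) s (d : R) : 0 < d ->
  (forall z, cabs (z - s) < d -> F z = G z) -> mcont F s -> mcont G s.
Proof.
move=> d0 FG Fc i j; apply: (continuous_local d0 _ (Fc i j)) => z zs.
by rewrite FG.
Qed.

Lemma mcont_zero m n (F : C -> 'M[C]_(m, n)) s : mcont F s ->
  (forall d : R, 0 < d -> exists t, cabs (t - s) < d /\ F t = 0) -> F s = 0.
Proof.
move=> Fc H; apply/matrixP => i j; rewrite [RHS]mxE.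
apply: (continuous_zero (Fc i j)) => d /H [t [ts Ft]].
by exists t; rewrite Ft mxE.
Qed.

Lemma continuous_affine (a b : C) s : {for s, continuous (fun z : C => a - z * b)}.
Proof.
apply: continuousB; first exact: cst_continuous.
by apply: continuousM; [exact: cvg_id | exact: cst_continuous].
Qed.

Lemma injective_avoid (u : nat -> C) (B : seq C) K : injective u ->
  exists2 k, (K <= k)%N & u k \notin B.
Proof.
move=> iu; apply: contrapT => H.
have : size [seq u (K + i)%N | i <- iota 0 (size B).+1] = (size B).+1.
  by rewrite size_map size_iota.
have us : uniq [seq u (K + i)%N | i <- iota 0 (size B).+1].
  by rewrite map_inj_uniq ?iota_uniq // => i j /iu /addnI.
have sub : {subset [seq u (K + i)%N | i <- iota 0 (size B).+1] <= B}.
  move=> _ /mapP [i _ ->]; apply/negPn/negP => nB.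
  by apply: H; exists (K + i)%N; rewrite ?leq_addr.
by move=> sz; have := uniq_leq_size us sub; rewrite sz ltnn.
Qed.

Lemma near_avoid (s : C) (B : seq C) (d : R) : 0 < d ->
  exists t, [/\ cabs (t - s) < d & t \notin B].
Proof.
move=> d0; have [K HK] := inv_nat_small d0.
pose u (k : nat) := s + k.+1%:R^-1 : C.
have iu : injective u.
  move=> i j /addrI /invr_inj /eqP; rewrite eqr_nat eqSS => /eqP //.
have [k Kk kB] := injective_avoid B K iu.
exists (u k); split=> //; rewrite /u addrC addKr cabsV cabs_nat.
exact: HK.
Qed.

End Continuity.

(** * Reproducing kernel spaces of analytic vector functions *)

(** A reproducing kernel Pontryagin space [U] of analytic functions on [S],
    presented by its evaluations [ev s] and by the vectors [kk s c] that
    represent them; [kap s t] below is the reproducing kernel. The last field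
    supplies pairs of points that are symmetric with respect to the unit
    circle without lying on it. *)
Record rk_model (R : realType) (U : lmodType (Cplx R)) (ip : U -> U -> Cplx R)
    (n : nat) (S : set (Cplx R)) (ev : Cplx R -> U -> 'cV[Cplx R]_n)
    (kk : Cplx R -> 'cV[Cplx R]_n -> U) : Prop := RkModel {
  rk_herm : herm_form ip;
  rk_pont : pontryagin setT ip;
  rk_lin : forall s, linear (ev s);
  rk_rep : forall s f c, S s -> ip f (kk s c) = dot c (ev s f);
  rk_ana : forall f s i, S s -> analytic_at (fun z => ev z f i 0) s;
  rk_open : forall s, S s -> exists d : R, 0 < d /\ forall z, cabs (z - s) < d -> S z;
  rk_sep : forall f, (forall s, S s -> ev s f = 0) -> f = 0;
  rk_pairs : forall B : seq (Cplx R), exists a b,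
    [/\ S a, S b, a * b^* = 1, a != b & a \notin B /\ b \notin B] }.

Section Model.
Variables (R : realType) (U : lmodType (Cplx R)) (ip : U -> U -> Cplx R).
Local Notation C := (Cplx R).
Variables (n : nat) (S : set C) (ev : C -> U -> 'cV[C]_n) (kk : C -> 'cV[C]_n -> U).
Hypothesis mod : rk_model ip S ev kk.

Let ipH := rk_herm mod.
Let evl := rk_lin mod.

Definition kap (s t : C) : 'M[C]_n := \matrix_(i, j) ev s (kk t (delta_mx j 0)) i 0.

(** The difference quotient operator at [a] appears as a relation between [f]
    and its image [h], because the existence of the image is part of what has
    to be proved. *)
Definition isR (a : C) (f h : U) : Prop :=
  forall s, S s -> (s - a) *: ev s h = ev s f - ev a f.

Lemma ip_nondeg g : (forall f, ip f g = 0) -> g = 0.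
Proof.
move=> H; apply: (rk_sep mod) => s Ss; apply: dot_eq0 => c.
by rewrite -(rk_rep mod) // (ipC ipH) H conjC0.
Qed.

Lemma ip_inj g h : (forall f, ip f g = ip f h) -> g = h.
Proof.
move=> H; apply/eqP; rewrite -subr_eq0; apply/eqP; apply: ip_nondeg => f.
by rewrite (ipBr ipH) H subrr.
Qed.

Lemma kk_linear t : S t -> linear (kk t).
Proof.
move=> St a c d; apply: ip_inj => f.
by rewrite (ipDr ipH) (ipZr ipH) !(rk_rep mod) // dotDl dotZl.
Qed.

Lemma kk_rep' s f c : S s -> ip (kk s c) f = dot (ev s f) c.
Proof. by move=> Ss; rewrite (ipC ipH) (rk_rep mod) // -dotC. Qed.

Lemma ev_kk s t c : S t -> ev s (kk t c) = kap s t *m c.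
Proof.
move=> St; have {1}-> : c = \sum_j c j 0 *: delta_mx j 0.
  by rewrite {1}[c]matrix_sum_delta; apply: eq_bigr => j _; rewrite big_ord1.
rewrite (linear_sumE _ _ (kk_linear St)) (linear_sumE _ _ (evl s)).
apply/colP => i; rewrite summxE mxE; apply: eq_bigr => j _.
rewrite (linearZE _ _ (kk_linear St)) (linearZE _ _ (evl s)) mxE [RHS]mulrC.
by rewrite mxE.
Qed.

Lemma kapC s t : S s -> S t -> kap t s = adjmx (kap s t).
Proof.
move=> Ss St; apply: mulmx_delta_inj => c; apply/eqP; rewrite -subr_eq0; apply/eqP.
apply: dot_eq0 => d; rewrite dotBr -ev_kk // -(rk_rep mod) // kk_rep' // ev_kk //.
by rewrite [dot d (adjmx _ *m _)]dot_mulmx adjmxK subrr.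
Qed.

Lemma ev_mcont f s : S s -> mcont (fun z => ev z f) s.
Proof.
move=> Ss i j; rewrite ord1.
exact: analytic_continuous (rk_ana mod _ _ Ss).
Qed.

Lemma kap_mcont s t : S s -> mcont (fun z => kap z t) s.
Proof.
move=> Ss i j.
have -> : (fun z => kap z t i j) = (fun z => ev z (kk t (delta_mx j 0)) i 0).
  by apply/funext => z; rewrite mxE.
exact: analytic_continuous (rk_ana mod _ _ Ss).
Qed.

Lemma S_near_avoid s (B : seq C) (d : R) : S s -> 0 < d ->
  exists t, [/\ S t, cabs (t - s) < d & t \notin B].
Proof.
move=> Ss d0; have [e [e0 He]] := rk_open mod Ss.
have [|t [ts tB]] := @near_avoid R s B (Num.min d e); first by rewrite lt_min d0.
by exists t; move: ts; rewrite lt_min => /andP[? /He].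
Qed.

Definition dense_in_S (good : C -> Prop) : Prop :=
  forall s (d : R), S s -> 0 < d -> exists t, [/\ S t, cabs (t - s) < d & good t].

Lemma ev_dense0 (good : C -> Prop) f : dense_in_S good ->
  (forall s, S s -> good s -> ev s f = 0) -> f = 0.
Proof.
move=> dg H; apply: (rk_sep mod) => s Ss.
suff Z : forall d : R, 0 < d -> exists t, cabs (t - s) < d /\ ev t f = 0.
  exact: (mcont_zero (ev_mcont (f := f) Ss) Z).
move=> d d0; have [t [St ts tg]] := dg s d Ss d0.
by exists t; rewrite H.
Qed.

Lemma isR_dense (good : C -> Prop) a f h : dense_in_S good ->
  (forall s, S s -> good s -> (s - a) *: ev s h = ev s f - ev a f) -> isR a f h.
Proof.
move=> dg H s Ss; apply/eqP; rewrite -subr_eq0; apply/eqP.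
pose F z := (z - a) *: ev z h - (ev z f - ev a f).
have Fc : mcont F s.
  apply: mcontB.
    apply: mcontZ; last exact: ev_mcont.
    by apply: continuousB; [exact: cvg_id | exact: cst_continuous].
  by apply: mcontB; [exact: ev_mcont | exact: mcont_const].
suff Z : forall d : R, 0 < d -> exists t, cabs (t - s) < d /\ F t = 0.
  exact: (mcont_zero Fc Z).
move=> d d0; have [t [St ts tg]] := dg s d Ss d0.
by exists t; split=> //; rewrite /F H // subrr.
Qed.

Lemma cofinite_dense (B : seq C) : dense_in_S (fun s => s \notin B).
Proof. by move=> s d Ss d0; exact: S_near_avoid. Qed.

Lemma ev_ae0 f (B : seq C) : (forall s, S s -> s \notin B -> ev s f = 0) -> f = 0.
Proof. exact/ev_dense0/cofinite_dense. Qed.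

Lemma isR_ae a f h (B : seq C) :
  (forall s, S s -> s \notin B -> (s - a) *: ev s h = ev s f - ev a f) -> isR a f h.
Proof. exact/isR_dense/cofinite_dense. Qed.

Lemma isR_uniq a f h h' : isR a f h -> isR a f h' -> h = h'.
Proof.
move=> H H'; apply/eqP; rewrite -subr_eq0; apply/eqP; apply: (@ev_ae0 _ [:: a]) => s Ss.
rewrite inE => sa; rewrite linearBE //; apply/eqP; rewrite subr_eq0; apply/eqP.
have : (s - a) *: ev s h = (s - a) *: ev s h' by rewrite H // H'.
by apply: scalerI; rewrite subr_eq0.
Qed.

Lemma isR_lin a c f h f' h' :
  isR a f h -> isR a f' h' -> isR a (c *: f + f') (c *: h + h').
Proof.
move=> H H' s Ss; rewrite !evl scalerDr H' // scalerA mulrC -scalerA H //.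
by rewrite scalerBr opprD addrACA.
Qed.

Section Theta.
Variables (X : 'M[C]_n) (Th : C -> 'M[C]_n).
Hypothesis uX : X \in unitmx.
Hypothesis hX : adjmx X = X.
Hypothesis KF : forall s t, S s -> S t -> s * t^* != 1 ->
  (1 - s * t^*) *: kap s t = invmx X - Th s *m X *m adjmx (Th t).

Lemma unit_circle_symm (a b s : C) : a * b^* = 1 -> (s * b^* == 1) = (s == a).
Proof.
move=> ab; have b0 : b^* != 0.
  by apply/negP => /eqP b0; move: ab; rewrite b0 mulr0 => /eqP; rewrite eq_sym oner_eq0.
by rewrite -ab (inj_eq (mulIf b0)).
Qed.

Lemma kap_affine_mcont s t u : S s ->
  mcont (fun z => (1 - z * u) *: kap z t) s.
Proof.
move=> Ss; apply: mcontZ; last exact: kap_mcont.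
exact: continuous_affine.
Qed.

(** The kernel formula is not available at the symmetric pair itself. On a
    vector [v] killed by the adjoint of [Th b], however, its left-hand side
    equals [X^-1 v] near [a] and tends to zero at [a], so [v] vanishes. *)
Lemma Theta_unit a b : S a -> S b -> a * b^* = 1 -> Th b \in unitmx.
Proof.
move=> Sa Sb ab; rewrite -adjmx_unit; apply: unitmx_inj => v Tv.
have Z : ((1 - a * b^*) *: kap a b - invmx X) *m v = 0.
  have Fc : mcont (fun z => ((1 - z * b^*) *: kap z b - invmx X) *m v) a.
    apply: mcontM; last exact: mcont_const.
    by apply: mcontB; [exact: kap_affine_mcont | exact: mcont_const].
  apply: (mcont_zero Fc) => d d0.
  have [t [St ts tB]] := S_near_avoid [:: a] Sa d0.
  exists t; split=> //; rewrite KF //.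
    by rewrite addrAC subrr add0r mulNmx -(mulmxA (Th t *m X)) Tv mulmx0 oppr0.
  by rewrite (unit_circle_symm _ ab); rewrite inE in tB.
move: Z; rewrite ab subrr scale0r sub0r mulNmx => /eqP; rewrite oppr_eq0 => /eqP Xv.
by rewrite -[v](mulKVmx uX) Xv mulmx0.
Qed.

(** The kernel formula persists at the points where its denominator vanishes:
    solving it against an invertible value of [Th] shows that [Th] is
    continuous. *)
Lemma kernel_formula s t : S s -> S t ->
  (1 - s * t^*) *: kap s t = invmx X - Th s *m X *m adjmx (Th t).
Proof.
move=> Ss St; have [st|/eqP st] := eqVneq (s * t^*) 1; last exact/KF/eqP.
have [a [b [Sa Sb ab _ [aB bB]]]] := rk_pairs mod [:: s; t].
rewrite inE negb_or inE in bB; case/andP: bB => bs bt.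
have ub := Theta_unit Sa Sb ab.
have sb : s * b^* != 1.
  apply/negP => /eqP sb; move/eqP: bt; apply.
  have s0 : s != 0.
    by apply/negP => /eqP s0; move: sb; rewrite s0 mul0r => /eqP; rewrite eq_sym oner_eq0.
  by apply: (inj_comp (mulfI s0) (can_inj (@conjCK C))); rewrite /= sb st.
have uXb : X *m adjmx (Th b) \in unitmx by rewrite unitmx_mul uX adjmx_unit.
have ThE z : S z -> z * b^* != 1 ->
    Th z = (invmx X - (1 - z * b^*) *: kap z b) *m invmx (X *m adjmx (Th b)).
  by move=> Sz zb; rewrite KF // opprB addrCA subrr addr0 -mulmxA mulmxK.
pose F z := (1 - z * t^*) *: kap z t - (invmx X -
  (invmx X - (1 - z * b^*) *: kap z b) *m invmx (X *m adjmx (Th b)) *m (X *m adjmx (Th t))).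
have Fc : mcont F s.
  apply: mcontB; first exact: kap_affine_mcont.
  apply: mcontB; first exact: mcont_const.
  do 2![apply: mcontM; last exact: mcont_const].
  by apply: mcontB; [exact: mcont_const | exact: kap_affine_mcont].
have : F s = 0.
  apply: (mcont_zero Fc) => d d0.
  have [z [Sz zs zB]] := S_near_avoid [:: s; a] Ss d0.
  rewrite inE negb_or inE in zB; case/andP: zB => zs' za.
  exists z; split=> //; rewrite /F -ThE // ?(unit_circle_symm _ ab) //.
  by rewrite KF ?mulmxA ?subrr // (unit_circle_symm _ st).
by rewrite /F -ThE // mulmxA => /eqP; rewrite subr_eq0 => /eqP.
Qed.

(** The kernel form of [1 + b^* R_b^* + a R_a = ev_b^* X ev_a] for a pair of
    points symmetric with respect to the unit circle. There the kernel formula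
    reads [Th a X (Th b)^* = X^-1], which lets the values of [Th] at the pair
    cancel. *)
Lemma kernel_pair a b s t : S a -> S b -> a * b^* = 1 -> S s -> S t ->
  ((1 - s * b^*) *: kap s b) *m X *m ((1 - a * t^*) *: kap a t)
  - (1 - s * b^*) *: kap s b - (1 - a * t^*) *: kap a t
  + (1 - s * t^*) *: kap s t = 0.
Proof.
move=> Sa Sb ab Ss St; rewrite !kernel_formula //.
have Tab : Th a *m X *m adjmx (Th b) = invmx X.
  have := kernel_formula Sa Sb; rewrite ab subrr scale0r => /esym/eqP.
  by rewrite subr_eq0 => /eqP <-.
have Tba : adjmx (Th b) *m X *m Th a = invmx X.
  have : (Th a *m X) *m (adjmx (Th b) *m X) = 1%:M by rewrite mulmxA Tab mulVmx.
  by move=> /mulmx1C; rewrite !mulmxA => H; rewrite -[LHS](mulmxK uX) H mul1mx.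
set u := Th s *m X *m _; set v := _ *m X *m adjmx (Th t); set w := _ *m X *m adjmx (Th t).
have uv : u *m X *m v = w.
  rewrite /u /v /w; move: (Th s) (adjmx (Th b)) (Th a) (adjmx (Th t)) Tba.
  move=> A B D E BD.
  have -> : A *m X *m B *m X *m (D *m X *m E) = A *m X *m (B *m X *m D) *m X *m E.
    by rewrite !mulmxA.
  by rewrite BD (mulmxK uX).
move: u v w uv => u v w uv.
have -> : (invmx X - u) *m X *m (invmx X - v) = invmx X - v - (u - w).
  rewrite (mulmxBl _ u) (mulVmx uX) mulmxBl mul1mx mulmxBr (mulmxK uX).
  by rewrite uv.
by apply/matrixP => i j; rewrite !mxE; ring.
Qed.

End Theta.
End Model.

(** * Boundedness of the difference quotient operators for a symmetric pair *)

Section Bounds.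
Variables (R : realType) (U : lmodType (Cplx R)) (ip : U -> U -> Cplx R).
Local Notation C := (Cplx R).
Variables (n : nat) (S : set C) (ev : C -> U -> 'cV[C]_n) (kk : C -> 'cV[C]_n -> U).
Hypothesis mod : rk_model ip S ev kk.
Variables (k : nat) (h : 'I_k -> U).
Hypothesis oh : negative_orthonormal ip h.
Hypothesis hilb : hilbert (majorant ip h).

Let ipH := rk_herm mod.
Let evl := rk_lin mod.
Local Notation hp := (majorant ip h).
Local Notation nm := (nm hp).
Let hpH : herm_form hp. Proof. exact: majorant_herm. Qed.

Lemma sum_ord_const (x : R) : \sum_(i < k) x = k%:R * x.
Proof. by rewrite sumr_const card_ord mulr_natl. Qed.

Lemma majorant_neg f i : hp f (h i) = - ip f (h i).
Proof.
rewrite /majorant (bigD1 i) //= big1 => [|j ji]; rewrite oh.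
  by rewrite eqxx addr0 /=; ring.
by rewrite (negbTE ji) oppr0 mulr0.
Qed.

Lemma nm_neg i : nm (h i) = 1.
Proof.
apply/eqP; rewrite -(@eqrXn2 _ 2) ?nm_ge0 ?ler01 // -(inj_eq (@complexI R)).
by rewrite -(hp_nm hilb) majorant_neg oh eqxx opprK expr1n.
Qed.

Lemma ip_neg_le f i : cabs (ip f (h i)) <= nm f.
Proof.
rewrite -cabsN -majorant_neg; apply: le_trans (cauchy_schwarz hilb _ _) _.
by rewrite nm_neg mulr1.
Qed.

Definition ipK : R := 1 + 2 * k%:R.

Lemma ipK_gt0 : 0 < ipK.
Proof. by rewrite /ipK ltr_wpDr ?ltr01 // mulr_ge0. Qed.

Lemma ip_le f g : cabs (ip f g) <= ipK * (nm f * nm g).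
Proof.
have -> : ip f g = hp f g - 2 * \sum_i ip f (h i) * ip (h i) g.
  by rewrite /majorant addrK.
apply: le_trans (cabsB _ _) _; rewrite /ipK [leRHS]mulrDl mul1r; apply: lerD.
  exact: cauchy_schwarz.
rewrite cabsM cabs_nat -mulrA ler_wpM2l //.
apply: le_trans (cabs_sum _ _ _) _.
rewrite -sum_ord_const; apply: ler_sum => i _.
rewrite cabsM (cabs_ipC ipH (h i)).
by apply: ler_pM; rewrite ?cabs_ge0 ?ip_neg_le.
Qed.

Lemma nm_sqrE f : nm f ^+ 2 = complex.Re (ip f f) + 2 * \sum_i cabs (ip f (h i)) ^+ 2.
Proof.
rewrite (nm_sqr hilb) /majorant cReD; congr (_ + _).
have -> : \sum_i ip f (h i) * ip (h i) f =
    real_complex R (\sum_i cabs (ip f (h i)) ^+ 2).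
  rewrite rmorph_sum; apply: eq_bigr => i _.
  by rewrite /= cabs_sqr -(ipC ipH).
by rewrite -(rmorph_nat (real_complex R)) cReMl.
Qed.

Lemma nm_sqr_le f (D : R) : 0 <= D -> (forall i, cabs (ip f (h i)) <= D) ->
  nm f ^+ 2 <= cabs (ip f f) + 2 * k%:R * D ^+ 2.
Proof.
move=> D0 HD; rewrite nm_sqrE; apply: lerD; first exact: Re_le_cabs.
rewrite -mulrA ler_wpM2l // -sum_ord_const.
by apply: ler_sum => i _; apply: lerXn2r; rewrite ?nnegrE ?cabs_ge0.
Qed.

(** Precision with which the negative directions have to be approximated for
    the error terms below to be absorbed into the norm. *)
Definition approx_scale : R := (4 * (k%:R + 1) * ipK)^-1.

Lemma approx_scale_gt0 : 0 < approx_scale.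
Proof. by rewrite invr_gt0 !mulr_gt0 ?ipK_gt0 // ltr_wpDl. Qed.

(** The negative directions [h i] may be replaced by vectors [g i] on which the
    pairing with [f] is under control: the error is a small multiple of the
    norm of [f], which the left-hand side absorbs. *)
Lemma nm_sqr_approx f (g : 'I_k -> U) (D : R) : 0 <= D ->
  (forall i, nm (h i - g i) < approx_scale) -> (forall i, cabs (ip f (g i)) <= D) ->
  nm f ^+ 2 <= 2 * cabs (ip f f) + 8 * k%:R * D ^+ 2.
Proof.
move=> D0 hg HD; have K0 := ipK_gt0; have k0 : 0 <= k%:R :> R by rewrite ler0n.
pose s : R := (4 * (k%:R + 1))^-1; set y := nm f; have y0 : 0 <= y := nm_ge0 _ _.
have k1 : 0 < k%:R + 1 :> R by rewrite ltr_wpDl.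
have s0 : 0 <= s by rewrite invr_ge0 mulr_ge0 ?ltW.
have neg i : cabs (ip f (h i)) <= D + s * y.
  have -> : h i = g i + (h i - g i) by rewrite addrC subrK.
  rewrite (ipDr ipH); apply: le_trans (cabsD _ _) _; apply: lerD => //.
  have -> : s * y = ipK * (y * approx_scale).
    by rewrite /s /approx_scale; field; rewrite !gt_eqF.
  apply: le_trans (ip_le _ _) _; rewrite ler_wpM2l ?(ltW K0) //.
  by rewrite ler_wpM2l // ltW.
have := nm_sqr_le (addr_ge0 D0 (mulr_ge0 s0 y0)) neg; rewrite -/y.
have ks : 4 * k%:R * s ^+ 2 <= 2^-1.
  rewrite exprVn ler_pdivrMr ?exprn_gt0 ?mulr_gt0 //.
  by move: (k%:R : R) k0 => x x0; nra.
have sq : (D + s * y) ^+ 2 <= 2 * D ^+ 2 + 2 * s ^+ 2 * y ^+ 2.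
  by have := sqr_ge0 (D - s * y); nra.
have := ler_wpM2l (_ : 0 <= 2 * k%:R) sq; rewrite mulr_ge0 // => /(_ isT).
have := ler_wpM2r (sqr_ge0 y) ks.
move: ((D + _) ^+ 2) (D ^+ 2) (s ^+ 2) (y ^+ 2) (cabs _) => u v z w t.
by move: (k%:R : R) k0 => x x0; nra.
Qed.

(** The vector representing in the indefinite form the functional that [g]
    represents in the Hilbert space inner product. *)
Definition flip (g : U) : U := g + \sum_i (2 * ip (h i) g)^* *: h i.

Lemma hp_flip f g : hp f g = ip f (flip g).
Proof.
rewrite /majorant /flip (ipDr ipH) (ip_sumr ipH); congr (_ + _).
rewrite mulr_sumr; apply: eq_bigr => i _.
by rewrite (ipZr ipH) conjCK; ring.
Qed.

Lemma nm_flip g : nm (flip g) <= ipK * nm g.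
Proof.
apply: le_trans (nmD hilb _ _) _; rewrite /ipK [leRHS]mulrDl mul1r lerD2l.
apply: le_trans (nm_sum hilb _ _) _.
rewrite -mulrA mulrCA -sum_ord_const.
apply: ler_sum => i _; rewrite (nmZ hilb) nm_neg mulr1 cabsJ cabsM cabs_nat.
by rewrite ler_wpM2l // (cabs_ipC ipH) ip_neg_le.
Qed.

Lemma flip_eq0 g : flip g = 0 -> g = 0.
Proof.
move=> fg; apply: (nm_eq0 hilb).
by apply/eqP; rewrite -sqrf_eq0 (nm_sqr hilb) hp_flip fg (ip0r ipH).
Qed.

Lemma ev_le a i : S a -> exists2 B, 0 <= B & forall f, cabs (ev a f i 0) <= B * nm f.
Proof.
move=> Sa; exists (ipK * nm (kk a (delta_mx i 0))).
  by rewrite mulr_ge0 ?nm_ge0 // ltW ?ipK_gt0.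
move=> f; rewrite -dot_delta -(rk_rep mod) //; apply: le_trans (ip_le _ _) _.
by rewrite mulrCA mulrC.
Qed.

Lemma kk_ev_le a b (M : 'M[C]_n) : S a -> S b ->
  exists2 B, 0 <= B & forall f, nm (kk b (M *m ev a f)) <= B * nm f.
Proof.
move=> Sa Sb.
have [B HB] := boolp.choice (fun i => let: ex_intro2 B B0 H := ev_le i Sa in
   ex_intro (fun B => 0 <= B /\ forall f, cabs (ev a f i 0) <= B * nm f) B (conj B0 H)).
exists (\sum_i (\sum_j cabs (M i j) * B j) * nm (kk b (delta_mx i 0))).
  apply: sumr_ge0 => i _; rewrite mulr_ge0 ?nm_ge0 // sumr_ge0 // => j _.
  by rewrite mulr_ge0 ?cabs_ge0 //; case: (HB j).
move=> f; set v := _ *m _.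
have -> : v = \sum_i v i 0 *: delta_mx i 0.
  by rewrite {1}[v]matrix_sum_delta; apply: eq_bigr => i _; rewrite big_ord1.
rewrite (linear_sumE _ _ (kk_linear mod Sb)); apply: le_trans (nm_sum hilb _ _) _.
rewrite mulr_suml; apply: ler_sum => i _.
rewrite (linearZE _ _ (kk_linear mod Sb)) (nmZ hilb) mulrAC ler_wpM2r ?nm_ge0 //.
rewrite mxE; apply: le_trans (cabs_sum _ _ _) _; rewrite mulr_suml.
apply: ler_sum => j _; rewrite cabsM -mulrA ler_wpM2l ?cabs_ge0 //.
by case: (HB j).
Qed.

Section Lists.
Variable good : C -> Prop.
Hypothesis goodS : forall s, good s -> S s.
Hypothesis good_sep : forall f, (forall s, good s -> ev s f = 0) -> f = 0.

Definition glist (l : seq (C * 'cV[C]_n)) : Prop := forall q, q \in l -> good q.1.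

Definition Gs (l : seq (C * 'cV[C]_n)) : U := \sum_(q <- l) kk q.1 q.2.

Lemma glist_cons q l : glist (q :: l) -> good q.1 /\ glist l.
Proof.
move=> gl; split; first by apply: gl; rewrite mem_head.
by move=> r rl; apply: gl; rewrite in_cons rl orbT.
Qed.

Definition lscale (a : C) (l : seq (C * 'cV[C]_n)) := [seq (q.1, a *: q.2) | q <- l].

Lemma glist_lin a l l' : glist l -> glist l' -> glist (lscale a l ++ l').
Proof.
move=> gl gl' q; rewrite mem_cat => /orP[/mapP[r rl ->]|]; last exact: gl'.
exact: (gl r rl).
Qed.

Lemma Gs_lin a l l' : glist l -> Gs (lscale a l ++ l') = a *: Gs l + Gs l'.
Proof.
move=> gl; rewrite /Gs big_cat big_map; congr (_ + _); rewrite scaler_sumr.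
apply: eq_big_seq => q /gl /goodS Sq /=.
by rewrite (linearZE _ _ (kk_linear mod Sq)).
Qed.

(** Riesz representation for the functional of [f] restricted to combinations
    of kernel vectors yields the projection of [f]; the remainder is orthogonal
    to all kernel vectors, hence evaluates to zero at all good points. *)
Lemma kernel_dense f (eps : R) : 0 < eps -> exists l, glist l /\ nm (f - Gs l) < eps.
Proof.
pose M g (x : C) := exists l, [/\ glist l, g = Gs l & x = hp g f].
have [|||H [HE Hc]] := @riesz R U hp hilb M (nm f).
- by exists [::]; split=> //; rewrite /Gs ?big_nil // (ip0l hpH).
- move=> a g x g' x' [l [gl -> ->]] [l' [gl' -> ->]].
  exists (lscale a l ++ l'); split; first exact: glist_lin.
    by rewrite Gs_lin.
  by rewrite hpH.1.
- by move=> g x [l [_ _ ->]]; rewrite mulrC; exact: cauchy_schwarz.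
have fH : f = H.
  apply/eqP; rewrite -subr_eq0; apply/eqP; apply: flip_eq0; apply: good_sep => s gs.
  apply: dot_eq0 => c; rewrite dotC -(kk_rep' mod _ _ (goodS gs)).
  suff : hp (kk s c) (f - H) = 0 by rewrite hp_flip => ->; rewrite conjC0.
  have Ms : M (kk s c) (hp (kk s c) f).
    exists [:: (s, c)]; split=> //; last by rewrite /Gs big_seq1.
    by move=> q; rewrite inE => /eqP ->.
  by rewrite (ipBr hpH) -(HE _ _ Ms) subrr.
by move=> /Hc [g [x [[l [gl -> _]] Hl]]]; exists l; rewrite fH.
Qed.

(** This turns candidate values into a vector: only the size of the functional
    that they define on finite combinations of kernel vectors has to be
    estimated. [flip] passes from the inner product used by the Riesz theorem
    to the indefinite form used by the kernel. *)
Lemma weak_riesz (val : C -> 'cV[C]_n) (B : R) : 0 <= B ->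
  (forall l, glist l -> cabs (\sum_(q <- l) dot q.2 (val q.1)) <= B * nm (Gs l)) ->
  exists H, (forall s, good s -> ev s H = val s) /\ nm H <= ipK * B.
Proof.
move=> B0 HB.
pose M g (x : C) := exists l, [/\ glist l, g = Gs l & x = (\sum_(q <- l) dot q.2 (val q.1))^*].
have [|||H [HE Hc]] := @riesz R U hp hilb M B.
- by exists [::]; split=> //; rewrite /Gs ?big_nil // conjC0.
- move=> a g x g' x' [l [gl -> ->]] [l' [gl' -> ->]].
  exists (lscale a l ++ l'); split; [exact: glist_lin | by rewrite Gs_lin |].
  rewrite big_cat rmorphD big_map /=; congr (_ + _).
  rewrite !rmorph_sum mulr_sumr; apply: eq_bigr => q _ /=.
  by rewrite dotZl rmorphM /= conjCK.
- by move=> g x [l [gl -> ->]]; rewrite cabsJ HB.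
exists (flip H); split.
  move=> s gs; apply/eqP; rewrite -subr_eq0; apply/eqP; apply: dot_eq0 => c.
  have Ms : M (kk s c) (dot c (val s))^*.
    exists [:: (s, c)]; rewrite /Gs !big_seq1; split=> //.
    by move=> q; rewrite inE => /eqP ->.
  have := HE _ _ Ms; rewrite hp_flip (kk_rep' mod _ _ (goodS gs)) => E.
  by rewrite dotBr [dot c (ev s _)]dotC -E conjCK subrr.
apply: le_trans (nm_flip _) _; rewrite ler_wpM2l ?(ltW ipK_gt0) //.
have [H0|H0] := eqVneq H 0; first by rewrite H0 (nm0 hilb).
have nH := nm_gt0 hilb H0.
have key : forall eps, 0 < eps -> nm H ^+ 2 <= nm H * B + eps.
  move=> eps eps0.
  have e0 : 0 < eps / (nm H + B) by rewrite divr_gt0 // ltr_wpDr.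
  have [g [x [Mg Hg]]] := Hc _ e0.
  have xB : cabs x <= B * nm g by case: Mg => l [gl -> ->]; rewrite cabsJ HB.
  have ng : nm g <= nm H + nm (H - g).
    have {1}-> : g = H - (H - g) by rewrite opprB addrCA subrr addr0.
    exact: (nmB hilb).
  rewrite (nm_sqr hilb); have {1}-> : H = (H - g) + g by rewrite subrK.
  rewrite (ipDl hpH) cReD -(HE _ _ Mg).
  have h1 := le_trans (Re_le_cabs _) (cauchy_schwarz hilb (H - g) H).
  have h2 := Re_le_cabs x.
  rewrite ltr_pdivlMr ?ltr_wpDr // in Hg.
  move: h1 h2 xB ng Hg nH B0; move: (nm (H - g)) (nm g) (nm H) (cabs x).
  move: (complex.Re _) (complex.Re _) => u v w y z t; nra.
have : nm H ^+ 2 <= nm H * B by apply/ler_addgt0Pr.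
by rewrite expr2 ler_pM2l.
Qed.

End Lists.

Section Pair.
Variables (X : 'M[C]_n) (a b : C).
Hypothesis Sa : S a.
Hypothesis Sb : S b.
Hypothesis ab : a * b^* = 1.
Hypothesis KP : forall s t, S s -> S t ->
  ((1 - s * b^*) *: kap ev kk s b) *m X *m ((1 - a * t^*) *: kap ev kk a t)
  - (1 - s * b^*) *: kap ev kk s b - (1 - a * t^*) *: kap ev kk a t
  + (1 - s * t^*) *: kap ev kk s t = 0.

Definition off_pair (s : C) : Prop := [/\ S s, s != a & s != b].

(** The image under the adjoint of [R_b] of a combination of kernel vectors,
    and the image under [R_a] that the kernel identity then provides. *)
Definition Ys (l : seq (C * 'cV[C]_n)) : U :=
  \sum_(q <- l) (q.1^* - b^*)^-1 *: (kk q.1 q.2 - kk b q.2).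

Definition Zs (l : seq (C * 'cV[C]_n)) : U :=
  b^* *: (kk b (X *m ev a (Gs l)) - Gs l - b^* *: Ys l).

Lemma Gs_cons q l : Gs (q :: l) = kk q.1 q.2 + Gs l.
Proof. by rewrite /Gs big_cons. Qed.

Lemma Zs_cons q l : Zs (q :: l) = Zs [:: q] + Zs l.
Proof.
rewrite /Zs /Ys /Gs !big_cons !big_nil !addr0.
rewrite (linearDE _ _ (evl a)) mulmxDr (linearDE _ _ (kk_linear mod Sb)).
rewrite -scalerDr; congr (_ *: _); rewrite scalerDr !opprD !addrA.
by rewrite [LHS](ACl (1*3*5*2*4*6)).
Qed.

(** On kernel vectors, [kernel_pair] solves for the image under [R_a] in terms
    of the adjoint of [R_b], by [a^-1 = b^*]. *)
Lemma Zs_isR l : glist off_pair l -> isR S ev a (Gs l) (Zs l).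
Proof.
have b0 : b^* != 0.
  by apply/negP => /eqP b0; move: ab; rewrite b0 mulr0 => /eqP; rewrite eq_sym oner_eq0.
have aE : a = (b^*)^-1 by apply: (mulIf b0); rewrite ab mulVf.
elim: l => [|q l IH gl].
  move=> _ s Ss; rewrite /Zs /Ys /Gs !big_nil (linear0E (evl a)) mulmx0.
  rewrite (linear0E (kk_linear mod Sb)) scaler0 !subr0 scaler0.
  by rewrite (linear0E (evl s)) scaler0.
have [[St ta tb] /IH Rl] := glist_cons gl; move: St ta tb.
rewrite Gs_cons Zs_cons; case: q {gl} => t c /= St ta tb s Ss.
rewrite !(linearDE _ _ (evl _)) scalerDr Rl // opprD addrACA; congr (_ + _).
have D0 : t^* - b^* != 0 by rewrite subr_eq0 (inj_eq (can_inj (@conjCK C))).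
rewrite /Zs /Ys /Gs !big_seq1 /= (linearZE _ _ (evl s)) !(linearBE _ _ (evl s)).
rewrite !(linearZE _ _ (evl s)) (linearBE _ _ (evl s)) !(ev_kk mod) //.
have /(congr1 (fun M : 'M_n => M *m c)) := KP Ss St.
rewrite mul0mx mulmxDl !mulmxBl -!scalemxAl -scalemxAr -!scalemxAl !mulmxA aE.
move: (_ *m c) (_ *m c) (_ *m c) (_ *m c) => p B A K /matrixP E.
apply/matrixP => i j; move: {E}(E i j); rewrite !mxE.
move: b0 D0; move: (t^*) (b^*) => t' b' b0 D0.
move: (p i j) (A i j) (K i j) (B i j) => {}p {}A {}K {}B E.
apply/eqP; rewrite -subr_eq0; apply/eqP.
rewrite -[RHS](mulr0 (b' / (t' - b'))) -E; field.
by rewrite b0 D0.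
Qed.

Lemma Ys_rep F l : glist off_pair l -> ip F (Ys l) =
  \sum_(q <- l) dot q.2 ((q.1 - b)^-1 *: (ev q.1 F - ev b F)).
Proof.
move=> gl; rewrite /Ys (ip_sumr ipH); apply: eq_big_seq => q /gl [Sq _ qb].
rewrite (ipZr ipH) (ipBr ipH) !(rk_rep mod) // dotZr dotBr; congr (_ * _).
by rewrite fmorphV rmorphB /= !conjCK.
Qed.

Lemma Ys_adj F H l : isR S ev b F H -> glist off_pair l -> ip F (Ys l) = ip H (Gs l).
Proof.
move=> RF gl; rewrite Ys_rep // /Gs (ip_sumr ipH).
apply: eq_big_seq => q /gl [Sq _ qb].
by rewrite -RF // scalerA mulVf ?subr_eq0 // scale1r (rk_rep mod).
Qed.

(** The resolvent identity [(b - a) R_b R_a = R_b - R_a], tested against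
    kernel vectors. *)
Lemma Ys_resolvent G Z l : isR S ev a G Z -> glist off_pair l ->
  (b - a) * ip Z (Ys l) = ip G (Ys l) - ip Z (Gs l).
Proof.
move=> RG gl; rewrite !Ys_rep // /Gs (ip_sumr ipH) -sumrB mulr_sumr.
apply: eq_big_seq => q /gl [Sq qa qb]; rewrite (rk_rep mod) //.
have D0 : q.1 - b != 0 by rewrite subr_eq0.
rewrite -dotBr -dotZr; congr (dot _ _).
apply: (scalerI D0); rewrite [RHS]scalerBr !scalerA mulrAC mulfV // mul1r.
rewrite scale1r scalerBr RG //.
apply/eqP; rewrite -subr_eq0; apply/eqP.
have := RG _ Sq => /eqP; rewrite -subr_eq0 => /eqP E.
rewrite -[RHS]E; move: (ev q.1 Z) (ev q.1 G) (ev b G) (ev a G) => x y z t.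
by apply/matrixP => i j; rewrite !mxE; ring.
Qed.

End Pair.
End Bounds.

Lemma quadratic_bound (R : realDomainType) (p q x y : R) :
  0 <= p -> 0 <= q -> 0 <= x -> 0 <= y ->
  y ^+ 2 <= p * x * y + q * x ^+ 2 -> y <= (p + q + 1) * x.
Proof.
move=> p0 q0 x0 y0 H; rewrite leNgt; apply/negP => xy.
have pq : 0 <= (p + q + 1) * x by rewrite mulr_ge0 ?addr_ge0.
have y1 : 0 < y by apply: le_lt_trans xy.
have h1 : (p + q + 1) * x * y < y ^+ 2 by rewrite expr2 ltr_pM2r.
have h2 : q * x * ((p + q + 1) * x) <= q * x * y.
  by rewrite ler_wpM2l ?mulr_ge0 // ltW.
have h3 : q * x ^+ 2 <= q * x * ((p + q + 1) * x).
  have -> : q * x * ((p + q + 1) * x) = q * x ^+ 2 + (p + q) * q * x ^+ 2 by ring.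
  by rewrite lerDl !mulr_ge0 ?addr_ge0 ?sqr_ge0.
have h4 : 0 <= x * y by rewrite mulr_ge0.
have : (p + q + 1) * x * y = p * x * y + q * x * y + x * y by ring.
lra.
Qed.

Section PairOperator.
Variables (R : realType) (U : lmodType (Cplx R)) (ip : U -> U -> Cplx R).
Local Notation C := (Cplx R).
Variables (n : nat) (S : set C) (ev : C -> U -> 'cV[C]_n) (kk : C -> 'cV[C]_n -> U).
Hypothesis mod : rk_model ip S ev kk.
Variables (k : nat) (h : 'I_k -> U).
Hypothesis oh : negative_orthonormal ip h.
Hypothesis hilb : hilbert (majorant ip h).

Let ipH := rk_herm mod.
Let evl := rk_lin mod.
Local Notation hp := (majorant ip h).
Local Notation nm := (nm hp).
Let hpH : herm_form hp. Proof. exact: majorant_herm. Qed.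

Variable X : 'M[C]_n.
Hypothesis hX : adjmx X = X.

Definition kernel_symm (a b : C) : Prop :=
  [/\ S a, S b, a * b^* = 1 & forall s t, S s -> S t ->
  ((1 - s * b^*) *: kap ev kk s b) *m X *m ((1 - a * t^*) *: kap ev kk a t)
  - (1 - s * b^*) *: kap ev kk s b - (1 - a * t^*) *: kap ev kk a t
  + (1 - s * t^*) *: kap ev kk s t = 0].

Lemma off_pair_sep a b f : (forall s, off_pair S a b s -> ev s f = 0) -> f = 0.
Proof.
move=> H; apply: (ev_ae0 mod (B := [:: a; b])) => s Ss.
by rewrite inE negb_or inE => /andP[sa sb]; apply: H.
Qed.

Lemma off_pairS a b s : off_pair S a b s -> S s.
Proof. by case. Qed.

Lemma off_pair_dense a b f (eps : R) : 0 < eps ->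
  exists l, glist (off_pair S a b) l /\ nm (f - Gs kk l) < eps.
Proof. exact: (kernel_dense mod hilb (@off_pairS a b) (@off_pair_sep a b)). Qed.

Lemma Ys_Zs a b l : a * b^* = 1 ->
  Ys kk b l = a *: (kk b (X *m ev a (Gs kk l)) - Gs kk l - a *: Zs ev kk X a b l).
Proof.
move=> ab; rewrite /Zs scalerA ab scale1r opprB addrCA subrr addr0.
by rewrite scalerA ab scale1r.
Qed.

(** The square of [Y = R_b^* G] in the indefinite form is estimated by replacing
    one factor [Y] by [a (T - G - a Z)], where [Z = R_a G] and
    [T = ev_b^* X ev_a G], and the product of [Z] with [Y] by the resolvent
    identity; the result is linear in the norm of [Y]. The negative directions
    are approximated by kernel combinations, whose image under [R_b] is given
    by [Zs_isR] with the roles of [a] and [b] exchanged. *)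
Lemma Ys_bound a b : kernel_symm a b -> kernel_symm b a -> a != b ->
  exists2 K, 0 <= K & forall l, glist (off_pair S a b) l ->
    nm (Ys kk b l) <= K * nm (Gs kk l).
Proof.
move=> [Sa Sb ab KP] [_ _ ba KP'] anb.
have K0 := ipK_gt0 R k; set K := ipK R k in K0.
(* The negative part of the majorant is controlled by pairing with kernel
   combinations, on which the operator itself is available. *)
have [l_ Hl] := boolp.choice (fun i => off_pair_dense b a (h i) (approx_scale_gt0 R k)).
pose D := \sum_i nm (Zs ev kk X b a (l_ i)).
have D0 : 0 <= D by apply: sumr_ge0 => i _; exact: nm_ge0.
have neg l i : glist (off_pair S a b) l ->
    cabs (ip (Ys kk b l) (Gs kk (l_ i))) <= K * D * nm (Gs kk l).
  move=> gl; rewrite (cabs_ipC ipH); have [gli _] := Hl i.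
  rewrite (Ys_adj mod Sb (Zs_isR mod Sa ba KP' gli) gl).
  apply: le_trans (ip_le mod oh hilb _ _) _; rewrite -mulrA ler_wpM2l ?(ltW K0) //.
  rewrite ler_wpM2r ?nm_ge0 // /D (bigD1 i) //= lerDl.
  by apply: sumr_ge0 => j _; exact: nm_ge0.
have [K1 K10 HK1] := kk_ev_le mod oh hilb X Sa Sb.
have [c c0 Hc] : exists2 c, 0 <= c & forall l, glist (off_pair S a b) l ->
    cabs (ip (Ys kk b l) (Ys kk b l)) <=
      c * nm (Gs kk l) * nm (Ys kk b l) + c * nm (Gs kk l) ^+ 2.
  pose d := cabs (b - a)^-1; have d0 : 0 <= d := cabs_ge0 _.
  pose A := cabs a; have A0 : 0 <= A := cabs_ge0 _.
  pose B := cabs b^*; have B0 : 0 <= B := cabs_ge0 _.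
  have K0' := ltW K0.
  exists (A * (K * K1 + K + A * d * K * (1 + B * B)) + A * A * d * K * B * (K1 + 1)).
    by rewrite !(addr_ge0, mulr_ge0).
  move=> l gl; set g := nm (Gs kk l); set y := nm (Ys kk b l).
  have g0 : 0 <= g := nm_ge0 _ _; have y0 : 0 <= y := nm_ge0 _ _.
  set T := kk b (X *m ev a (Gs kk l)); set Z := Zs ev kk X a b l.
  have TK : nm T <= K1 * g := HK1 _.
  have ZK : nm Z <= B * (K1 * g + g + B * y).
    rewrite /Z /Zs (nmZ hilb) -/B ler_wpM2l //.
    apply: le_trans (nmB hilb _ _) _; rewrite (nmZ hilb) lerD2r.
    by apply: le_trans (nmB hilb _ _) _; rewrite lerD2r.
  have E : ip (Ys kk b l) (Ys kk b l) =
      a * (ip T (Ys kk b l) - ip (Gs kk l) (Ys kk b l) -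
       a * ((b - a)^-1 * (ip (Gs kk l) (Ys kk b l) - ip Z (Gs kk l)))).
    rewrite {1}(Ys_Zs l ab) (ipZl ipH) !(ipBl ipH) (ipZl ipH).
    have := Ys_resolvent mod Sb (Zs_isR mod Sb ab KP gl) gl; rewrite -/Z => <-.
    by rewrite mulKf // subr_eq0 eq_sym.
  rewrite E cabsM -/A.
  have i1 : cabs (ip T (Ys kk b l)) <= K * (K1 * g * y).
    apply: le_trans (ip_le mod oh hilb _ _) _; rewrite ler_wpM2l //.
    by rewrite ler_wpM2r.
  have i2 : cabs (ip (Gs kk l) (Ys kk b l)) <= K * (g * y) := ip_le mod oh hilb _ _.
  have i3 : cabs (ip Z (Gs kk l)) <= K * (B * (K1 * g + g + B * y) * g).
    apply: le_trans (ip_le mod oh hilb _ _) _; rewrite ler_wpM2l //.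
    by rewrite ler_wpM2r.
  apply: (@le_trans _ _ (A * (K * (K1 * g * y) + K * (g * y) +
      A * (d * (K * (g * y) + K * (B * (K1 * g + g + B * y) * g)))))).
    rewrite ler_wpM2l //; apply: le_trans (cabsB _ _) _; apply: lerD.
      by apply: le_trans (cabsB _ _) _; apply: lerD.
    rewrite !cabsM -/A -/d ler_wpM2l // ler_wpM2l //.
    by apply: le_trans (cabsB _ _) _; apply: lerD.
  rewrite -subr_ge0.
  set lhs := _ - _.
  have -> : lhs = A * A * d * K * B * (K1 + 1) * (g * y) +
     A * (K * K1 + K + A * d * K * (1 + B * B)) * g ^+ 2.
    by rewrite /lhs; ring.
  by rewrite addr_ge0 // !(mulr_ge0, addr_ge0, exprn_ge0).
exists (2 * c + 2 * (c + 4 * k%:R * (K * D) ^+ 2) + 1).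
  by rewrite !(addr_ge0, mulr_ge0, exprn_ge0) // ltW.
move=> l gl; set g := nm (Gs kk l); set y := nm (Ys kk b l).
have g0 : 0 <= g := nm_ge0 _ _; have y0 : 0 <= y := nm_ge0 _ _.
apply: quadratic_bound => //; first by rewrite mulr_ge0.
  by rewrite !(addr_ge0, mulr_ge0, exprn_ge0) // ltW.
have KD0 : 0 <= K * D * g by rewrite !mulr_ge0 // ltW.
have := nm_sqr_approx mod oh hilb KD0 (fun i => (Hl i).2) (fun i => neg l i gl).
have := Hc l gl; rewrite -/g -/y exprMn.
by move: (cabs _) ((K * D) ^+ 2) => w u; nra.
Qed.

(** The functional [G |-> (F, R_b^* G)] is bounded on kernel combinations, and
    its representing vector is [R_b F]. *)
Lemma R_bounded a b : kernel_symm a b -> kernel_symm b a -> a != b ->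
  exists2 K, 0 <= K & forall F, exists H, isR S ev b F H /\ nm H <= K * nm F.
Proof.
move=> ks ks' anb; have [K K0 HK] := Ys_bound ks ks' anb.
have [Sa Sb ab KP] := ks.
have c0 := ltW (ipK_gt0 R k); exists (ipK R k * (ipK R k * K)); first by rewrite !mulr_ge0.
move=> F; pose val s := (s - b)^-1 *: (ev s F - ev b F).
have [|l gl|H [HE Hn]] := @weak_riesz _ _ _ _ _ _ _ mod _ _ oh hilb _ (@off_pairS a b)
    val (ipK R k * K * nm F).
- by rewrite !mulr_ge0 ?nm_ge0.
- rewrite -(Ys_rep mod Sb F gl); apply: le_trans (ip_le mod oh hilb _ _) _.
  rewrite -!mulrA ler_wpM2l // mulrA [K * nm F]mulrC -mulrA ler_wpM2l ?nm_ge0 //.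
  exact: HK.
exists H; split; last by rewrite -!mulrA in Hn *.
apply: (isR_ae mod (B := [:: a; b])) => s Ss.
rewrite inE negb_or inE => /andP[sa sb]; rewrite HE // /val scalerA mulfV ?scale1r //.
by rewrite subr_eq0.
Qed.

(** Kernel combinations satisfy the identity by construction of [Zs]; both sides
    are continuous in [F], because [R_a] is bounded. *)
Lemma pair_identity a b F F1 G G1 :
  kernel_symm a b -> kernel_symm b a -> a != b ->
  isR S ev a F F1 -> isR S ev b G G1 ->
  ip F G + b^* * ip F G1 + a * ip F1 G = dot (ev b G) (X *m ev a F).
Proof.
move=> ks ks' anb RF RG; have [Sa Sb ab KP] := ks.
have [Ka Ka0 HKa] : exists2 K, 0 <= K & forall F, exists H, isR S ev a F H /\ nm H <= K * nm F.
  by apply: (R_bounded ks' ks); rewrite eq_sym.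
pose Phi f f1 := ip f G + b^* * ip f G1 + a * ip f1 G - dot (ev b G) (X *m ev a f).
have base l : glist (off_pair S a b) l -> Phi (Gs kk l) (Zs ev kk X a b l) = 0.
  move=> gl; rewrite /Phi -(kk_rep' mod) //.
  have -> : ip (Gs kk l) G1 = ip (Ys kk b l) G.
    by rewrite (ipC ipH) -(Ys_adj mod Sb RG gl) -(ipC ipH).
  rewrite (Ys_Zs l ab) (ipZl ipH) !(ipBl ipH) (ipZl ipH).
  by rewrite mulrA [b^* * a]mulrC ab; ring.
have [Ke Ke0 HKe] := kk_ev_le mod oh hilb X Sa Sb.
pose K := ipK R k; have K0 : 0 < K := ipK_gt0 R k.
pose M := K * nm G + cabs b^* * (K * nm G1) + cabs a * (K * Ka * nm G) + K * Ke * nm G.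
have M0 : 0 <= M by rewrite !(addr_ge0, mulr_ge0, cabs_ge0, nm_ge0) // ltW.
have PhiB f f1 : isR S ev a f f1 -> cabs (Phi f f1) <= M * nm f.
  move=> Rf; have [f2 [Rf2 nf2]] := HKa f.
  have nf1 : nm f1 <= Ka * nm f by rewrite (isR_uniq mod Rf Rf2).
  have le1 x y : cabs (ip x y) <= K * (nm x * nm y) := ip_le mod oh hilb x y.
  rewrite /Phi -(kk_rep' mod) //; apply: le_trans (cabsB _ _) _.
  have -> : M * nm f = K * (nm f * nm G) + cabs b^* * (K * (nm f * nm G1)) +
     cabs a * (K * (Ka * nm f * nm G)) + K * (Ke * nm f * nm G).
    by rewrite /M; ring.
  apply: lerD; last first.
    apply: le_trans (le1 _ _) _; rewrite ler_wpM2l ?(ltW K0) //.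
    by rewrite ler_wpM2r ?nm_ge0.
  apply: le_trans (cabsD _ _) _; apply: lerD.
    apply: le_trans (cabsD _ _) _; apply: lerD => //.
    by rewrite cabsM ler_wpM2l ?cabs_ge0.
  rewrite cabsM ler_wpM2l ?cabs_ge0 //; apply: le_trans (le1 _ _) _.
  by rewrite ler_wpM2l ?(ltW K0) // ler_wpM2r ?nm_ge0.
have PhiD f f1 f' f1' : Phi (f + f') (f1 + f1') = Phi f f1 + Phi f' f1'.
  rewrite /Phi !(ipDl ipH) (linearDE _ _ (evl a)) mulmxDr dotDr.
  move: (dot _ _) (dot _ _) (ip f G) (ip f' G) (ip f G1) (ip f' G1) (ip f1 G) (ip f1' G).
  by move=> *; ring.
apply/eqP; rewrite -subr_eq0 -/(Phi F F1) -cabs_eq0; apply/eqP/le_anti.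
rewrite cabs_ge0 andbT; apply/ler_addgt0Pr => eps eps0; rewrite add0r.
have e0 : 0 < eps / (M + 1) by rewrite divr_gt0 // ltr_wpDl.
have [l [gl Hl]] := off_pair_dense a b F e0.
have RZ := Zs_isR mod Sb ab KP gl.
have -> : Phi F F1 = Phi (F - Gs kk l) (F1 - Zs ev kk X a b l).
  have {1}-> : F = (F - Gs kk l) + Gs kk l by rewrite subrK.
  have {1}-> : F1 = (F1 - Zs ev kk X a b l) + Zs ev kk X a b l by rewrite subrK.
  by rewrite PhiD base // addr0.
apply: le_trans (PhiB _ _ _) _.
  have := isR_lin mod (-1) RZ RF; rewrite !scaleN1r.
  by rewrite ![- _ + _]addrC.
rewrite ltr_pdivlMr ?ltr_wpDl // in Hl.
by have := nm_ge0 hp (F - Gs kk l); nra.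
Qed.

End PairOperator.

(** * Difference quotient operators off the unit circle *)

Section OffCircle.
Variables (R : realType) (U : lmodType (Cplx R)) (ip : U -> U -> Cplx R).
Local Notation C := (Cplx R).
Variables (n : nat) (S : set C) (ev : C -> U -> 'cV[C]_n) (kk : C -> 'cV[C]_n -> U).
Hypothesis mod : rk_model ip S ev kk.
Variables (k : nat) (h : 'I_k -> U).
Hypothesis oh : negative_orthonormal ip h.
Hypothesis hilb : hilbert (majorant ip h).

Let ipH := rk_herm mod.
Let evl := rk_lin mod.
Local Notation hp := (majorant ip h).
Local Notation nm := (nm hp).
Let hpH : herm_form hp. Proof. exact: majorant_herm. Qed.

Variable X : 'M[C]_n.

(** The structural identity as a condition on given images [F1] of [F] and [G1]
    of [G], so that it can be stated before the operators are everywhere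
    defined. *)
Definition R_identity (a b : C) (F F1 G G1 : U) : Prop :=
  ip F G + b^* * ip F G1 + a * ip F1 G - (1 - a * b^*) * ip F1 G1
  = dot (ev b G) (X *m ev a F).

(** [R_a (1 + (a' - a) R_a') = R_a'], a form of the resolvent identity that
    presupposes an image under [R_a'] only. *)
Lemma isR_shift a a' F F1 : S a -> isR S ev a' F F1 ->
  isR S ev a (F + (a' - a) *: F1) F1 /\ ev a (F + (a' - a) *: F1) = ev a' F.
Proof.
move=> Sa RF.
have E : ev a (F + (a' - a) *: F1) = ev a' F.
  rewrite (linearDE _ _ (evl a)) (linearZE _ _ (evl a)) -opprB scaleNr RF //.
  by rewrite opprB addrCA subrr addr0.
split=> // s Ss; rewrite E (linearDE _ _ (evl s)) (linearZE _ _ (evl s)) addrAC -RF //.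
by rewrite -scalerDl addrA subrK.
Qed.

(** By the resolvent identity, the relation at one pair of points with
    [a b^* = 1] implies the relation at every pair. *)
Lemma R_identity_transfer a b : S a -> S b -> a * b^* = 1 ->
  (forall F F1 G G1, isR S ev a F F1 -> isR S ev b G G1 ->
     ip F G + b^* * ip F G1 + a * ip F1 G = dot (ev b G) (X *m ev a F)) ->
  forall a' b' F F1 G G1, isR S ev a' F F1 -> isR S ev b' G G1 ->
    R_identity a' b' F F1 G G1.
Proof.
move=> Sa Sb ab H a' b' F F1 G G1 RF RG.
have [RF' EF] := isR_shift Sa RF; have [RG' EG] := isR_shift Sb RG.
have := H _ _ _ _ RF' RG'; rewrite EF EG /R_identity => <-.
rewrite !(ipDl ipH) !(ipDr ipH) !(ipZl ipH) !(ipZr ipH) rmorphB /=.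
move: ab; move: (b^*) (b'^*) (ip F G) (ip F G1) (ip F1 G) (ip F1 G1) => c c' x y z w ac.
have -> : 1 - a' * c' = a * c - a' * c' by rewrite ac.
ring.
Qed.

(** [flip] reverses the sign of the negative directions, so it leads from either
    form to the other. *)
Lemma flipK f g : ip f g = hp f (flip ip h g).
Proof.
rewrite /flip (ipDr hpH) (ip_sumr hpH).
under eq_bigr => i _ do rewrite (ipZr hpH) conjCK (majorant_neg oh).
rewrite /majorant -addrA mulr_sumr -big_split /= big1 ?addr0 // => i _; ring.
Qed.

Lemma riesz_functional (phi : U -> C) (B : R) : scalar_form phi ->
  (forall f, cabs (phi f) <= B * nm f) -> exists g, forall f, phi f = hp f g.
Proof.
move=> lphi Bphi.
have phi0 : phi 0 = 0.
  have := lphi 1 0 0; rewrite scale1r addr0 mul1r => /eqP.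
  by rewrite -subr_eq0 opprD addNKr oppr_eq0 => /eqP.
have [|||g [Hg _]] := @riesz R U hp hilb (fun f x => x = phi f) B.
- by rewrite phi0.
- by move=> a f x g y -> ->.
- by move=> f x ->.
by exists g => f; apply: Hg.
Qed.

(** The disk automorphism that moves [c] to the origin turns the identity at
    [(c, c)] into the isometry of [(1 - |c|^2) R_c - c^*] on the vectors
    vanishing at [c]; up to finite rank it is a Hilbert space contraction. *)
Lemma R_off_circle c (Rc : U -> U) (K : R) a' :
  S c -> S a' -> 0 < (1 - cabs c ^+ 2) * (1 - cabs a' ^+ 2) ->
  (forall F, isR S ev c F (Rc F)) -> (forall F, nm (Rc F) <= K * nm F) -> 0 <= K ->
  (forall F, R_identity c c F (Rc F) F (Rc F)) ->
  forall F, exists H, isR S ev a' F H.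
Proof.
move=> Sc Sa' side RR BR K0 Id F.
have lR : linear Rc.
  move=> a f g; apply: (isR_uniq mod (RR _)).
  exact: (isR_lin mod).
pose kp : C := 1 - c * c^*.
have kpJ : kp^* = kp by rewrite /kp rmorphB rmorphM rmorph1 /= conjCK mulrC.
have rE (z : C) : real_complex R (1 - cabs z ^+ 2) = 1 - z * z^* :> C.
  by rewrite rmorphB rmorph1 /= cabs_sqr.
have kpE : kp = real_complex R (1 - cabs c ^+ 2) by rewrite rE.
have kp0 : kp != 0.
  rewrite kpE (inj_eq (@complexI R) _ 0); apply/negP => /eqP E.
  by move: side; rewrite E mul0r ltxx.
have den2 : cabs (1 - c^* * a') ^+ 2 = cabs (a' - c) ^+ 2 + (1 - cabs c ^+ 2) * (1 - cabs a' ^+ 2).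
  apply: (@complexI R); rewrite rmorphD [X in _ = _ + X](rmorphM (real_complex R)) /=.
  rewrite !rE !cabs_sqr.
  rewrite !(rmorphB, rmorphM, rmorph1) /= conjCK.
  by move: (c^*) (a'^*) => x y; ring.
have dlt : cabs (a' - c) < cabs (1 - c^* * a').
  by rewrite -(@ltr_pXn2r _ 2) ?nnegrE ?cabs_ge0 // den2 ltrDl.
have den : 0 < cabs (1 - c^* * a') by apply: le_lt_trans (cabs_ge0 _) dlt.
have den0 : 1 - c^* * a' != 0 by rewrite -cabs_gt0.
pose W f := kp *: Rc f - c^* *: f.
have lW : linear W.
  move=> a f g; rewrite /W lR [a *: (_ - _)]scalerBr.
  by rewrite !scalerDr !scalerA [a * kp]mulrC [a * c^*]mulrC opprD addrACA.
pose b := (a' - c) / (1 - c^* * a').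
have b1 : cabs b < 1 by rewrite cabsM cabsV ltr_pdivrMr // mul1r.
have bWE f : f - b *: W f = (kp / (1 - c^* * a')) *: (f - (a' - c) *: Rc f).
  rewrite /W [b *: _]scalerBr opprB addrA !scalerA -{1}[f]scale1r -scalerDl.
  rewrite [RHS]scalerBr scalerA.
  congr (_ *: _ - _ *: _); rewrite /b /kp; field; exact: den0.
have kd0 : kp / (1 - c^* * a') != 0 by rewrite mulf_neq0 ?invr_eq0.
have phi i : exists g, forall f, ip (W f) (h i) = hp f g.
  apply: (@riesz_functional (fun f => ip (W f) (h i)) (cabs kp * K + cabs c^*)).
    by move=> a f g; rewrite lW ipH.1.
  move=> f; apply: le_trans (ip_neg_le oh hilb _ _) _.
  apply: le_trans (nmB hilb _ _) _; rewrite !(nmZ hilb) mulrDl lerD2r -mulrA.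
  by rewrite ler_wpM2l ?cabs_ge0.
have [w Hw] := boolp.choice phi.
pose g (j : 'I_(k + k + n)) := match fintype.split j with
  | inl j' => match fintype.split j' with inl i => h i | inr i => w i end
  | inr i => flip ip h (kk c (delta_mx i 0)) end.
have HW f : (forall j, hp f (g j) = 0) -> nm (W f) <= nm f.
  move=> Hf.
  have fh i : ip f (h i) = 0.
    have := Hf (fintype.unsplit (inl (fintype.unsplit (inl i)))); rewrite /g !unsplitK.
    by rewrite (majorant_neg oh) => /eqP; rewrite oppr_eq0 => /eqP.
  have Wh i : ip (W f) (h i) = 0.
    by have := Hf (fintype.unsplit (inl (fintype.unsplit (inr i)))); rewrite /g !unsplitK Hw.
  have fc : ev c f = 0.
    apply/colP => i; have := Hf (fintype.unsplit (inr i)); rewrite /g unsplitK -flipK.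
    by rewrite (rk_rep mod) // dot_delta mxE.
  rewrite -(@ler_pXn2r _ 2) ?nnegrE ?nm_ge0 // !(nm_sqrE mod hilb).
  rewrite [in leLHS]big1 => [|i _]; last by rewrite Wh cabs0 expr0n.
  rewrite [in leRHS]big1 => [|i _]; last by rewrite fh cabs0 expr0n.
  rewrite !mulr0 !addr0 le_eqVlt; apply/orP; left; apply/eqP; congr (complex.Re _).
  have := Id f; rewrite /R_identity fc mulmx0 dot0r => E.
  rewrite /W !(ipBl ipH) !(ipBr ipH) !(ipZl ipH) !(ipZr ipH) kpJ conjCK.
  rewrite -[RHS]addr0 -[0](mulr0 (- kp)) -E /kp.
  by move: (ip f f) (ip f (Rc f)) (ip (Rc f) f) (ip (Rc f) (Rc f)) (c^*) => x y z t c'; ring.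
have inj f : f - b *: W f = 0 -> f = 0.
  rewrite bWE => /eqP; rewrite scaler_eq0 (negbTE kd0) /= subr_eq0 => /eqP fE.
  have [ac|ac] := eqVneq a' c; first by rewrite fE ac subrr scale0r.
  have key s : S s -> (s - a') *: ev s f = - ((a' - c) *: ev c f).
    move=> Ss; have := RR f s Ss => /(congr1 (fun v => (a' - c) *: v)).
    rewrite scalerA mulrC -scalerA -(linearZE _ _ (evl s)) -fE scalerBr => E.
    have -> : s - a' = (s - c) - (a' - c) by rewrite opprB addrA subrK.
    by rewrite scalerBl E addrAC subrr add0r.
  have fc : ev c f = 0.
    have := key _ Sa'; rewrite subrr scale0r => /esym/eqP.
    by rewrite oppr_eq0 scaler_eq0 subr_eq0 (negbTE ac) => /eqP.
  apply: (ev_ae0 mod (B := [:: a'])) => s Ss; rewrite inE => sa.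
  have := key s Ss; rewrite fc scaler0 oppr0 => /eqP.
  by rewrite scaler_eq0 subr_eq0 (negbTE sa) => /eqP.
have [H] := fredholm hilb lW HW b1 inj ((kp / (1 - c^* * a')) *: Rc F).
rewrite bWE => /(scalerI kd0) HE; exists H.
have key s : S s -> (s - a') *: ev s H = ev s F - (ev c F + (a' - c) *: ev c H).
  move=> Ss; have := congr1 (fun v => (s - c) *: ev s v) HE.
  rewrite RR // (linearBE _ _ (evl s)) (linearZE _ _ (evl s)) scalerBr scalerA mulrC -scalerA RR //.
  rewrite scalerBr => E; rewrite opprD addrA -E.
  have -> : s - a' = (s - c) - (a' - c) by rewrite opprB addrA subrK.
  by rewrite scalerBl opprB addrA addrAC addrK.
move=> s Ss; rewrite key //; congr (_ - _).
by have := key _ Sa'; rewrite subrr scale0r => /esym/eqP; rewrite subr_eq0 => /eqP <-.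
Qed.

End OffCircle.

(** * Difference quotient operators on the unit circle *)

Section OnCircle.
Variables (R : realType) (U : lmodType (Cplx R)) (ip : U -> U -> Cplx R).
Local Notation C := (Cplx R).
Variables (n : nat) (S : set C) (ev : C -> U -> 'cV[C]_n) (kk : C -> 'cV[C]_n -> U).
Hypothesis mod : rk_model ip S ev kk.
Variables (k : nat) (h : 'I_k -> U).
Hypothesis oh : negative_orthonormal ip h.
Hypothesis hilb : hilbert (majorant ip h).

Let ipH := rk_herm mod.
Let evl := rk_lin mod.
Local Notation hp := (majorant ip h).
Local Notation nm := (nm hp).

Variable X : 'M[C]_n.

Lemma cabs_dot_le (c v : 'cV[C]_n) (M : 'I_n -> R) :
  (forall i, cabs (v i 0) <= M i) -> cabs (dot c v) <= \sum_i cabs (c i 0) * M i.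
Proof.
move=> vM; rewrite /dot mxE; apply: le_trans (cabs_sum _ _ _) _.
apply: ler_sum => i _; rewrite !mxE cabsM cabsJ.
by rewrite ler_wpM2l ?cabs_ge0.
Qed.

Lemma ball_boundary_near (c s : C) (d e : R) : 0 < d -> 0 < e ->
  exists t, [/\ cabs (t - s) < e, t != c & cabs (t - c) != d].
Proof.
move=> d0 e0; have [->|sc] := eqVneq s c.
  pose x := Num.min d e / 2; have x0 : 0 < x by rewrite divr_gt0 // lt_min d0.
  have xx : x < Num.min d e by rewrite ltr_pdivrMr // ltr_pMr ?lt_min ?d0 // ltr1n.
  exists (c + real_complex R x); rewrite addrC addKr cabs_real ?(ltW x0) //.
  move: xx; rewrite lt_min => /andP[xd xe]; split=> //; last by rewrite lt_eqF.
  rewrite -subr_eq0 addrAC subrr add0r -cabs_eq0 cabs_real ?(ltW x0) //.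
  by rewrite gt_eqF.
have [sd|sd] := eqVneq (cabs (s - c)) d; last by exists s; rewrite subrr cabs0.
pose x := e / (2 * d); have x0 : 0 < x by rewrite divr_gt0 // mulr_gt0.
have E : s + real_complex R x * (s - c) - c = (1 + real_complex R x) * (s - c).
  by ring.
have Ea : cabs (1 + real_complex R x : C) = 1 + x.
  rewrite -(rmorph1 (real_complex R)) -rmorphD cabs_real ?addr_ge0 //.
  exact: ltW.
exists (s + real_complex R x * (s - c)); split.
- rewrite [s + _]addrC addrK cabsM cabs_real ?(ltW x0) // sd /x.
  have -> : e / (2 * d) * d = e / 2 by field; rewrite gt_eqF.
  by rewrite ltr_pdivrMr // ltr_pMr // ltr1n.
- rewrite -subr_eq0 E mulf_neq0 ?subr_eq0 // -cabs_gt0 Ea.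
  by rewrite addr_gt0.
rewrite E cabsM Ea sd -subr_eq0.
have -> : (1 + x) * d - d = x * d by ring.
by rewrite mulf_neq0 ?gt_eqF.
Qed.

(** Near the unit circle the bound for [R_alpha F] grows like
    [1 / | |alpha|^2 - 1 |]. Averages of these vectors over a small circle,
    with a weight that vanishes at the same rate, stay bounded and converge
    pointwise to [R_a' F]. *)
Lemma R_on_circle a' : S a' -> cabs a' = 1 ->
  (forall a F, S a -> cabs a != 1 -> exists H, isR S ev a F H) ->
  (forall a F H, S a -> isR S ev a F H -> R_identity ip ev X a a F H F H) ->
  forall F, exists H, isR S ev a' F H.
Proof.
move=> Sa' a1 off Id F.
have K0 := ipK_gt0 R k; set K := ipK R k in K0.
have [T HT] := boolp.choice (fun i => let: ex_intro a (ex_intro r (ex_intro B H)) :=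
    analytic_taylor (rk_ana mod F i Sa') in
  ex_intro (fun p : (nat -> C) * R * R => taylor (fun z => ev z F i 0) a' p.1.1 p.1.2 p.2)
    (a, r, B) H).
have [e0 [e00 He0]] := rk_open mod Sa'.
have rT i : 0 < (T i).1.2 by case: (HT i).
have [r0 r00 [r01 r0T]] : exists2 r0 : R, 0 < r0 & r0 <= 1 /\ forall i, r0 <= (T i).1.2.
  have [x x0 Hx] := finite_pos_bound rT.
  exists (Num.min 1 x); first by rewrite lt_min ltr01.
  by split=> [|i]; rewrite ge_min ?lexx ?Hx ?orbT.
pose d := Num.min r0 e0 / 2.
have m0 : 0 < Num.min r0 e0 by rewrite lt_min r00.
have d0 : 0 < d by rewrite divr_gt0.
have dm : d < Num.min r0 e0 by rewrite ltr_pdivrMr // ltr_pMr // ltr1n.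
have [dr de] : d < r0 /\ d < e0 by apply/andP; rewrite -lt_min.
have d1 : d < 1 by apply: lt_le_trans dr r01.
have dT i : d < (T i).1.2 by apply: lt_le_trans dr (r0T i).
clearbody d.
pose al (u : C) : C := a' + a' * real_complex R d * u.
have ald u : cabs u = 1 -> cabs (al u - a') = d.
  by move=> u1; rewrite /al addrC addKr !cabsM a1 u1 mul1r mulr1 cabs_real // ltW.
have Sal u : cabs u = 1 -> S (al u) by move=> u1; apply: He0; rewrite ald.
pose wq (u : C) : C := 1 + real_complex R d * u + u ^+ 2.
have wqE u : cabs u = 1 -> cabs (wq u) * d = `|cabs (al u) ^+ 2 - 1|.
  move=> u1; have uu : u * u^* = 1 by rewrite -cabs_sqr u1 expr1n.
  rewrite -cabs_real_norm rmorphB rmorph1 /= cabs_sqr.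
  have aa : a' * a'^* = 1 by rewrite -cabs_sqr a1 expr1n.
  have dJ : (real_complex R d)^* = real_complex R d :> C.
    by apply: (@conj_Creal C); rewrite ger0_real // (@ler0c R) ltW.
  have -> : al u * (al u)^* - 1 = u^* * (real_complex R d * wq u).
    rewrite /al /wq !(rmorphD, rmorphM) /= dJ; move: aa uu.
    move: (a'^*) (u^*) (real_complex R d) => b v t aa uu.
    have -> : (a' + a' * t * u) * (b + b * t * v) = a' * b * (1 + t * u) * (1 + t * v) by ring.
    rewrite aa mul1r.
    have -> : v * (t * (1 + t * u + u ^+ 2)) = t * v + t * t * (u * v) + t * u * (u * v) by ring.
    have -> : (1 + t * u) * (1 + t * v) - 1 = t * u + t * v + t * t * (u * v) by ring.
    by rewrite uu; ring.
  by rewrite !cabsM cabsJ u1 mul1r cabs_real ?(ltW d0) // mulrC.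
have [Hf HHf] := boolp.choice (fun u => 
  match pselect (cabs u = 1 /\ cabs (al u) != 1) with
  | left p => let: ex_intro H HH := off (al u) F (Sal u p.1) p.2 in
      ex_intro (fun H => cabs u = 1 /\ cabs (al u) != 1 -> isR S ev (al u) F H) H (fun=> HH)
  | right np => ex_intro (fun H => cabs u = 1 /\ cabs (al u) != 1 -> isR S ev (al u) F H) 0 
      (fun p => False_ind _ (np p)) end).
pose M i : R := (T i).2 / (1 - d / (T i).1.2).
have evM u i : cabs u = 1 -> cabs (ev (al u) F i 0) <= M i.
  move=> u1; case: (HT i) => r_gt0 B_ge0 _ /(_ 0%N (al u)).
  by rewrite big_ord0 subr0 expr0 mulr1 ald // => /(_ (dT i)).
have M0 i : 0 <= M i.
  by apply: le_trans (cabs_ge0 _) (evM 1 i _); rewrite cabs1.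
pose good w := [/\ S w, w != a' & cabs (w - a') != d].
have goodS w : good w -> S w by case.
have good_dense : dense_in_S S good.
  move=> s e Ss e0'; have [e1 [e10 He1]] := rk_open mod Ss.
  have [|t [ts ta td]] := @ball_boundary_near a' s d (Num.min e e1) d0; first by rewrite lt_min e0'.
  by exists t; move: ts; rewrite lt_min => /andP[te /He1 St].
have good_sep f : (forall s, good s -> ev s f = 0) -> f = 0.
  by move=> H; apply: (ev_dense0 mod good_dense) => s _; exact: H.
have gap w u : good w -> cabs u = 1 -> `|cabs (w - a') - d| <= cabs (w - al u).
  move=> _ u1; have := cabs_sub (w - a') (al u - a'); have := cabs_sub (al u - a') (w - a').
  have -> : w - a' - (al u - a') = w - al u by rewrite opprB addrA subrK.
  have -> : al u - a' - (w - a') = al u - w by rewrite opprB addrA subrK.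
  rewrite ald // [cabs (al u - w)]cabsC ler_norml.
  by move: (cabs (w - al u)) (cabs (w - a')) => y z; lra.
have gap0 w : good w -> 0 < `|cabs (w - a') - d|.
  by case=> _ _ wd; rewrite normr_gt0 subr_eq0.
have wal w u : good w -> cabs u = 1 -> w - al u != 0.
  by move=> gw u1; rewrite -cabs_gt0; apply: lt_le_trans (gap w u gw u1); exact: gap0.
have evH w u : good w -> cabs u = 1 -> cabs (al u) != 1 ->
    ev w (Hf u) = (w - al u)^-1 *: (ev w F - ev (al u) F).
  move=> gw u1 au; rewrite -(HHf u (conj u1 au)) ?scalerA ?mulVf ?scale1r ?wal //.
  exact: goodS.
have test l : glist good l -> exists2 D : R, 0 <= D & forall u, cabs u = 1 ->
    cabs (al u) != 1 -> cabs (ip (Hf u) (Gs kk l)) <= D.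
  elim: l => [_|[w c] l IH gl].
    by exists 0 => // u _ _; rewrite /Gs big_nil (ip0r ipH) cabs0.
  have [gw /IH [D D0 HD]] := glist_cons gl; rewrite /= in gw.
  exists ((cabs (dot c (ev w F)) + \sum_i cabs (c i 0) * M i) / `|cabs (w - a') - d| + D).
    rewrite addr_ge0 // divr_ge0 // addr_ge0 ?cabs_ge0 // sumr_ge0 // => i _.
    by rewrite mulr_ge0 ?cabs_ge0.
  move=> u u1 au; rewrite (Gs_cons kk (w, c) l) (ipDr ipH).
  apply: le_trans (cabsD _ _) _; apply: lerD; last exact: HD.
  rewrite (rk_rep mod _ _ (goodS w gw)) evH // dotZr dotBr cabsM cabsV mulrC.
  apply: ler_pM; rewrite ?cabs_ge0 ?invr_ge0 ?cabs_ge0 //.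
    apply: le_trans (cabsB _ _) _; rewrite lerD2l.
    by apply: cabs_dot_le => i; exact: evM.
  by rewrite lef_pV2 ?posrE ?gap ?gap0 // cabs_gt0 wal.
have k0 : 0 <= k%:R :> R by rewrite ler0n.
have [l_ Hl] := boolp.choice (fun i => kernel_dense mod hilb goodS good_sep (h i)
  (approx_scale_gt0 R k)).
have [D_ HD_] := boolp.choice (fun i => let: ex_intro2 D D0 H := test (l_ i) (Hl i).1 in
  ex_intro (fun D => 0 <= D /\ forall u, cabs u = 1 ->
    cabs (al u) != 1 -> cabs (ip (Hf u) (Gs kk (l_ i))) <= D) D (conj D0 H)).
pose D := \sum_i D_ i.
have D0 : 0 <= D by apply: sumr_ge0 => i _; case: (HD_ i).
have neg u i : cabs u = 1 -> cabs (al u) != 1 -> cabs (ip (Hf u) (Gs kk (l_ i))) <= D.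
  move=> u1 au; have [_ /(_ _ u1 au) Hi] := HD_ i; apply: le_trans Hi _.
  by rewrite /D (bigD1 i) //= lerDl sumr_ge0 // => j _; case: (HD_ j).
pose E3 := \sum_i M i * \sum_j cabs (X i j) * M j.
pose E1 := cabs (ip F F) + E3; pose E2 := 4 * K * nm F.
have E10 : 0 <= E1.
  rewrite addr_ge0 ?cabs_ge0 // sumr_ge0 // => i _; rewrite mulr_ge0 // sumr_ge0 // => j _.
  by rewrite mulr_ge0 ?cabs_ge0.
have E20 : 0 <= E2 by rewrite !mulr_ge0 ?nm_ge0 // ltW.
pose P := 2 * E2; pose Q := 8 * (E1 + 16 * k%:R * D ^+ 2).
have P0 : 0 <= P by rewrite mulr_ge0.
have kD0 : 0 <= 16 * k%:R * D ^+ 2 by apply: mulr_ge0; [exact: mulr_ge0 | exact: sqr_ge0].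
have Q0 : 0 <= Q by apply: mulr_ge0 => //; apply: addr_ge0.
have bound u : cabs u = 1 -> cabs (al u) != 1 ->
    `|cabs (al u) ^+ 2 - 1| * nm (Hf u) <= P + Q + 1.
  move=> u1 au; set dl := `|_|; set y := nm (Hf u).
  have y0 : 0 <= y := nm_ge0 _ _.
  have dl0 : 0 <= dl by exact: normr_ge0.
  have al2 : cabs (al u) <= 2.
    have := cabsD (al u - a') a'; rewrite subrK ald // a1; move: (cabs (al u)) => z; lra.
  have dl4 : dl <= 4.
    rewrite /dl ler_norml; have := cabs_ge0 (al u).
    by move: (cabs (al u)) al2 => z z2 z0; apply/andP; split; nra.
  have RH := HHf u (conj u1 au).
  have iYY : dl * cabs (ip (Hf u) (Hf u)) <= E1 + E2 * y.
    have E : (1 - al u * (al u)^*) * ip (Hf u) (Hf u) =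
      ip F F + (al u)^* * ip F (Hf u) + al u * ip (Hf u) F -
        dot (ev (al u) F) (X *m ev (al u) F).
      by rewrite -(Id _ _ _ (Sal _ u1) RH); ring.
    have -> : dl * cabs (ip (Hf u) (Hf u)) = cabs ((1 - al u * (al u)^*) * ip (Hf u) (Hf u)).
      by rewrite cabsM /dl -cabs_real_norm cabsC rmorphB rmorph1 /= cabs_sqr.
    rewrite E; apply: le_trans (cabsB _ _) _.
    have h3 : cabs (dot (ev (al u) F) (X *m ev (al u) F)) <= E3.
      apply: le_trans (@cabs_dot_le _ _ (fun i => \sum_j cabs (X i j) * M j) _) _.
        move=> i; rewrite mxE; apply: le_trans (cabs_sum _ _ _) _.
        apply: ler_sum => j _; rewrite cabsM ler_wpM2l ?cabs_ge0 //; exact: evM.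
      apply: ler_sum => i _; rewrite ler_wpM2r ?evM // sumr_ge0 // => j _.
      by rewrite mulr_ge0 ?cabs_ge0.
    have h1 : cabs (ip F (Hf u)) <= K * (nm F * y) := ip_le mod oh hilb _ _.
    have h2 : cabs (ip (Hf u) F) <= K * (nm F * y) by rewrite (cabs_ipC ipH).
    have h12 : cabs (ip F F + (al u)^* * ip F (Hf u) + al u * ip (Hf u) F) <=
        cabs (ip F F) + 2 * (K * (nm F * y)) + 2 * (K * (nm F * y)).
      apply: le_trans (cabsD _ _) _; apply: lerD.
        apply: le_trans (cabsD _ _) _; rewrite lerD2l cabsM cabsJ.
        by apply: ler_pM; rewrite ?cabs_ge0.
      by rewrite cabsM; apply: ler_pM; rewrite ?cabs_ge0.
    apply: le_trans (lerD h12 h3) _; rewrite /E1 /E2.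
    by move: (cabs (ip F F)) (nm F) => v1 v2; rewrite -subr_ge0 le_eqVlt; apply/orP; left; apply/eqP; ring.
  have Hy2 : y ^+ 2 <= 2 * cabs (ip (Hf u) (Hf u)) + 8 * k%:R * D ^+ 2.
    exact: (nm_sqr_approx mod oh hilb D0 (fun i => (Hl i).2) (fun i => neg u i u1 au)).
  rewrite -[leRHS]mulr1; apply: quadratic_bound => //; first by rewrite mulr_ge0.
  have dD : dl * D ^+ 2 <= 4 * D ^+ 2 by rewrite ler_wpM2r // sqr_ge0.
  have h4 : dl * y ^+ 2 <= 2 * (E1 + E2 * y) + 32 * k%:R * D ^+ 2.
    have := ler_wpM2l dl0 Hy2; have := ler_wpM2l k0 dD; move: iYY.
    by move: (cabs (ip _ _)) (D ^+ 2) (y ^+ 2) (k%:R : R) (E2 * y) => v1 v2 v3 v4 v5; nra.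
  have h5 := ler_wpM2l dl0 h4.
  rewrite expr1n !mulr1 exprMn expr2 -mulrA; apply: le_trans h5 _.
  have h6 : 0 <= E1 + 16 * k%:R * D ^+ 2 by apply: addr_ge0.
  have h7 := ler_wpM2r h6 dl4.
  rewrite /P /Q; move: h7; move: (D ^+ 2) (k%:R : R) => v1 v2; nra.
(* The weight vanishes where [al u] lies on the unit circle, so the missing
   vectors there can be replaced by zero. *)
pose Y u : U := if cabs (al u) == 1 then 0 else Hf u.
pose cst := (P + Q + 1) / d.
have cst0 : 0 <= cst by rewrite divr_ge0 ?addr_ge0 // ltW.
have nY u : cabs u = 1 -> nm (wq u *: Y u) <= cst.
  move=> u1; rewrite /Y; have [au|au] := eqVneq (cabs (al u)) 1.
    by rewrite scaler0 (nm0 hilb).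
  by rewrite (nmZ hilb) ler_pdivlMr // mulrAC wqE // bound.
pose avg N : U := (N.+3%:R : C)^-1 *: \sum_(j < N.+3) wq (uroot R N.+3 ^+ j) *: Y (uroot R N.+3 ^+ j).
have navg N : nm (avg N) <= cst.
  rewrite (nmZ hilb) cabsV cabs_nat ler_pdivrMl ?ltr0n //.
  apply: le_trans (nm_sum hilb _ _) _.
  apply: (@le_trans _ _ (\sum_(j < N.+3) cst)).
    by apply: ler_sum => j _; apply: nY; exact: cabs_uroot.
  by rewrite sumr_const card_ord mulr_natl.
have evavg N w i : good w -> ev w (avg N) i 0 = average N.+3 (fun u => wq u *
    ((ev w F i 0 - ev (a' + a' * real_complex R d * u) F i 0) /
     ((w - a') - a' * real_complex R d * u))).
  move=> gw; rewrite (linearZE _ _ (evl w)) (linear_sumE _ _ (evl w)) mxE /average.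
  congr (_ * _); rewrite summxE; apply: eq_bigr => j _.
  rewrite (linearZE _ _ (evl w)) mxE /Y; set u := _ ^+ j.
  have u1 : cabs u = 1 by exact: cabs_uroot.
  have [au|au] := eqVneq (cabs (al u)) 1.
    have -> : wq u = 0; last by rewrite !mul0r.
    apply/eqP; rewrite -cabs_eq0; have := wqE u u1; rewrite au expr1n subrr normr0.
    by move/eqP; rewrite mulf_eq0 (gt_eqF d0) orbF.
  rewrite evH // !mxE; congr (_ * _); rewrite [LHS]mulrC; congr (_ / _).
  by rewrite /al opprD addrA.
pose val s := (s - a')^-1 *: (ev s F - ev a' F).
have lim l : glist good l -> forall eps : R, 0 < eps -> exists N0, forall N, (N0 <= N)%N ->
    cabs (\sum_(q <- l) dot q.2 (val q.1) - ip (avg N) (Gs kk l)) < eps.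
  elim: l => [_|[w c] l IH gl] eps eps0.
    by exists 0%N => N _; rewrite /Gs !big_nil (ip0r ipH) subrr cabs0.
  have [gw {}/IH IH] := glist_cons gl; rewrite /= in gw.
  have e2 : 0 < eps / 2 by rewrite divr_gt0.
  have [N1 H1] := IH _ e2.
  pose sc := 1 + \sum_i cabs (c i 0).
  have sc0 : 0 < sc by rewrite ltr_wpDr // sumr_ge0 // => i _; exact: cabs_ge0.
  have e3 : 0 < eps / 2 / sc by rewrite divr_gt0.
  have [Sw wa wd] := gw.
  have v0 : w - a' != 0 by rewrite subr_eq0.
  have wE : a' + (w - a') = w by rewrite addrC subrK.
  have HN i : exists N0, forall N, (N0 <= N)%N ->
      cabs (val w i 0 - ev w (avg N) i 0) < eps / 2 / sc.
    have fwE : cabs (w - a') < d -> ev w F i 0 = ev (a' + (w - a')) F i 0 by rewrite wE.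
    have [N0 HN0] := average_diff_quot (HT i) d0 (dT i) a1 v0 wd fwE e3.
    exists N0 => N /HN0 /=; rewrite evavg // cabsC /val !mxE mulrC.
    by rewrite [(w - a')^-1 * _]mulrC.
  have [N_ HN_] := boolp.choice HN.
  exists (maxn N1 (\max_i N_ i)) => N; rewrite geq_max => /andP[/H1 h1 Nm].
  rewrite (Gs_cons kk (w, c) l) big_cons (ipDr ipH) /= opprD addrACA.
  apply: le_lt_trans (cabsD _ _) _; rewrite [eps]splitr; apply: ler_ltD => //.
  rewrite (rk_rep mod) // -dotBr.
  apply: le_trans (@cabs_dot_le _ _ (fun=> eps / 2 / sc) _) _.
    move=> i; rewrite !mxE; have := HN_ i N (leq_trans (leq_bigmax i) Nm).
    by rewrite /val !mxE => /ltW.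
  rewrite -mulr_suml mulrCA -[leRHS]mulr1 ler_wpM2l ?(ltW e2) //.
  by rewrite ler_pdivrMr // mul1r /sc lerDr.
have [|l gl|H [HE _]] := @weak_riesz _ _ _ _ _ _ _ mod _ _ oh hilb _ goodS val (K * cst).
- by rewrite mulr_ge0 // ltW.
- apply/ler_addgt0Pr => eps eps0; have [N0 HN0] := lim l gl eps eps0.
  have := HN0 N0 (leqnn _); set z := ip _ _; set s := \sum_(_ <- _) _ => hs.
  have -> : s = (s - z) + z by rewrite subrK.
  apply: le_trans (cabsD _ _) _; rewrite addrC; apply: lerD; last exact: ltW.
  apply: le_trans (ip_le mod oh hilb _ _) _; rewrite -mulrA ler_wpM2l ?(ltW K0) //.
  by rewrite ler_wpM2r ?nm_ge0.
exists H; apply: (isR_dense mod good_dense) => s Ss gs; rewrite HE // /val scalerA.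
by case: gs => _ sa _; rewrite mulfV ?scale1r // subr_eq0.
Qed.

End OnCircle.

(** * Equivalence of the kernel formula and the operator identity *)

Section Equivalence.
Variables (R : realType) (U : lmodType (Cplx R)) (ip : U -> U -> Cplx R).
Local Notation C := (Cplx R).
Variables (n : nat) (S : set C) (ev : C -> U -> 'cV[C]_n) (kk : C -> 'cV[C]_n -> U).
Hypothesis mod : rk_model ip S ev kk.
Let ipH := rk_herm mod.
Let evl := rk_lin mod.

Variable X : 'M[C]_n.
Hypothesis uX : X \in unitmx.
Hypothesis hX : adjmx X = X.

Theorem kernel_formula_identity (Th : C -> 'M[C]_n) :
  (forall s t, S s -> S t -> s * t^* != 1 ->
    (1 - s * t^*) *: kap ev kk s t = invmx X - Th s *m X *m adjmx (Th t)) ->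
  (forall a F, S a -> exists H, isR S ev a F H) /\
  (forall a b F F1 G G1, isR S ev a F F1 -> isR S ev b G G1 ->
     R_identity ip ev X a b F F1 G G1).
Proof.
move=> KF.
have [k [h [oh hilb]]] := pontryagin_majorant ipH (rk_pont mod).
have [a [b [Sa Sb ab anb _]]] := rk_pairs mod [::].
have ba : b * a^* = 1 by have := congr1 (fun z => z^*) ab; rewrite /= rmorphM /= conjCK conjC1 mulrC.
have ks : kernel_symm S ev kk X a b.
  by split=> // s t Ss St; exact: (kernel_pair mod uX KF Sa Sb ab Ss St).
have ks' : kernel_symm S ev kk X b a.
  by split=> // s t Ss St; exact: (kernel_pair mod uX KF Sb Sa ba Ss St).
have bna : b != a by rewrite eq_sym.
have Id : forall a b F F1 G G1, isR S ev a F F1 -> isR S ev b G G1 ->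
     R_identity ip ev X a b F F1 G G1.
  apply: (R_identity_transfer mod Sa Sb ab) => F F1 G G1 RF RG.
  exact: (pair_identity mod oh hilb ks ks' anb RF RG).
have off c d : kernel_symm S ev kk X c d -> kernel_symm S ev kk X d c -> c != d ->
    forall a', S a' -> 0 < (1 - cabs d ^+ 2) * (1 - cabs a' ^+ 2) ->
    forall F, exists H, isR S ev a' F H.
  move=> kcd kdc cd a' Sa' side.
  have [K K0 HK] := R_bounded mod oh hilb kcd kdc cd.
  have [Rd HRd] := boolp.choice HK.
  have Sd : S d by case: kcd.
  apply: (R_off_circle mod oh hilb (X := X) Sd Sa' side (Rc := Rd) (K := K)) => //.
  - by move=> F; case: (HRd F).
  - by move=> F; case: (HRd F).
  - by move=> F; apply: Id; case: (HRd F).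
have a1 : cabs a != 1.
  apply/negP => /eqP a1; move/eqP: anb; apply.
  have aa : a * a^* = 1 by rewrite -cabs_sqr a1 expr1n.
  have a0 : a != 0 by rewrite -cabs_gt0 a1.
  by apply: (inj_comp (mulfI a0) (can_inj (@conjCK C))); rewrite /= aa ab.
have cab : cabs a * cabs b = 1 by rewrite -[cabs b]cabsJ -cabsM ab cabs1.
have offc a' F : S a' -> cabs a' != 1 -> exists H, isR S ev a' F H.
  move=> Sa' a'1.
  have ca0 := cabs_ge0 a; have cb0 := cabs_ge0 b; have ca'0 := cabs_ge0 a'.
  have [lt|gt|eq] := ltgtP ((1 - cabs a ^+ 2) * (1 - cabs a' ^+ 2)) 0.
  - apply: (off _ _ ks ks' anb) => //.
    have := lt; have bE : (1 - cabs b ^+ 2) * cabs a ^+ 2 = - (1 - cabs a ^+ 2).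
      have -> : (1 - cabs b ^+ 2) * cabs a ^+ 2 = cabs a ^+ 2 - (cabs a * cabs b) ^+ 2 by ring.
      by rewrite cab; ring.
    have a2 : 0 < cabs a ^+ 2.
      rewrite exprn_gt0 // lt0r ca0 andbT; apply/negP => /eqP E.
      by move/eqP: cab; rewrite E mul0r eq_sym oner_eq0.
    rewrite -(pmulr_rgt0 _ a2) mulrA [_ ^+ 2 * (1 - cabs b ^+ 2)]mulrC bE mulNr oppr_gt0.
    by [].
  - exact: (off _ _ ks' ks bna).
  - move/eqP: eq; rewrite mulf_eq0 !subr_eq0 ![1 == _]eq_sym !sqrp_eq1 //.
    by rewrite (negbTE a1) (negbTE a'1).
split=> // a' F Sa'; have [a'1|a'1] := eqVneq (cabs a') 1; last exact: offc.
apply: (R_on_circle mod oh hilb (X := X) Sa' a'1).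
  by move=> c G Sc c1; exact: offc.
by move=> c G H _ RG; exact: Id.
Qed.

(** Conversely, the identity at a single point [a0] of the unit circle, where
    its last term vanishes, determines the kernel from its values at [a0]. *)
Theorem identity_kernel_formula a0 : S a0 -> cabs a0 = 1 ->
  (forall F, exists H, isR S ev a0 F H) ->
  (forall F F1 G G1, isR S ev a0 F F1 -> isR S ev a0 G G1 ->
     R_identity ip ev X a0 a0 F F1 G G1) ->
  let Th s := invmx X + (a0^* * (s - a0)) *: kap ev kk s a0 in
  forall s t, S s -> S t ->
    (1 - s * t^*) *: kap ev kk s t = invmx X - Th s *m X *m adjmx (Th t).
Proof.
move=> Sa0 a01 RE Id Th s t Ss St.
have aa : a0 * a0^* = 1 by rewrite -cabs_sqr a01 expr1n.
set A := kap ev kk s a0; set B := kap ev kk a0 t; set Kst := kap ev kk s t.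
have Kts : adjmx (kap ev kk t s) = Kst by rewrite (kapC mod Ss St) adjmxK.
have Ats : adjmx (kap ev kk a0 s) = A by rewrite (kapC mod Ss Sa0) adjmxK.
have key : ((s * t^* - 1) *: Kst - (a0^* * (s - a0)) *: A - (a0 * (t^* - a0^*)) *: B)
    = ((s - a0) * (t^* - a0^*)) *: (A *m X *m B).
  apply: mulmx_delta_inj => c; apply/eqP; rewrite -subr_eq0; apply/eqP.
  apply: dot_eq0 => d; rewrite dotBr.
  have [F1 RF] := RE (kk t c); have [G1 RG] := RE (kk s d).
  have := Id _ _ _ _ RF RG; rewrite /R_identity aa subrr mul0r subr0.
  have e1 : ev s (kk t c) = Kst *m c := ev_kk mod s c St.
  have e2 : ev a0 (kk t c) = B *m c := ev_kk mod a0 c St.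
  have e3 : ev t (kk s d) = kap ev kk t s *m d := ev_kk mod t d Ss.
  have e4 : ev a0 (kk s d) = kap ev kk a0 s *m d := ev_kk mod a0 d Ss.
  have DF : (s - a0) * ip F1 (kk s d) = dot d (Kst *m c) - dot d (B *m c).
    by rewrite (rk_rep mod F1 d Ss) -dotZr (RF s Ss) dotBr e1 e2.
  have DG : (t^* - a0^*) * ip (kk t c) G1 = dot d (Kst *m c) - dot d (A *m c).
    rewrite (kk_rep' mod G1 c St) -rmorphB -dotZl (RG t St) e3 e4 dotBl.
    by congr (_ - _); [rewrite -Kts; exact: dot_mulmxl | rewrite -Ats; exact: dot_mulmxl].
  have E1 : ip (kk t c) (kk s d) = dot d (Kst *m c) by rewrite (rk_rep mod _ d Ss) e1.
  have E2 : dot (ev a0 (kk s d)) (X *m ev a0 (kk t c)) = dot d (A *m X *m B *m c).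
    by rewrite e2 e4 /dot adjmxM Ats !mulmxA.
  rewrite E1 E2; move: DF DG; clear - aa.
  move: Kst A B (ip F1 _) (ip _ G1) => Kst A B y1 y2 D1 D2 E.
  rewrite !mulmxBl -!scalemxAl !dotBr !dotZr.
  move: D1 D2 E aa; move: (a0^*) (t^*) => b0 t'.
  pose x1 : C := dot d (Kst *m c); pose x2 : C := dot d (A *m c).
  pose x3 : C := dot d (B *m c); pose x4 : C := dot d (A *m X *m B *m c).
  rewrite -/x1 -/x2 -/x3 -/x4.
  change ((s - a0) * y1 = x1 - x3 -> (t' - b0) * y2 = x1 - x2 ->
    x1 + b0 * y2 + a0 * y1 = x4 -> a0 * b0 = 1 ->
    (s * t' - 1) * x1 - b0 * (s - a0) * x2 - a0 * (t' - b0) * x3 -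
      (s - a0) * (t' - b0) * x4 = 0).
  clearbody x1 x2 x3 x4 => D1 D2 E aa.
  have -> : (s * t' - 1) * x1 - b0 * (s - a0) * x2 - a0 * (t' - b0) * x3 =
     (s - a0) * (t' - b0) * x1 + b0 * (s - a0) * (x1 - x2) + a0 * (t' - b0) * (x1 - x3).
    by rewrite -aa; ring.
  by rewrite -D1 -D2 -E; ring.
have aJ : (a0^*)^* = a0 by exact: conjCK.
have Tt : adjmx (Th t) = invmx X + (a0 * (t^* - a0^*)) *: B.
  by rewrite /Th adjmxD adjmxZ adjmx_inv hX -(kapC mod St Sa0) rmorphM rmorphB /= conjCK.
rewrite Tt /Th -/A -/Kst; clearbody A B Kst; rewrite mulmxDl mulVmx // mulmxDr mulmxDl mul1mx mulmxDl mul1mx.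
rewrite -!scalemxAl -!scalemxAr scalerA mulmxK //.
have -> : (a0^* * (s - a0) * (a0 * (t^* - a0^*))) *: (A *m X *m B) =
  ((s - a0) * (t^* - a0^*)) *: (A *m X *m B).
  congr (_ *: _); move: aa; move: (a0^*) => b0 aa.
  by rewrite -[RHS]mul1r -aa; ring.
rewrite -key; move: (invmx X) => x.
by apply/matrixP => i j; rewrite !mxE; ring.
Qed.

End Equivalence.

(** * A space of functions as a vector space of its own *)

Section Subspace.
Variables (C : numClosedFieldType) (E : lmodType C) (V : set E).

Definition subspace_pred (hV : lin_subspace V) : {pred E} := fun x => `[< V x >].

Lemma subspace_submod (hV : lin_subspace V) : submod_closed (subspace_pred hV).
Proof.
split; first by apply/asboolP; exact: hV.1.
by move=> a x y /asboolP Vx /asboolP Vy; apply/asboolP; exact: hV.2.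
Qed.

HB.instance Definition _ (hV : lin_subspace V) :=
  GRing.isSubmodClosed.Build C E (subspace_pred hV) (subspace_submod hV).

(** A type of its own lets the form be total on a vector space, as the
    preceding sections assume. *)
Record subspace_of (hV : lin_subspace V) :=
  Subspace { sval_of :> E; sval_ofP : sval_of \in subspace_pred hV }.

HB.instance Definition _ (hV : lin_subspace V) := [isSub for @sval_of hV].
HB.instance Definition _ (hV : lin_subspace V) := [Choice of subspace_of hV by <:].
HB.instance Definition _ (hV : lin_subspace V) :=
  [SubChoice_isSubLmodule of subspace_of hV by <:].

Variable hV : lin_subspace V.
Variable ip : E -> E -> C.

Lemma subspaceP (f : subspace_of hV) : V f.
Proof. by apply/asboolP; exact: (sval_ofP f). Qed.

Definition to_subspace (f : E) (Vf : V f) : subspace_of hV :=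
  Subspace (introT (asboolP _) Vf : f \in subspace_pred hV).

Lemma subspace_val_inj (f g : subspace_of hV) : f = g :> E -> f = g.
Proof. exact: val_inj. Qed.

Definition sub_ip (f g : subspace_of hV) : C := ip f g.

End Subspace.

Section SubspacePontryagin.
Variables (R : realType) (E : lmodType (Cplx R)) (V : set E).
Local Notation C := (Cplx R).
Variables (hV : lin_subspace V) (ip : E -> E -> C).
Hypothesis pont : pontryagin V ip.

Lemma sub_ip_herm : herm_form (@sub_ip C E V hV ip).
Proof.
case: pont => _ [lin herm] _; split=> [a f g h|f g].
  exact: lin (subspaceP f) (subspaceP g) (subspaceP h).
exact: herm (subspaceP f) (subspaceP g).
Qed.

Lemma sub_pontryagin : pontryagin setT (@sub_ip C E V hV ip).
Proof.
case: pont => _ _ [Vp [Vm [[lp lm] [sp sm] dec orth [pos comp neg fin]]]].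
have sub W : lin_subspace W -> lin_subspace [set f : subspace_of hV | W (f : E)].
  by move=> [W0 Wl]; split=> [|a f g Wf Wg]; [exact: W0 | exact: Wl].
split; first by [].
  by split=> [a f g h _ _ _|f g _ _]; [exact: sub_ip_herm.1 | exact: sub_ip_herm.2].
exists [set f : subspace_of hV | Vp (f : E)], [set f : subspace_of hV | Vm (f : E)].
split=> //; first by split; exact: sub.
  move=> f _; have [g [h [Vg Vh fE]]] := dec _ (subspaceP f).
  exists (to_subspace hV (sp _ Vg)), (to_subspace hV (sm _ Vh)); split=> //.
  exact: subspace_val_inj.
  by move=> g h Vg Vh; exact: orth.
have nz (f : subspace_of hV) : f != 0 -> (f : E) != 0.
  by apply: contra => /eqP f0; apply/eqP; apply: subspace_val_inj.
split.
- by move=> g Vg g0; apply: pos => //; exact: nz.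
- move=> u Vu cu; have [l Vl Hl] := comp (fun n => u n : E) Vu cu.
  by exists (to_subspace hV (sp _ Vl)).
- by move=> g Vg g0; apply: neg => //; exact: nz.
have [m [b [Vb Hb]]] := finite_dim_basis lm fin.
exists m, (fun i => to_subspace hV (sm _ (Vb i))) => f /Hb [c fE].
exists c; apply: subspace_val_inj; rewrite fE.
by elim/big_rec2: _ => // i x y _ ->.
Qed.

End SubspacePontryagin.

(** * Rational functions: roots, derivatives and partial fractions *)

Section RationalFunction.
Variable R : realType.
Local Notation C := (Cplx R).
Variables (N : nat) (r : ratfun C).
Hypothesis N0 : (0 < N)%N.
Hypothesis sizeP : size (rnum r) = N.+1.
Hypothesis sizeQ : (size (rden r) <= size (rnum r))%N.
Local Notation P := (rnum r).
Local Notation Q := (rden r).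

Lemma horner_continuous (p : {poly C}) (z : C) : {for z, continuous (fun x => p.[x])}.
Proof.
elim/poly_ind: p => [|p c IH].
  have -> : (fun x => (0 : {poly C}).[x]) = (fun=> 0) by apply/funext => x; rewrite horner0.
  exact: cst_continuous.
have -> : (fun x => (p * 'X + c%:P).[x]) = (fun x => p.[x] * x + c).
  by apply/funext => x; rewrite hornerMXaddC.
apply: continuousD; last exact: cst_continuous.
by apply: continuousM; [exact: IH | exact: cvg_id].
Qed.

Lemma frac_continuous (p q : {poly C}) (z : C) : q.[z] != 0 ->
  {for z, continuous (fun x => p.[x] / q.[x])}.
Proof.
move=> qz; apply: continuousM; first exact: horner_continuous.
by apply: continuousV => //; exact: horner_continuous.
Qed.

Lemma rat_continuous z : regular r z -> {for z, continuous (r : C -> C)}.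
Proof. exact: frac_continuous. Qed.

Lemma regular_near z : regular r z -> exists d : R, 0 < d /\
  forall x, cabs (x - z) < d -> regular r x.
Proof.
move=> rz; have z0 : 0 < cabs Q.[z] by rewrite cabs_gt0.
have [/(_ (horner_continuous (p := Q) (z := z))) H _] := continuous_cabsP (fun x => Q.[x]) z.
have [d [d0 Hd]] := H _ z0; exists d; split=> // x /Hd xz; apply/negP => /eqP Qx.
by move: xz; rewrite Qx sub0r cabsN ltxx.
Qed.

(** The polynomial whose roots are the solutions of [r w = a]. *)
Definition level (a : C) : {poly C} := P - a *: Q.

Lemma level_neq0 a : level a != 0.
Proof.
apply/negP; rewrite subr_eq0 => /eqP PE.
have [w Pw] : exists w, root P w.
  by apply/closed_rootP; rewrite sizeP eqSS -lt0n.
have Qw : Q.[w] != 0 := coprimep_root (rnum_rden_coprime r) Pw.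
have a0 : a = 0.
  by move/eqP: Pw; rewrite PE hornerZ => /eqP; rewrite mulf_eq0 (negbTE Qw) orbF => /eqP.
by have := sizeP; rewrite PE a0 scale0r size_poly0.
Qed.

Lemma size_level a : (size (level a) <= N.+1)%N.
Proof.
apply: leq_trans (size_polyD _ _) _; rewrite size_polyN geq_max sizeP leqnn /=.
by apply: leq_trans (size_scale_leq _ _) _; rewrite -sizeP.
Qed.

Lemma level_horner a z : regular r z -> (level a).[z] = (r z - a) * Q.[z].
Proof.
move=> rz; rewrite !hornerE /= /rat_eval mulrBl divfK //.
Qed.

Lemma roots_ofE a w : roots_of r a w <-> root (level a) w.
Proof.
split=> [[rw <-]|]; first by rewrite /root level_horner // subrr mul0r.
move=> rootw; have rw : regular r w.
  apply/negP => /eqP Qw; move: rootw; rewrite /root !hornerE /= Qw mulr0 subr0 => Pw.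
  have := coprimep_root (rnum_rden_coprime r) Pw.
  by rewrite Qw eqxx.
split=> //; move: rootw; rewrite /root level_horner // mulf_eq0 (negbTE rw) orbF.
by rewrite subr_eq0 => /eqP.
Qed.

Lemma lim_punctured (g h : C -> C) (z : C) (d : R) :
  0 < d -> (forall x, cabs (x - z) < d -> x != z -> g x = h x) ->
  {for z, continuous h} -> lim (g x @[x --> z^']) = h z.
Proof.
move=> d0 gh /continuous_cabsP hc; apply: cvg_lim; first exact: norm_hausdorff.
have FF : Filter (z^' : set_system C) by exact: dnbhs_filter.
apply: (cvgrPdist_lt (FF := FF) _ (h z)).2 => eps eps0.
have eE := real_complexE0 (ltW eps0).
have [|e [e0 He]] := hc (complex.Re eps); first by rewrite -(@ltcR R) -eE.
apply/nbhs_ballP; exists (real_complex R (Num.min d e)).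
  by rewrite /= (@ltcR R 0) lt_min d0.
move=> x; rewrite /ball /= cabsE (@ltcR R) cabsC lt_min => /andP[xd xe] xz.
by rewrite gh // eE cabsE (@ltcR R) cabsC; exact: He.
Qed.

Lemma derive1_quotient (f g : C -> C) (a : C) (d : R) : 0 < d ->
  (forall z, cabs (z - a) < d -> f z - f a = (z - a) * g z) ->
  {for a, continuous g} -> derive1 f a = g a.
Proof.
move=> d0 fg gc; rewrite /derive1 -[in RHS](add0r a).
have hc : {for 0, continuous (fun h : C => g (h + a))}.
  apply/continuous_cabsP => eps eps0.
  have [e [e0 He]] := (continuous_cabsP g a).1 gc eps eps0; exists e; split=> // h hd.
  by rewrite add0r; apply: He; rewrite addrK -[h]subr0.
apply: (lim_punctured d0 _ hc) => h; rewrite subr0 => hd h0.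
by rewrite fg addrK // /GRing.scale /= mulKf.
Qed.

(** Removing one root from [level (r a)] gives the numerator of the difference
    quotient of [r] at [a]; its value at [a] gives the derivative. *)
Lemma level_factor a : regular r a -> exists T : {poly C},
  [/\ level (r a) = ('X - a%:P) * T, (size T <= N)%N,
      derive1 r a = T.[a] / Q.[a] &
      forall z, regular r z -> diff_quot r a z = T.[z] / Q.[z]].
Proof.
move=> ra; have /roots_ofE/factor_theorem [T E] : roots_of r (r a) a by [].
exists T; have sT : (size T <= N)%N.
  have := size_level (r a); rewrite E; have [->|T0] := eqVneq T 0.
    by rewrite size_poly0.
  by rewrite size_Mmonic ?monicXsubC // size_XsubC addn2.
have step z : regular r z -> r z - r a = (z - a) * (T.[z] / Q.[z]).
  move=> rz; have := level_horner (r a) rz; rewrite E hornerM hornerXsubC => H.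
  by rewrite mulrA -[(z - a) * _]mulrC H mulfK.
have dE : derive1 r a = T.[a] / Q.[a].
  have [d [d0 Hd]] := regular_near ra.
  apply: (@derive1_quotient r (fun z => T.[z] / Q.[z]) a d d0) => [z /Hd|]; first exact: step.
  exact: frac_continuous.
split=> //; first by rewrite mulrC.
move=> z rz; rewrite /diff_quot; have [->//|za] := eqVneq z a.
by rewrite step // mulrAC mulfV ?mul1r // subr_eq0.
Qed.

Lemma Lspace_frac f : Lspace r f -> exists q : {poly C}, (size q <= N)%N /\
  forall z, regular r z -> f z = q.[z] / Q.[z].
Proof.
move=> [m [a [c [ra fE]]]].
have [T HT] := boolp.choice (fun k => level_factor (ra k)).
exists (\sum_k c k *: T k); split.
  apply: leq_trans (size_sum _ _ _) _; apply/bigmax_leqP => k _.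
  by apply: leq_trans (size_scale_leq _ _) _; case: (HT k).
move=> z rz; rewrite fE // horner_sum mulr_suml; apply: eq_bigr => k _.
by rewrite hornerZ -mulrA; case: (HT k) => _ _ _ ->.
Qed.

(** The fibre of [r] over [a] as a list without repetition, since [Omega] only
    asserts the existence of a bijection. *)
Definition rts (a : C) : seq C := 
  if pselect (Omega N r a) is left _ then enum_fset (fset_set (roots_of r a)) else [::].

Lemma rtsP a : Omega N r a ->
  [/\ uniq (rts a), size (rts a) = N & forall w, (w \in rts a) <-> roots_of r a w].
Proof.
move=> Oa; rewrite /rts; case: pselect => // _.
have fin : finite_set (roots_of r a) by exists N.
split; first exact: fset_uniq.
  by apply/card_eq_fsetP; rewrite fset_setK.
move=> w; have H := in_fset_set fin w.
by split=> [wr|/mem_set]; [apply: set_mem; rewrite -H; exact: wr | rewrite -H => wr; exact: wr].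
Qed.

Lemma rts_sum (V : nmodType) a (F : C -> V) : Omega N r a ->
  \sum_(w \in roots_of r a) F w = \sum_(w <- rts a) F w.
Proof.
move=> Oa; rewrite fsbig_finite; last by exists N.
by rewrite /rts; case: pselect.
Qed.

Lemma rts_regular a w : Omega N r a -> w \in rts a -> regular r w /\ r w = a.
Proof. by move=> Oa; case: (rtsP Oa) => _ _ H /H. Qed.

Lemma rts_derive a w : Omega N r a -> w \in rts a ->
  derive1 r w != 0 /\ forall x, x \in rts a -> x != w ->
  forall T, level a = ('X - w%:P) * T -> T.[x] = 0.
Proof.
move=> Oa wr; have [ur sr Hr] := rtsP Oa.
have [rw rwa] := rts_regular Oa wr.
have [T [LE sT dE _]] := level_factor rw; rewrite rwa in LE.
have Tx x T' : x \in rts a -> x != w -> level a = ('X - w%:P) * T' -> T'.[x] = 0.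
  move=> /Hr/roots_ofE; rewrite /root => /eqP Lx xw E; move/eqP: Lx.
  by rewrite E hornerM hornerXsubC mulf_eq0 subr_eq0 (negbTE xw) => /eqP.
split; last by move=> x xr xw T'; exact: Tx.
rewrite dE mulf_neq0 ?invr_eq0 //; apply/negP => /eqP Tw.
(* Otherwise T vanishes at all N roots. *)
have : T = 0.
  apply: (roots_geq_poly_eq0 (rs := rts a)) => //; last by rewrite sr.
  apply/allP => x xr; rewrite /root; have [->|xw] := eqVneq x w; first exact/eqP.
  by apply/eqP; exact: Tx LE.
by move=> T0; have := level_neq0 a; rewrite LE T0 mulr0 eqxx.
Qed.

(** Lagrange interpolation of the numerator at the roots of [r w = alpha]. *)
Lemma partial_fraction a (e : C -> C) (q : {poly C}) z : Omega N r a ->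
  (size q <= N)%N -> (forall z, regular r z -> e z = q.[z] / Q.[z]) ->
  regular r z -> r z != a ->
  \sum_(w <- rts a) e w / (derive1 r w * (z - w)) = e z / (r z - a).
Proof.
move=> Oa sq eE rz rza; have [ur sr Hr] := rtsP Oa.
have [T HT] : exists T : C -> {poly C}, forall w, w \in rts a ->
    [/\ level a = ('X - w%:P) * T w, (size (T w) <= N)%N & derive1 r w = (T w).[w] / Q.[w]].
  have H w : exists T : {poly C}, w \in rts a ->
    [/\ level a = ('X - w%:P) * T, (size T <= N)%N & derive1 r w = T.[w] / Q.[w]].
    have [wr|wr] := boolP (w \in rts a); last by exists 0.
    have [rw rwa] := rts_regular Oa wr.
    by have [T [LE sT dE _]] := level_factor rw; exists T; rewrite -{1}rwa.
  by have [T HT] := boolp.choice H; exists T.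
pose L := \sum_(w <- rts a) (e w / derive1 r w) *: T w.
have LE : L = q.
  apply/eqP; rewrite -subr_eq0; apply/eqP.
  apply: (roots_geq_poly_eq0 (rs := rts a)) => //; last first.
    rewrite sr; apply: leq_trans (size_polyD _ _) _; rewrite size_polyN geq_max sq andbT.
    rewrite /L big_seq; apply: leq_trans (size_sum _ _ _) _; apply/bigmax_leqP_seq => w wr _.
    by apply: leq_trans (size_scale_leq _ _) _; case: (HT w wr).
  apply/allP => x xr; rewrite /root !hornerE horner_sum subr_eq0; apply/eqP.
  rewrite (bigD1_seq x) //= big_seq_cond big1 ?addr0 => [|w /andP[wr wx]].
    have [rx _] := rts_regular Oa xr; have [dx _] := rts_derive Oa xr.
    have [_ _ dE] := HT x xr; rewrite hornerZ eE //; move: dx; rewrite dE => dx.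
    have Tx0 : (T x).[x] != 0 by apply: contraNneq dx => ->; rewrite mul0r.
    by field; rewrite rx.
  have [_ Hx] := rts_derive Oa wr; have [Lw _ _] := HT w wr.
  by rewrite hornerZ (Hx x xr _ _ Lw) ?mulr0 // eq_sym.
rewrite [e z]eE // -LE /L horner_sum !mulr_suml big_seq [RHS]big_seq.
apply: eq_bigr => w wr; have [Lw _ _] := HT w wr.
have := level_horner a rz; rewrite Lw hornerM hornerXsubC => E.
have zw : z - w != 0.
  rewrite subr_eq0; apply/negP => /eqP zw; move/eqP: rza; apply.
  by rewrite zw; case: (rts_regular Oa wr).
have ra0 : r z - a != 0 by rewrite subr_eq0.
have [dx _] := rts_derive Oa wr.
have TE : (T w).[z] = (r z - a) * Q.[z] / (z - w) by rewrite -E mulrC mulKf.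
rewrite hornerZ TE; field.
by rewrite dx zw rz ra0.
Qed.

End RationalFunction.

Section RegularValues.
Variable R : realType.
Local Notation C := (Cplx R).
Variables (N : nat) (r : ratfun C).
Hypothesis N0 : (0 < N)%N.
Hypothesis sizeP : size (rnum r) = N.+1.
Hypothesis sizeQ : (size (rden r) <= size (rnum r))%N.
Local Notation P := (rnum r).
Local Notation Q := (rden r).

Lemma Omega_list a (s : seq C) : uniq s -> size s = N ->
  (forall w, w \in s <-> roots_of r a w) -> Omega N r a.
Proof.
move=> us ss Hs; rewrite /Omega /=.
have -> : roots_of r a = [set` seq_fset tt s].
  have E x : (x \in seq_fset tt s) = (x \in s) by exact: seq_fsetE.
  by apply/seteqP; split=> w; [move/Hs; rewrite -E | move=> ws; apply/Hs; rewrite -E].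
apply/card_eq_fsetP; rewrite size_seq_fset.
by rewrite undup_id.
Qed.

Lemma Omega_separable a : size (level r a) = N.+1 ->
  (forall w, root (level r a) w -> (level r a)^`().[w] != 0) -> Omega N r a.
Proof.
move=> sl sep; have [s Ds] := closed_field_poly_normal (level r a).
have l0 : lead_coef (level r a) != 0 by rewrite lead_coef_eq0 (level_neq0 N0 sizeP).
have us : uniq s.
  rewrite -separable_prod_XsubC unlock.
  have : coprimep (level r a) (level r a)^`() by apply: Pdiv.ClosedField.root_coprimep.
  by rewrite Ds derivZ coprimepZl // coprimepZr.
apply: (Omega_list us).
  by move: sl; rewrite Ds size_scale // size_prod_XsubC => -[].
move=> w; apply: iff_sym; apply: (iff_trans (roots_ofE _ _ _)).
by rewrite Ds rootZ // root_prod_XsubC.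
Qed.

Definition wronskian : {poly C} := P^`() * Q - P * Q^`().

(** Otherwise [P], being prime to [Q], would divide its own derivative. *)
Lemma wronskian_neq0 : wronskian != 0.
Proof.
rewrite subr_eq0; apply/negP => /eqP E.
have PP' : P %| P^`().
  by rewrite -(Gauss_dvdpl _ (rnum_rden_coprime r)) E dvdp_mulr.
have P'0 : P^`() != 0.
  apply/negP => /eqP P'; have := congr1 (fun p : {poly C} => p`_N.-1) P'.
  rewrite coef_deriv coef0 prednK // => /eqP; rewrite mulrn_eq0 (gtn_eqF N0) /=.
  have -> : P`_N = lead_coef P by rewrite lead_coefE sizeP.
  by rewrite lead_coef_eq0 -size_poly_eq0 sizeP.
by have := dvdp_leq P'0 PP'; rewrite leqNgt lt_size_deriv // -size_poly_gt0 sizeP.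
Qed.

(** Only the values of [r] at its critical points and at infinity can fail to
    have [N] distinct preimages. *)
Lemma Omega_cofinite : exists B : seq C, forall a, a \notin B -> Omega N r a.
Proof.
have [ws Dw] := closed_field_poly_normal wronskian.
exists (P`_N / Q`_N :: [seq r w | w <- ws]) => a; rewrite inE negb_or => /andP[aN aB].
have PN : P`_N != 0.
  have -> : P`_N = lead_coef P by rewrite lead_coefE sizeP.
  by rewrite lead_coef_eq0 -size_poly_eq0 sizeP.
apply: Omega_separable.
  apply/eqP; rewrite eqn_leq (size_level sizeP sizeQ) /= ltnNge; apply/negP => sl.
  have : (level r a)`_N = 0 by apply: nth_default.
  rewrite coefB coefZ => /eqP; rewrite subr_eq0 => /eqP PE.
  have QN : Q`_N != 0 by apply: contraNneq PN => QN; rewrite PE QN mulr0.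
  by move/eqP: aN; apply; rewrite PE mulfK.
move=> w rw; apply/negP => /eqP l'w; move/negP: aB; apply.
have /roots_ofE [regw rwa] := rw.
apply/mapP; exists w => //; rewrite -root_prod_XsubC.
have lw : lead_coef wronskian != 0 by rewrite lead_coef_eq0 wronskian_neq0.
rewrite -(rootZ _ _ lw) -Dw /root /wronskian hornerD hornerN !hornerM subr_eq0.
have Pw : P.[w] = a * Q.[w] by rewrite -rwa /rat_eval divfK.
have P'w : P^`().[w] = a * Q^`().[w].
  by apply/eqP; rewrite -subr_eq0 -hornerZ -hornerN -hornerD -derivZ -derivN -derivD; apply/eqP.
by rewrite Pw P'w mulrAC.
Qed.

(** The finitely many exceptional values have finitely many preimages, which can
    be avoided near any point. *)
Lemma regular_near_avoid z (d : R) (B : seq C) : 0 < d ->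
  exists x, [/\ cabs (x - z) < d, x \notin B & regular r x -> Omega N r (r x)].
Proof.
move=> d0; have [B' HB'] := Omega_cofinite.
have pre a : exists s : seq C, forall w, roots_of r a w -> w \in s.
  have [s Ds] := closed_field_poly_normal (level r a).
  have l0 : lead_coef (level r a) != 0 by rewrite lead_coef_eq0 (level_neq0 N0 sizeP).
  by exists s => w /roots_ofE; rewrite Ds rootZ // root_prod_XsubC.
have [s Hs] := boolp.choice pre.
have [x [xz xB]] := @near_avoid R z (B ++ flatten (map s B')) d d0.
exists x; move: xB; rewrite mem_cat negb_or => /andP[xB xs]; split=> // rx.
apply: HB'; apply: contra xs => rxB; apply/flattenP; exists (s (r x)).
  exact: map_f.
exact: Hs.
Qed.

Lemma horner_bound (p : {poly C}) (B : R) : 0 <= B ->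
  exists2 M, 0 < M & forall s, cabs s <= B -> cabs p.[s] <= M.
Proof.
move=> B0; elim/poly_ind: p => [|p c [M M0 HM]].
  by exists 1 => // s _; rewrite horner0 cabs0.
exists (M * B + cabs c + 1) => [|s sB].
  by rewrite ltr_wpDl // addr_ge0 ?cabs_ge0 // mulr_ge0 // ltW.
rewrite hornerMXaddC; apply: le_trans (cabsD _ _) _; rewrite -[leLHS]addr0.
apply: lerD => //; rewrite lerD2r cabsM; apply: ler_pM; rewrite ?cabs_ge0 //.
exact: HM.
Qed.

Lemma prod_XsubC_bound (ws : seq C) (z : C) (d : R) :
  (forall w, w \in ws -> cabs (w - z) != d) ->
  exists2 m, 0 < m & forall s, cabs (s - z) = d -> m <= cabs (\prod_(w <- ws) ('X - w%:P)).[s].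
Proof.
elim: ws => [_|w ws IH H].
  by exists 1 => // s _; rewrite big_nil hornerC cabs1.
have [|m m0 Hm] := IH; first by move=> x xw; apply: H; rewrite in_cons xw orbT.
have wd := H w (mem_head _ _); have g0 : 0 < `|d - cabs (w - z)|.
  by rewrite normr_gt0 subr_eq0 eq_sym.
exists (`|d - cabs (w - z)| * m); first exact: mulr_gt0.
move=> s sz; rewrite big_cons hornerM hornerXsubC cabsM.
apply: ler_pM; rewrite ?normr_ge0 ?(ltW m0) ?Hm //.
have := cabs_sub (s - z) (w - z); have := cabs_sub (w - z) (s - z).
have -> : s - z - (w - z) = s - w by rewrite opprB addrA subrK.
have -> : w - z - (s - z) = w - s by rewrite opprB addrA subrK.
rewrite sz [cabs (w - s)]cabsC ler_norml.
by move: (cabs (s - w)) (cabs (w - z)) => x y; lra.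
Qed.

(** On a circle where [r] omits the value [c], it stays away from [c]: the
    numerator of [r - c] is a product of distances to points off the circle. *)
Lemma circle_gap (z d c : C) : 0 < d ->
  (forall s, circle z d s -> regular r s /\ r s != c) ->
  exists2 m : R, 0 < m & forall s, circle z d s -> m <= cabs (r s - c).
Proof.
move=> d0 Hc; have dE := real_complexE0 (ltW d0); set dr := complex.Re d in dE.
have circE s : circle z d s <-> cabs (s - z) = dr.
  rewrite /circle /= cabsE dE; split=> [/(@complexI R)//|->//].
have [ws Dw] := closed_field_poly_normal (level r c).
have l0 : lead_coef (level r c) != 0 by rewrite lead_coef_eq0 (level_neq0 N0 sizeP).
have [|m m0 Hm] := @prod_XsubC_bound ws z dr.
  move=> w ww; apply/negP => /eqP/circE /Hc [_ /eqP]; apply.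
  have : roots_of r c w by apply/roots_ofE; rewrite Dw rootZ // root_prod_XsubC.
  by case.
have [|M M0 HM] := @horner_bound Q (cabs z + dr).
  by rewrite addr_ge0 ?cabs_ge0 // -(@lecR R) -dE ltW.
exists (cabs (lead_coef (level r c)) * m / M).
  by rewrite !(divr_gt0, mulr_gt0) // cabs_gt0.
move=> s cs; have [rs _] := Hc s cs; have /circE sz := cs.
have E : (level r c).[s] = lead_coef (level r c) * (\prod_(w <- ws) ('X - w%:P)).[s].
  by rewrite {1}Dw hornerZ.
have Qs : 0 < cabs Q.[s] by rewrite cabs_gt0.
have sM : cabs s <= cabs z + dr.
  by have := cabsD (s - z) z; rewrite subrK sz addrC.
rewrite ler_pdivrMr //; apply: (@le_trans _ _ (cabs (r s - c) * cabs Q.[s])).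
  by rewrite -cabsM -(level_horner c rs) E cabsM ler_wpM2l ?cabs_ge0 ?Hm.
by rewrite ler_wpM2l ?cabs_ge0 ?HM.
Qed.

Section Disks.
Variables (w0 : C) (L : nat) (zeta delta : 'I_L -> C).
Hypothesis adm : admissible_disks r w0 zeta delta.

Lemma circle_regular l s : circle (zeta l) (delta l) s -> regular r s.
Proof. by case: adm => _ _ + _ _ cs => /(_ l s); apply; rewrite /cdisk /= cs. Qed.

Lemma Aset_open c : Aset r zeta delta c -> exists d : R, 0 < d /\
  forall x, cabs (x - c) < d -> Aset r zeta delta x.
Proof.
move=> Ac; have gap l : exists m : R, 0 < m /\
    forall s, circle (zeta l) (delta l) s -> m <= cabs (r s - c).
  have dl : 0 < delta l by case: adm => _ [+ _] _ _ _; apply.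
  have [|m m0 Hm] := circle_gap dl (z := zeta l) (c := c); last by exists m.
  move=> s cs; split; first exact: circle_regular cs.
  by apply/negP => /eqP rsc; apply: Ac; exists l => //; exists s.
have [m Hm] := boolp.choice gap.
have [d d0 Hd] := finite_pos_bound (fun l => (Hm l).1).
exists d; split=> // x xc [l _ [s cs rsx]].
have := (Hm l).2 s cs; rewrite rsx => h.
by have := lt_le_trans xc (le_trans (Hd l) h); rewrite ltxx.
Qed.

(** A zero of [r] on one of the circles would be the centre of some disk, which
    cannot be the same disk and would meet the disk bounded by that circle. *)
Lemma Aset0 : Aset r zeta delta 0.
Proof.
case: adm => [[izeta rzeta] [dpos tI] creg _ _] [l _ [s cs rs0]].
have : roots_of r 0 s by split=> //; exact: circle_regular cs.
rewrite -rzeta => -[l' _ zl'].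
have dl := dpos l; have dl' := dpos l'.
have dE := real_complexE0 (ltW dl); have dE' := real_complexE0 (ltW dl').
set d := complex.Re (delta l) in dE; set d' := complex.Re (delta l') in dE'.
have d0 : 0 < d by rewrite -(@ltcR R) -dE.
have d0' : 0 < d' by rewrite -(@ltcR R) -dE'.
have csd : cabs (s - zeta l) = d.
  by apply: (@complexI R); rewrite -cabsE -dE; exact: cs.
(* A point of the radius towards s lies in both disks. *)
pose t := Num.min (d' / (2 * d)) (1 / 2).
have t0 : 0 < t by rewrite lt_min !divr_gt0 // mulr_gt0.
have t1 : t < 1 by rewrite gt_min; apply/orP; right; rewrite ltr_pdivrMr // mul1r ltr1n.
pose x := s - real_complex R t * (s - zeta l).
have xl : disk (zeta l) (delta l) x.
  rewrite /disk /= cabsE dE (@ltcR R).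
  have -> : x - zeta l = real_complex R (1 - t) * (s - zeta l).
    by rewrite /x rmorphB rmorph1; ring.
  rewrite cabsM cabs_real ?subr_ge0 ?(ltW t1) // csd gtr_pMl //.
  by rewrite ltrBlDr ltrDl.
have xl' : disk (zeta l') (delta l') x.
  rewrite /disk /= cabsE dE' (@ltcR R) zl' /x addrAC subrr add0r cabsN cabsM csd.
  rewrite cabs_real ?(ltW t0) // -ltr_pdivlMr //.
  apply: (@le_lt_trans _ _ (d' / (2 * d))); first by rewrite /t ge_min lexx.
  by rewrite ltr_pM2l // ltf_pV2 ?posrE ?mulr_gt0 // ltr_pMl // ltr1n.
have ll' : l = l' by apply: tI => //; exists x.
by move: csd; rewrite ll' zl' subrr cabs0 => E; move: d0; rewrite -E ltxx.
Qed.

End Disks.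
End RegularValues.

(** * Real rational functions and the matrix X *)

Section Reality.
Variable R : realType.
Local Notation C := (Cplx R).
Variables (N : nat) (r : ratfun C).
Hypothesis N0 : (0 < N)%N.
Hypothesis sizeP : size (rnum r) = N.+1.
Hypothesis sizeQ : (size (rden r) <= size (rnum r))%N.
Hypothesis rreal : real_ratfun r.
Local Notation P := (rnum r).
Local Notation Q := (rden r).

Lemma poly_fun_eq0 (p : {poly C}) : (forall z, p.[z] = 0) -> p = 0.
Proof.
move=> H; apply: (roots_geq_poly_eq0 (rs := [seq (i%:R : C) | i <- iota 0 (size p)])).
- by apply/allP => x _; rewrite /root H.
- by rewrite map_inj_uniq ?iota_uniq // => i j /eqP; rewrite eqr_nat => /eqP.
- by rewrite size_map size_iota.
Qed.

Let conjp (p : {poly C}) : {poly C} := map_poly (Num.conj : C -> C) p.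

Lemma horner_conjp (p : {poly C}) (z : C) : (conjp p).[z] = (p.[z^*])^*.
Proof. by rewrite -{1}[z]conjCK horner_map. Qed.

(** Comparing [r] with its conjugate shows that the denominator divides its
    conjugate, so the set of poles is symmetric. *)
Lemma regular_conj z : regular r z -> regular r z^*.
Proof.
have Q0 : Q != 0 := rden_neq0 r.
have cQ0 : conjp Q != 0 by rewrite map_poly_eq0.
have E : P * conjp Q = conjp P * Q.
  apply/eqP; rewrite -subr_eq0; apply/eqP; apply: (mulIf (mulf_neq0 Q0 cQ0)).
  rewrite mul0r; apply: poly_fun_eq0 => x.
  rewrite hornerM hornerD hornerN !hornerM !horner_conjp.
  have [Qx|Qx] := eqVneq Q.[x] 0; first by rewrite Qx !(mulr0, mul0r).
  have [Qx'|Qx'] := eqVneq Q.[x^*] 0; first by rewrite Qx' conjC0 !(mulr0, mul0r).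
  have := rreal Qx Qx'; rewrite /rat_eval rmorphM fmorphV /= => Ex.
  have cQx : (Q.[x^*])^* != 0 by rewrite conjC_eq0.
  have -> : P.[x] = (P.[x^*])^* / (Q.[x^*])^* * Q.[x] by rewrite -Ex divfK.
  by field.
have QQ : Q %| conjp Q.
  by rewrite -(@Gauss_dvdpr _ _ P) ?E ?dvdp_mull // coprimep_sym; exact: rnum_rden_coprime.
move=> rz; apply: contra rz => /eqP Qz.
have : (conjp Q).[z^*] = 0.
  by have /dvdpP [T ->] := QQ; rewrite hornerM Qz mulr0.
by rewrite horner_conjp conjCK => /eqP; rewrite conjC_eq0.
Qed.

Lemma rat_conj z : regular r z -> r z^* = (r z)^*.
Proof. by move=> rz; rewrite [r z](rreal rz (regular_conj rz)) conjCK. Qed.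

Lemma derive_conj w : regular r w -> derive1 r w^* = (derive1 r w)^*.
Proof.
move=> rw; have [T [E sT dE _]] := level_factor sizeP sizeQ rw.
pose g z := T.[z] / Q.[z]; rewrite dE -/(g w).
have [d [d0 Hd]] := regular_near rw.
apply: etrans (_ : (g w^*^*)^* = _); last by rewrite conjCK.
apply: (@derive1_quotient R r (fun z => (g z^*)^*) w^* d d0) => [z zw|].
  have zw' : cabs (z^* - w) < d by rewrite -cabsJ rmorphB /= conjCK.
  have rz := Hd _ zw'; have rz' : regular r z by rewrite -[z]conjCK; exact: regular_conj.
  have step : r z^* - r w = (z^* - w) * g z^*.
    have := level_horner (r w) rz; rewrite E hornerM hornerXsubC => H.
    by rewrite /g mulrA H mulfK.
  have rzE : r z = (r z^*)^* by rewrite -rat_conj // conjCK.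
  rewrite rzE (rat_conj rw); move: (r z^*) (r w) (g z^*) step => x y v step.
  by rewrite -rmorphB step rmorphM rmorphB /= conjCK.
apply/continuous_cabsP => eps eps0; rewrite conjCK.
have /continuous_cabsP/(_ eps eps0) [e [e0 He]] := @frac_continuous R T Q w rw.
exists e; split=> // z zw; rewrite -rmorphB cabsJ; apply: He.
by rewrite -cabsJ rmorphB /= conjCK.
Qed.

Lemma rts_conj a : Omega N r a ->
  Omega N r a^* /\ perm_eq (rts N r a^*) [seq w^* | w <- rts N r a].
Proof.
move=> Oa; have [ua sa Ha] := rtsP Oa.
have us : uniq [seq w^* | w <- rts N r a].
  by rewrite map_inj_uniq //; exact: can_inj (@conjCK C).
have Hs w : w \in [seq w^* | w <- rts N r a] <-> roots_of r a^* w.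
  split=> [/mapP [x /Ha [rx <-] ->]|[rw rwa]].
    by split; [exact: regular_conj | exact: rat_conj].
  apply/mapP; exists w^*; last by rewrite conjCK.
  by apply/Ha; split; [exact: regular_conj | rewrite rat_conj // rwa conjCK].
have Oa' : Omega N r a^* by apply: (Omega_list us) => //; rewrite size_map.
split=> //; have [ub _ Hb] := rtsP Oa'; apply: uniq_perm => // w.
by apply/idP/idP => [/Hb/Hs|/Hs/Hb].
Qed.

End Reality.

Section GramMatrix.
Variable R : realType.
Local Notation C := (Cplx R).
Variables (N p : nat) (r : ratfun C).
Hypothesis N0 : (0 < N)%N.
Hypothesis sizeP : size (rnum r) = N.+1.
Hypothesis sizeQ : (size (rden r) <= size (rnum r))%N.
Hypothesis rreal : real_ratfun r.
Variable e : 'I_N -> C -> C.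
Hypothesis eB : real_basis r e.
Variable J : 'M[C]_p.
Hypothesis sJ : signature_mx J.
Local Notation Q := (rden r).
Local Notation Z := (ZI p e).

Lemma ZIE z i k : Z z i k = e (mxtens_unindex k).1 z * (i == (mxtens_unindex k).2)%:R.
Proof.
rewrite /ZI castmxE /= !mxE; congr (e _ _ * _); first by rewrite cast_ord_id.
have -> : (mxtens_unindex (cast_ord (esym (mul1n p)) i)).2 = i.
  by apply: val_inj; rewrite /= modn_small.
by rewrite cast_ord_id.
Qed.

Lemma ZI_mul z (x : 'cV[C]_(N * p)) i :
  (Z z *m x) i 0 = \sum_n e n z * x (mxtens_index (n, i)) 0.
Proof.
rewrite mxE; transitivity (\sum_n \sum_j Z z i (mxtens_index (n, j)) * x (mxtens_index (n, j)) 0).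
  rewrite pair_bigA (reindex (@mxtens_index N p)) /=.
    by apply: eq_bigr => -[n j].
  by exists (@mxtens_unindex N p) => ? _; rewrite (mxtens_indexK, mxtens_unindexK).
apply: eq_bigr => n _; rewrite (bigD1 i) //= big1 ?addr0 => [|j ji].
  by rewrite ZIE mxtens_indexK eqxx mulr1.
by rewrite ZIE mxtens_indexK /= eq_sym (negbTE ji) mulr0 mul0r.
Qed.

Lemma basis_frac n : exists q : {poly C}, (size q <= N)%N /\
  forall z, regular r z -> e n z = q.[z] / Q.[z].
Proof. by case: eB => eL _ _ _; exact: (Lspace_frac sizeP sizeQ (eL n)). Qed.

Lemma basis_continuous n z : regular r z -> {for z, continuous (e n)}.
Proof.
move=> rz; have [q [_ qE]] := basis_frac n; have [d [d0 Hd]] := regular_near rz.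
apply: (continuous_local d0 (f := fun x => q.[x] / Q.[x])).
  by move=> x /Hd rx; rewrite qE.
exact: frac_continuous.
Qed.

Lemma ZI_mcont z : regular r z -> mcont (fun x => Z x) z.
Proof.
move=> rz i k.
have -> : (fun x => Z x i k) = (fun x => e (mxtens_unindex k).1 x * (i == (mxtens_unindex k).2)%:R).
  by apply/funext => x; rewrite ZIE.
by apply: continuousM; [exact: basis_continuous | exact: cst_continuous].
Qed.

(** Combinations of the basis are fractions with denominator [Q] and numerator
    of degree below [N], hence determined by their values at [N] points. *)
Lemma basis_sep a (c : 'I_N -> C) : Omega N r a ->
  (forall w, w \in rts N r a -> \sum_n c n * e n w = 0) -> forall n, c n = 0.
Proof.
move=> Oa cw; have [ua sa Ha] := rtsP Oa.
have [q Hq] := boolp.choice basis_frac.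
have cE z : regular r z -> \sum_n c n * e n z = (\sum_n c n *: q n).[z] / Q.[z].
  move=> rz; rewrite horner_sum mulr_suml; apply: eq_bigr => n _.
  by rewrite (Hq n).2 // hornerZ mulrA.
have q0 : \sum_n c n *: q n = 0.
  apply: (roots_geq_poly_eq0 (rs := rts N r a)) => //.
    apply/allP => w wr; have [rw _] := rts_regular Oa wr.
    have := cE w rw; rewrite cw // => /esym/eqP.
    by rewrite mulf_eq0 invr_eq0 (negbTE rw) orbF.
  rewrite sa; apply: leq_trans (size_sum _ _ _) _; apply/bigmax_leqP => n _.
  by apply: leq_trans (size_scale_leq _ _) _; case: (Hq n).
by case: eB => _ _ + _; apply => z rz; rewrite cE // q0 horner0 mul0r.
Qed.

Lemma ZI_sep a (x : 'cV[C]_(N * p)) : Omega N r a ->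
  (forall w, w \in rts N r a -> Z w *m x = 0) -> x = 0.
Proof.
move=> Oa xw; apply/colP => k; rewrite mxE -[k]mxtens_unindexK.
case: (mxtens_unindex k) => n i.
apply: (basis_sep (c := fun n => x (mxtens_index (n, i)) 0) Oa) => w /xw /colP/(_ i).
by rewrite ZI_mul mxE => E; rewrite -[RHS]E; apply: eq_bigr => m _; rewrite mulrC.
Qed.

(** This expansion of an element of the space of difference quotients over a
    fibre of [r] makes all sums over the roots of [r = a] computable. *)
Lemma ZI_partial_fraction a z : Omega N r a -> regular r z -> r z != a ->
  \sum_(w <- rts N r a) (derive1 r w * (z - w))^-1 *: Z w = (r z - a)^-1 *: Z z.
Proof.
move=> Oa rz rza; apply/matrixP => i k; rewrite summxE [RHS]mxE ZIE.
have [q [sq qE]] := basis_frac (mxtens_unindex k).1.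
rewrite mulrA [_ * e _ z]mulrC -(partial_fraction N0 sizeP sizeQ Oa sq qE rz rza).
move: (derive1 r) => dr; rewrite mulr_suml; apply: eq_bigr => w _.
by rewrite mxE ZIE mulrA [_ * e _ w]mulrC.
Qed.

Definition Xlist (a : C) : 'M[C]_(N * p) :=
  \sum_(w <- rts N r a) (derive1 r w)^-1 *: ((Z w)^T *m J *m Z w).

Lemma XmxE a : Omega N r a -> Xmx r J e a = Xlist a.
Proof. by move=> Oa; rewrite /Xmx (rts_sum _ Oa). Qed.

(** Expanding in both sums one of the two factors over the fibre of the other
    value turns them into the same double sum. *)
Lemma Xlist_indep a b : Omega N r a -> Omega N r b -> Xlist a = Xlist b.
Proof.
move=> Oa Ob; have [->//|ab] := eqVneq a b.
have PF c z : Omega N r c -> regular r z -> r z != c ->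
  Z z = (r z - c) *: \sum_(w <- rts N r c) (derive1 r w * (z - w))^-1 *: Z w.
  move=> Oc rz rzc; rewrite ZI_partial_fraction // scalerA mulfV ?scale1r //.
  by rewrite subr_eq0.
rewrite /Xlist; move: (derive1 r) PF => dr PF.
transitivity (\sum_(w <- rts N r a) \sum_(w' <- rts N r b)
    ((a - b) / (dr w * dr w' * (w - w'))) *: ((Z w')^T *m J *m Z w)).
  rewrite big_seq [RHS]big_seq; apply: eq_bigr => w wr.
  have [rw rwa] := rts_regular Oa wr.
  rewrite {1}(PF b w) // ?rwa //.
  rewrite linearZ /= -!scalemxAl scalerA raddf_sum /= !mulmx_suml scaler_sumr.
  apply: eq_bigr => w' _; rewrite linearZ /= -!scalemxAl scalerA; congr (_ *: _).
  rewrite !invfM; move: (dr w)^-1 (dr w')^-1 (w - w')^-1 (a - b) => A B t s.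
  by ring.
rewrite exchange_big /= big_seq [RHS]big_seq; apply: eq_bigr => w' wr'.
have [rw' rwb'] := rts_regular Ob wr'.
rewrite [in RHS]/= {3}(PF a w') // ?rwb' //; last by rewrite eq_sym.
rewrite -scalemxAr scalerA mulmx_sumr scaler_sumr; apply: eq_bigr => w _.
rewrite -scalemxAr scalerA; congr (_ *: _); rewrite -[w - w']opprB -[a - b]opprB !invfM invrN.
move: (dr w)^-1 (dr w')^-1 (w' - w)^-1 (b - a) => A B t s.
by ring.
Qed.

Let JU : J \in unitmx. Proof. by case: sJ. Qed.
Let Jadj : adjmx J = J. Proof. by case: sJ. Qed.

(** If [X x = 0], pairing with a vector [y] for which [Z_r y] lives at a single
    root shows that [x] vanishes at every root; the difference quotient of [r]
    at a root provides [y]. *)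
Lemma Xlist_unit a : Omega N r a -> Xlist a \in unitmx.
Proof.
move=> Oa; have [ua sa Ha] := rtsP Oa.
apply: unitmx_inj => x Xx; apply: (ZI_sep Oa) => v vr.
have [rv rva] := rts_regular Oa vr; have [dv0 _] := rts_derive N0 sizeP sizeQ Oa vr.
have Lv : Lspace r (diff_quot r v).
  exists 1%N, (fun=> v), (fun=> 1); split=> // z _.
  by rewrite big_ord_recl big_ord0 mul1r addr0.
have [c cE] : exists c : 'I_N -> C, forall z, regular r z ->
    diff_quot r v z = \sum_n c n * e n z by case: eB => _ + _ _; apply.
suff JZx : J *m (Z v *m x) = 0 by rewrite -[LHS](mulKmx JU) JZx mulmx0.
apply/colP => i; rewrite [RHS]mxE.
pose y : 'cV[C]_(N * p) := \col_k (((mxtens_unindex k).2 == i)%:R * c (mxtens_unindex k).1).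
have yE w : w \in rts N r a -> Z w *m y = (if w == v then derive1 r v else 0) *: delta_mx i 0.
  move=> wr; have [rw rwa] := rts_regular Oa wr; apply/colP => j; rewrite ZI_mul.
  transitivity ((j == i)%:R * diff_quot r v w).
    rewrite cE // mulr_sumr; apply: eq_bigr => n _.
    by rewrite mxE mxtens_indexK mulrC -mulrA.
  rewrite !mxE eqxx andbT /diff_quot; case: ifP => _; first by rewrite mulrC.
  by rewrite rwa rva subrr !mul0r mulr0.
have := congr1 (fun M => (y^T *m M) 0 0) Xx; rewrite mulmx0 [in RHS]mxE.
rewrite /Xlist mulmx_suml mulmx_sumr summxE (bigD1_seq v) //=.
rewrite [X in _ + X]big_seq_cond big1 ?addr0 => [|w /andP[wr wv]].
  rewrite -scalemxAl -scalemxAr -!mulmxA (mulmxA y^T) -(trmx_mul _ y) yE // eqxx linearZ /= -scalemxAl.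
  rewrite scalerA mulVf // scale1r trmx_delta => <-.
  rewrite [RHS]mxE (bigD1 i) //= big1 ?addr0 => [|j ji].
    by rewrite [X in X * _]mxE !eqxx mul1r.
  by rewrite [X in X * _]mxE (negbTE ji) andbF mul0r.
rewrite -scalemxAl -scalemxAr -!mulmxA (mulmxA y^T) -(trmx_mul _ y) yE // (negbTE wv).
by rewrite scale0r trmx0 mul0mx scaler0 mxE.
Qed.

Lemma adj_ZI z : regular r z -> adjmx (Z z) = (Z z^*)^T.
Proof.
move=> rz; have eJ n : (e n z)^* = e n z^*.
  by case: eB => _ _ _ eR; rewrite (eR _ _ rz (regular_conj rreal rz)) conjCK.
apply/matrixP => k i; rewrite [RHS]mxE [LHS]mxE [in LHS]mxE !ZIE -eJ.
by move: (e _ _) => x; rewrite rmorphM rmorph_nat.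
Qed.

(** Conjugation permutes the fibres of a real function, so the adjoint of the
    sum over the fibre of [a] is the sum over the fibre of [a^*]. *)
Lemma Xlist_adj a : Omega N r a -> adjmx (Xlist a) = Xlist a.
Proof.
move=> Oa; have [Oa' per] := rts_conj rreal Oa.
rewrite [RHS](Xlist_indep Oa Oa') /Xlist (perm_big _ per) /= big_map adjmx_sum.
rewrite big_seq [RHS]big_seq; apply: eq_bigr => w wr.
have [rw _] := rts_regular Oa wr; have rw' := regular_conj rreal rw.
rewrite adjmxZ !adjmxM Jadj adj_ZI // (derive_conj sizeP sizeQ rreal rw) fmorphV mulmxA.
by have := congr1 (@adjmx _ _ _) (adj_ZI rw'); rewrite adjmxK conjCK => ->.
Qed.

End GramMatrix.

(** * The space as a space of functions on the value side of [r] *)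

Lemma punctured_avoid (R : realType) (B : seq (Cplx R)) (s : Cplx R) :
  exists d : R, 0 < d /\ forall z, cabs (z - s) < d -> z != s -> z \notin B.
Proof.
elim: B => [|b B [d [d0 Hd]]]; first by exists 1.
have [->|bs] := eqVneq b s.
  by exists d; split=> // z zs z0; rewrite inE negb_or z0 Hd.
exists (Num.min d (cabs (b - s))); split.
  by rewrite lt_min d0 cabs_gt0 subr_eq0.
move=> z; rewrite lt_min => /andP[zd zb] z0; rewrite inE negb_or Hd // andbT.
by apply: contraTneq zb => ->; rewrite ltxx.
Qed.

Section SpaceModel.
Variable R : realType.
Local Notation C := (Cplx R).
Variables (N p : nat) (r : ratfun C).
Hypothesis N0 : (0 < N)%N.
Hypothesis sizeP : size (rnum r) = N.+1.
Hypothesis sizeQ : (size (rden r) <= size (rnum r))%N.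
Hypothesis rreal : real_ratfun r.
Variable e : 'I_N -> C -> C.
Hypothesis eB : real_basis r e.
Variable J : 'M[C]_p.
Hypothesis sJ : signature_mx J.
Variable gamma : C.
Hypothesis Og : Omega N r gamma.
Variables (w0 : C) (L : nat) (zeta delta : 'I_L -> C).
Hypothesis adm : admissible_disks r w0 zeta delta.
Local Notation A := (Aset r zeta delta).
Local Notation D := (rat_preimage r A).
Local Notation S := (Omega N r `&` A).
Local Notation Z := (ZI p e).
Local Notation X := (Xlist r e J gamma).
Local Notation rts := (rts N r).
Hypothesis w01 : `|w0| = 1.
Hypothesis Aw0 : A w0.

(** Weights recovering [F s] from the values of [Z_r F(r)] at the roots of
    [r = s]. *)
Definition weight (u : C) : 'M[C]_(N * p, p) :=
  invmx X *m ((derive1 r u)^-1 *: ((Z u)^T *m J)).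

Definition value_at n (s : C) (f : C -> 'M[C]_(p, n)) : 'M[C]_(N * p, n) :=
  \sum_(u <- rts s) weight u *m f u.

Lemma XU : X \in unitmx. Proof. exact: (Xlist_unit N0 sizeP sizeQ eB sJ Og). Qed.

Lemma weight_sum s : Omega N r s -> \sum_(u <- rts s) weight u *m Z u = 1%:M.
Proof.
move=> Os; under eq_bigr => u _ do rewrite /weight -mulmxA -scalemxAl.
rewrite -mulmx_sumr -/(Xlist r e J s).
by rewrite (Xlist_indep N0 sizeP sizeQ eB J Os Og) mulVmx // XU.
Qed.

Lemma value_at_linear n s : linear (@value_at n s).
Proof.
move=> a f g; rewrite /value_at scaler_sumr -big_split; apply: eq_bigr => u _ /=.
by rewrite mulmxDr -scalemxAr.
Qed.

Lemma value_atE n s (f : C -> 'M[C]_(p, n)) x : Omega N r s ->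
  (forall u, u \in rts s -> f u = Z u *m x) -> value_at s f = x.
Proof.
move=> Os fE; rewrite -[RHS]mul1mx -(weight_sum Os) mulmx_suml /value_at.
by rewrite big_seq [RHS]big_seq; apply: eq_bigr => u ur; rewrite fE // mulmxA.
Qed.

Lemma rts_D s u : S s -> u \in rts s -> D u /\ r u = s.
Proof. by move=> [Os As] ur; have [ru rus] := rts_regular Os ur; split=> //; split=> //; rewrite rus. Qed.

Lemma S_open s : S s -> exists d : R, 0 < d /\ forall z, cabs (z - s) < d -> S z.
Proof.
move=> [Os As]; have [B HB] := Omega_cofinite N0 sizeP sizeQ.
have [d [d0 Hd]] := punctured_avoid B s; have [d' [d'0 Hd']] := Aset_open N0 sizeP adm As.
exists (Num.min d d'); split; first by rewrite lt_min d0.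
move=> z; rewrite lt_min => /andP[zd zd']; split; last exact: Hd'.
by have [->//|zs] := eqVneq z s; apply: HB; apply: Hd.
Qed.

Lemma D_open z : D z -> exists d : R, 0 < d /\ forall x, cabs (x - z) < d -> D x.
Proof.
move=> [rz Az]; have [d [d0 Hd]] := regular_near rz.
have [d' [d'0 Hd']] := Aset_open N0 sizeP adm Az.
have /continuous_cabsP/(_ d' d'0) [d'' [d''0 Hd'']] := rat_continuous rz.
exists (Num.min d d''); split; first by rewrite lt_min d0.
by move=> x; rewrite lt_min => /andP[/Hd rx /Hd'' /Hd' Ax].
Qed.

Lemma D_near z (d : R) : D z -> 0 < d -> exists x, [/\ cabs (x - z) < d, D x & S (r x)].
Proof.
move=> Dz d0; have [d' [d'0 Hd']] := D_open Dz.
have [|x [xz _ Ox]] := regular_near_avoid N0 sizeP sizeQ z (d := Num.min d d') [::].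
  by rewrite lt_min d0.
move: xz; rewrite lt_min => /andP[xd /Hd' Dx]; exists x; split=> //.
by case: Dx => rx Ax; split=> //; exact: Ox.
Qed.

(** Identities between continuous functions need to be checked only at the
    points where [r] takes a value in [Omega]. *)
Lemma D_ext m n (F : C -> 'M[C]_(m, n)) z : D z -> mcont F z ->
  (forall x, D x -> S (r x) -> F x = 0) -> F z = 0.
Proof.
move=> Dz Fc F0; apply: (mcont_zero Fc) => d d0.
by have [x [xz Dx Sx]] := D_near Dz d0; exists x; split=> //; exact: F0.
Qed.

Let cw0 : cabs w0 = 1. Proof. by rewrite /cabs w01. Qed.

(** Near [w0], the points [w0 x] and [w0 / x] with [x] real and close to [1] are
    symmetric with respect to the unit circle. *)
Lemma S_symmetric_pairs (B : seq C) : exists a b,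
  [/\ S a, S b, a * b^* = 1, a != b & a \notin B /\ b \notin B].
Proof.
have [B' HB'] := Omega_cofinite N0 sizeP sizeQ.
have [d [d0 Hd]] := Aset_open N0 sizeP adm Aw0.
have [K HK] := inv_nat_small d0.
pose x k : C := k.+1%:R / k.+2%:R.
have w00 : w0 != 0 by rewrite -cabs_eq0 cw0 oner_eq0.
have xE k : x k = 1 - k.+2%:R^-1.
  have k2 : (k.+2%:R : C) != 0 by rewrite pnatr_eq0.
  apply: (mulIf k2); rewrite mulrBl mul1r mulVf // divfK //.
  by rewrite -[k.+2%:R]natr1 addrK.
have iu : injective (fun k => w0 * x k).
  move=> k l /(mulfI w00); rewrite !xE => /addrI/oppr_inj/invr_inj/eqP.
  by rewrite eqr_nat => /eqP [].
have [k Kk] := injective_avoid (B ++ B' ++ [seq (b^*)^-1 | b <- B ++ B']) K iu.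
rewrite !mem_cat !negb_or => /and3P[aB aB' ab].
set a := w0 * x k in aB aB' ab.
have k1 : (k.+1%:R : C) != 0 by rewrite pnatr_eq0.
have k2 : (k.+2%:R : C) != 0 by rewrite pnatr_eq0.
have x0 : x k != 0 by rewrite mulf_neq0 ?invr_eq0.
have a0 : a != 0 by rewrite mulf_neq0.
have bE : (a^*)^-1 = w0 / x k.
  have w0J : w0 * w0^* = 1 by rewrite -normCK w01 expr1n.
  apply: (mulIf (_ : a^* != 0)); first by rewrite conjC_eq0.
  rewrite mulVf ?conjC_eq0 // /a rmorphM /= rmorphM fmorphV /= !conjC_nat -/(x k).
  by rewrite mulrACA -/(x k) w0J mulVf // mulr1.
have bB : (a^*)^-1 \notin B ++ B'.
  apply: contra ab => bB; apply/mapP; exists (a^*)^-1 => //.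
  by rewrite fmorphV /= conjCK invrK.
move: bB; rewrite mem_cat negb_or => /andP[bB bB'].
have kd : k.+1%:R^-1 < d by exact: HK.
exists a, (a^*)^-1; split=> //.
- split; first exact: HB'.
  apply: Hd; apply: le_lt_trans kd; rewrite /a -{2}[w0]mulr1 -mulrBr cabsM cw0 mul1r.
  by rewrite xE addrAC subrr sub0r cabsN cabsV cabs_nat lef_pV2 ?posrE ?ltr0n // ler_nat.
- split; first exact: HB'.
  apply: Hd; apply: le_lt_trans kd; rewrite bE -{2}[w0]mulr1 -mulrBr cabsM cw0 mul1r.
  have -> : (x k)^-1 - 1 = k.+1%:R^-1.
    rewrite /x invf_div; apply: (mulIf k1); rewrite mulrBl mul1r mulVf // divfK //.
    by rewrite -[k.+2%:R]natr1 addrAC subrr add0r.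
  by rewrite cabsV cabs_nat.
- by rewrite fmorphV /= conjCK mulfV.
- apply/eqP => E; have : cabs a < 1.
    rewrite cabsM cw0 mul1r cabsM cabsV !cabs_nat ltr_pdivrMr ?ltr0n // mul1r.
    by rewrite ltr_nat.
  have : cabs a * cabs a = 1.
    by rewrite {1}E cabsV cabsJ mulVf // cabs_eq0.
  by have := cabs_ge0 a; move: (cabs a) => t; nra.
Qed.

(** Points of the circle close to [w0] come from the Cayley transform of large
    real numbers; at most two of them are real. *)
Lemma S_circle_nonreal : exists a, [/\ S a, cabs a = 1 & a != a^*].
Proof.
have [B HB] := Omega_cofinite N0 sizeP sizeQ.
have [d [d0 Hd]] := Aset_open N0 sizeP adm Aw0.
have [K HK] := inv_nat_small (divr_gt0 d0 (ltr0n R 2)).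
have w00 : w0 != 0 by rewrite -cabs_eq0 cw0 oner_eq0.
pose y k : C := k.+1%:R - 'i.
have yJ k : (y k)^* = k.+1%:R + 'i by rewrite rmorphB /= conjC_nat conjCi opprK.
have ky k : k.+1%:R <= cabs (y k).
  have : cabs (y k + (y k)^* ) = 2%:R * k.+1%:R.
    have -> : y k + (y k)^* = 2%:R * k.+1%:R.
      by rewrite yJ /y; move: k.+1%:R ('i : C) => s t; ring.
    by rewrite cabsM !cabs_nat.
  have := cabsD (y k) (y k)^*; rewrite cabsJ; move: (cabs (y k)) => t + H; rewrite {}H.
  by move: k.+1%:R => m; lra.
have y0 k : y k != 0.
  by rewrite -cabs_gt0; apply: lt_le_trans (ky k); rewrite ltr0n.
have yE k : (y k)^* / y k = 1 + 2%:R * 'i / y k.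
  have -> : (y k)^* = y k + 2%:R * 'i.
    by rewrite yJ /y; move: k.+1%:R ('i : C) => s t; ring.
  by rewrite mulrDl divff.
have i2 : 2%:R * 'i != 0 :> C by rewrite mulf_neq0 ?pnatr_eq0 // neq0Ci.
have iu : injective (fun k => w0 * ((y k)^* / y k)).
  move=> k l /(mulfI w00); rewrite !yE => /addrI/(mulfI i2)/invr_inj/addIr/eqP.
  by rewrite eqr_nat => /eqP [].
have [k Kk] := injective_avoid (1 :: -1 :: B) K iu.
rewrite !inE !negb_or => /and3P[a1 am1 aB].
set a := w0 * ((y k)^* / y k) in a1 am1 aB.
have ca : cabs a = 1 by rewrite !cabsM cw0 cabsV cabsJ mul1r mulfV // cabs_eq0.
exists a; split=> //.
  split; first exact: HB.
  apply: Hd; rewrite /a -{2}[w0]mulr1 -mulrBr cabsM cw0 mul1r.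
  rewrite yE addrAC subrr add0r cabsM cabsM cabsV cabs_nat [cabs 'i](_ : _ = 1) ?mulr1; last by rewrite /cabs normCi.
  have := HK k Kk; have := ky k; move: (cabs (y k)) => t kt kd.
  have k0 : 0 < k.+1%:R :> R by rewrite ltr0n.
  have t0 : 0 < t by apply: lt_le_trans kt.
  apply: le_lt_trans (_ : 2%:R / k.+1%:R < _); first by rewrite ler_pM2l ?ltr0n // lef_pV2.
  by move: kd; rewrite ltr_pdivlMr ?ltr0n // mulrC.
apply/eqP => E; have : a * a = 1 by rewrite {2}E -normCK cabsE ca expr1n.
move/eqP; rewrite -expr2 -[1](expr1n _ 2) eqf_sqr.
by rewrite (negbTE a1) (negbTE am1).
Qed.

End SpaceModel.

(** * Correspondence between the operators and the abstract model *)

Lemma analytic_local (R : realType) (f g : Cplx R -> Cplx R) (c : Cplx R) (d : R) :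
  0 < d -> (forall z, cabs (z - c) < d -> f z = g z) ->
  analytic_at f c -> analytic_at g c.
Proof.
move=> d0 fg [a [rho [rho0 Ha]]].
have rE := real_complexE0 (ltW rho0); set q := complex.Re rho in rE.
have q0 : 0 < q by rewrite -(@ltcR R) -rE.
exists a, (real_complex R (Num.min q d)); split; first by rewrite (@ltcR R 0) lt_min q0.
move=> z; rewrite cabsE (@ltcR R) lt_min => /andP[zq zd]; rewrite -fg //.
by apply: Ha; rewrite cabsE rE (@ltcR R).
Qed.

Lemma analytic_affine_mul (C : numClosedFieldType) (f : C -> C) (c b k m : C) :
  analytic_at f c -> analytic_at (fun z => k + m * (z - b) * f z) c.
Proof.
move=> [a [rho [rho0 Ha]]]; pose l := m * (c - b).
pose a' j := if j is j'.+1 then l * a j + m * a j' else k + l * a 0%N.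
exists a', rho; split=> // z zr; rewrite -cvg_shiftS /=.
have -> : (fun j => series (fun j => a' j * (z - c) ^+ j) j.+1) =
    (fun j => k + (l * series (fun j => a j * (z - c) ^+ j) j.+1 +
              m * (z - c) * series (fun j => a j * (z - c) ^+ j) j)).
  apply/funext => j; rewrite /series /= !big_nat_recl // !expr0 !mulr1.
  rewrite mulrDr -[k + l * _ + _]addrA; congr (_ + _); rewrite -addrA; congr (_ + _).
  rewrite !mulr_sumr -big_split; apply: eq_bigr => i _ /=.
  by rewrite mulrDl -mulrA; congr (_ + _); rewrite exprS mulrACA.
have -> : m * (z - b) * f z = l * f z + m * (z - c) * f z.
  by rewrite /l -mulrDl -mulrDr; congr (_ * _ * _); rewrite [RHS]addrC addrA subrK.
apply: cvgD; first exact: cvg_cst.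
apply: cvgD; apply: cvgM; [exact: cvg_cst | | exact: cvg_cst | exact: Ha].
by rewrite (cvg_shiftS (series _)); exact: Ha.
Qed.

Section Correspondence.
Variable R : realType.
Local Notation C := (Cplx R).
Variables (N p : nat) (r : ratfun C).
Hypothesis N0 : (0 < N)%N.
Hypothesis sizeP : size (rnum r) = N.+1.
Hypothesis sizeQ : (size (rden r) <= size (rnum r))%N.
Hypothesis rreal : real_ratfun r.
Variable e : 'I_N -> C -> C.
Hypothesis eB : real_basis r e.
Variable J : 'M[C]_p.
Hypothesis sJ : signature_mx J.
Variable gamma : C.
Hypothesis Og : Omega N r gamma.
Variables (w0 : C) (L : nat) (zeta delta : 'I_L -> C).
Hypothesis adm : admissible_disks r w0 zeta delta.
Local Notation A := (Aset r zeta delta).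
Local Notation D := (rat_preimage r A).
Local Notation S := (Omega N r `&` A).
Local Notation Z := (ZI p e).
Local Notation X := (Xlist r e J gamma).
Local Notation rts := (rts N r).
Local Notation wt := (weight r e J gamma).
Local Notation val := (value_at r e J gamma).
Hypothesis w01 : `|w0| = 1.
Hypothesis Aw0 : A w0.
Variable V : set (C -> 'cV[C]_p).
Variable ip : (C -> 'cV[C]_p) -> (C -> 'cV[C]_p) -> C.
Variable K : C -> C -> 'M[C]_p.
Hypothesis Vout : forall f z, V f -> ~ D z -> f z = 0.
Hypothesis pont : pontryagin V ip.
Hypothesis rep : reproducing_kernel D V ip K.
Hypothesis Vana : forall f, V f -> analytic_on D f.
Hypothesis Vform : forall f, V f -> exists F : C -> 'cV[C]_(N * p),
  analytic_on A F /\ forall z, D z -> f z = Z z *m F (r z).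
Hypothesis hV : lin_subspace V.

Local Notation U := (subspace_of hV).
Local Notation fn f := (sval_of f : C -> 'cV[C]_p).
Local Notation sip := (@sub_ip C _ V hV ip).

Let ipH : herm_form sip. Proof. exact: sub_ip_herm. Qed.

Definition kvec (u : C) (c : 'cV[C]_p) : U :=
  if pselect (D u) is left Du then to_subspace hV (proj1 (rep c Du)) else 0.

Lemma kvecE u c z : D u -> D z -> fn (kvec u c) z = K z u *m c.
Proof.
move=> Du Dz; rewrite /kvec; case: pselect => // Du' /=.
by rewrite /restr mem_set.
Qed.

Lemma kvec_rep f u c : D u -> sip f (kvec u c) = dot c (fn f u).
Proof.
move=> Du; rewrite /kvec; case: pselect => // Du'.
exact: (proj2 (rep c Du')) (subspaceP f).
Qed.

Definition ev (s : C) (f : U) : 'cV[C]_(N * p) := val s (fn f).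

Definition kk (s : C) (c : 'cV[C]_(N * p)) : U :=
  \sum_(u <- rts s) kvec u (adjmx (wt u) *m c).

Lemma ev_form s (f : U) F : S s ->
  (forall z, D z -> fn f z = Z z *m F (r z)) -> ev s f = F s.
Proof.
move=> Ss fE; apply: (value_atE N0 sizeP sizeQ eB sJ Og) => [|u ur].
  by case: Ss.
by have [Du ru] := rts_D Ss ur; rewrite fE // ru.
Qed.

Lemma f_ev (f : U) z : D z -> S (r z) -> fn f z = Z z *m ev (r z) f.
Proof.
move=> Dz Sz; have [F [_ FE]] := Vform (subspaceP f).
by rewrite (ev_form Sz FE) FE.
Qed.

Lemma f_mcont (f : U) z : D z -> mcont (fn f) z.
Proof. by move=> Dz i j; apply: analytic_continuous; exact: Vana (subspaceP f) _ Dz i j. Qed.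

(** The vector [F s] depends linearly on the values of [f] at the roots of
    [r = s], so the functionals [f |-> F s] are represented by combinations of
    the kernel functions at these roots. *)
Lemma space_model : rk_model sip S ev kk.
Proof.
split.
- exact: ipH.
- exact: sub_pontryagin.
- by move=> s a f g; exact: value_at_linear.
- move=> s f c Ss; rewrite (ip_sumr ipH) big_seq /ev /value_at.
  rewrite [X in dot _ X]big_seq.
  rewrite (_ : dot c _ = \sum_(u <- rts s | u \in rts s) dot c (wt u *m fn f u)).
    apply: eq_bigr => u ur; have [Du _] := rts_D Ss ur.
    by rewrite kvec_rep // -dot_mulmx.
  by elim/big_rec2: _ => [|u x y _ <-]; rewrite ?dot0r ?dotDr.
- move=> f s i Ss; have [F [Fa FE]] := Vform (subspaceP f).
  have [d [d0 Hd]] := S_open N0 sizeP sizeQ adm Ss.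
  apply: (analytic_local (f := fun z => F z i 0) d0); last by apply: Fa; case: Ss.
  by move=> z /Hd Sz; rewrite (ev_form Sz FE).
- by move=> s; exact: (S_open N0 sizeP sizeQ adm).
- move=> f f0; apply: subspace_val_inj; apply/funext => z; change (fn f z = 0).
  have [Dz|nDz] := pselect (D z); last exact: Vout (subspaceP f) nDz.
  apply: (D_ext N0 sizeP sizeQ adm Dz (f_mcont (f := f) Dz)) => x Dx Sx.
  by rewrite f_ev // f0 // mulmx0.
- exact: (S_symmetric_pairs N0 sizeP sizeQ adm w01 Aw0).
Qed.


(** At the points with [r z = s] in [Omega] both sides are [Z_r z] applied to
    [(s - a) H s = F s - F a]; the other points follow by continuity. *)
Lemma isR_pointwise a (f h : U) z : S a -> isR S ev a f h -> D z ->
  (r z - a) *: fn h z = fn f z - Z z *m ev a f.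
Proof.
move=> Sa H Dz; apply/eqP; rewrite -subr_eq0; apply/eqP.
pose F x := (r x - a) *: fn h x - (fn f x - Z x *m ev a f).
have Fc : mcont F z.
  have rz : regular r z by case: Dz.
  apply: mcontB; first apply: mcontZ.
  - by apply: continuousB; [exact: rat_continuous | exact: cst_continuous].
  - exact: f_mcont.
  apply: mcontB; first exact: f_mcont.
  by apply: mcontM; [exact: (ZI_mcont sizeP sizeQ eB) | exact: mcont_const].
apply: (D_ext N0 sizeP sizeQ adm Dz Fc) => x Dx Sx; rewrite /F.
by rewrite (f_ev h Dx Sx) (f_ev f Dx Sx) scalemxAr H // mulmxBr subrr.
Qed.

Lemma Rformula_form a (f : U) z : S a -> regular r z -> r z != a ->
  \col_i Rformula r a (fun x => fn f x i 0) z
  = (r z - a)^-1 *: (fn f z - Z z *m ev a f).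
Proof.
move=> Sa rz rza; have Oa : Omega N r a by case: Sa.
rewrite scalerBr scalemxAl -(ZI_partial_fraction p N0 sizeP sizeQ eB Oa rz rza).
apply/colP => i; rewrite mxE /Rformula (rts_sum _ Oa); move: (derive1 r) => dr.
rewrite mulmx_suml mxE [in RHS]mxE mulrC; congr (_ + _); rewrite [RHS]mxE; congr (- _).
rewrite summxE big_seq [RHS]big_seq; apply: eq_bigr => w wr.
have [Dw rw] := rts_D Sa wr; rewrite f_ev // ?rw //.
by rewrite -scalemxAl [RHS]mxE mulrC.
Qed.

(** At the roots of [r = a], both functions are limits of their common values at
    neighbouring points. *)
Lemma isR_Rop a (f h : U) : S a -> isR S ev a f h -> fn h = Rop D r a (fn f).
Proof.
move=> Sa H; have [Oa Aa] := Sa; apply/funext => z.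
have [Dz|nDz] := pselect (D z); last first.
  by rewrite /Rop /restr memNset //; exact: Vout (subspaceP h) nDz.
have off x : D x -> r x != a ->
    \col_i Rformula r a (fun y => fn f y i 0) x = fn h x.
  move=> Dx rxa; have [rx _] := Dx; rewrite Rformula_form //.
  by rewrite -(isR_pointwise Sa H Dx) scalerA mulVf ?scale1r // subr_eq0.
rewrite /Rop /restr mem_set //; apply/colP => i; rewrite mxE; cbv zeta.
case: eqP => [rza|/eqP rza]; last by rewrite -(off z Dz rza) mxE.
have [d1 [d10 Hd1]] := D_open N0 sizeP adm Dz.
have [d2 [d20 Hd2]] := punctured_avoid (rts a) z.
have m0 : 0 < Num.min d1 d2 by rewrite lt_min d10.
have hc : {for z, continuous (fun y : C => fn h y i 0)} by exact: f_mcont.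
apply/esym/(lim_punctured m0 _ hc) => x.
rewrite lt_min => /andP[/Hd1 Dx x2] xz; have rxa : r x != a.
  apply: contra (Hd2 x x2 xz) => /eqP rx; have [_ _ Ha] := rtsP Oa.
  by apply/Ha; split=> //; case: Dx.
by have := off x Dx rxa; move/colP/(_ i); rewrite mxE.
Qed.

Lemma Rop_isR a (f h : U) : S a -> fn h = Rop D r a (fn f) -> isR S ev a f h.
Proof.
move=> Sa hE s Ss; have [->|sa] := eqVneq s a; first by rewrite !subrr scale0r.
suff -> : ev s h = (s - a)^-1 *: (ev s f - ev a f).
  by rewrite scalerA mulfV ?scale1r // subr_eq0.
apply: (value_atE N0 sizeP sizeQ eB sJ Og) => [|u ur]; first by case: Ss.
have [Du ru] := rts_D Ss ur; have rua : r u != a by rewrite ru.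
have [regu _] := Du.
rewrite hE /Rop /restr mem_set // (negbTE rua) -/(Rformula _ _ _ _).
rewrite (_ : \col_i _ = \col_i Rformula r a (fun y => fn f y i 0) u) //.
rewrite Rformula_form // ru -scalemxAr mulmxBr; congr (_ *: (_ - _)).
by rewrite f_ev // ru.
Qed.

(** Summing over the roots [u] first, partial fractions produce [Z_r] at [v^*]
    applied to [F a]; what remains is the sum over the conjugates of the roots
    [v], which defines [X] at [b^*]. *)
Lemma double_sum a b (f g : U) : S a -> S b -> a != b^* ->
  (a - b^*) * \sum_(u \in roots_of r a) \sum_(v \in roots_of r b)
     (((derive1 r v)^*)^-1 *: adjmx (fn g v) *m J
        *m ((derive1 r u)^-1 *: fn f u)) 0 0 / (u - v^*)
  = dot (ev b g) (X *m ev a f).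
Proof.
move=> Sa Sb ab; have [Oa _] := Sa; have [Ob _] := Sb.
have [Ob' per] := rts_conj rreal Ob.
have dJ v : v \in rts b -> derive1 r v^* = (derive1 r v)^*.
  by move=> vr; have [rv _] := rts_regular Ob vr; exact: (derive_conj sizeP sizeQ rreal rv).
rewrite (rts_sum _ Oa); under eq_bigr => u _ do rewrite (rts_sum _ Ob).
rewrite (Xlist_indep N0 sizeP sizeQ eB J Og Ob') /Xlist (perm_big _ per) /= big_map.
have PF z := ZI_partial_fraction p N0 sizeP sizeQ eB (z := z) Oa.
move: (derive1 r) dJ PF => dr dJ PF.
rewrite exchange_big mulr_sumr mulmx_suml /= big_seq.
rewrite [X in dot _ X]big_seq.
rewrite (_ : dot _ _ = \sum_(v <- rts b | v \in rts b)
    dot (ev b g) ((dr v^*)^-1 *: ((Z v^*)^T *m J *m Z v^*) *m ev a f)); last first.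
  by elim/big_rec2: _ => [|u x y _ <-]; rewrite ?dot0r ?dotDr.
apply: eq_bigr => v vr; have [rv rvb] := rts_regular Ob vr.
have rv' := regular_conj rreal rv.
have rvE : r v^* = b^* by rewrite (rat_conj rreal rv) rvb.
have [Dv _] := rts_D Sb vr.
have vE : fn g v = Z v *m ev b g by rewrite f_ev // rvb.
have zx : Z v^* *m ev a f = (a - b^*) *: \sum_(u <- rts a) ((dr u)^-1 / (u - v^*)) *: fn f u.
  have := PF v^* rv'; rewrite rvE eq_sym => /(_ ab) PFv.
  transitivity ((b^* - a) *: ((\sum_(u <- rts a) (dr u * (v^* - u))^-1 *: Z u) *m ev a f)).
    by rewrite PFv -scalemxAl scalerA mulfV ?scale1r // subr_eq0 eq_sym.
  rewrite -[b^* - a]opprB scaleNr -scalerN mulmx_suml -sumrN; congr (_ *: _).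
  rewrite big_seq [RHS]big_seq; apply: eq_bigr => u ur; have [Du ru] := rts_D Sa ur.
  by rewrite f_ev // ?ru // -scalemxAl -scaleNr -[v^* - u]opprB mulrN invrN opprK invfM.
rewrite -[in RHS]scalemxAl -![in RHS]mulmxA dotZr zx.
have -> x : dot (ev b g) ((Z v^*)^T *m (J *m x)) = (adjmx (fn g v) *m J *m x) 0 0.
  by rewrite vE adjmxM (adj_ZI p rreal eB rv) /dot !mulmxA.
rewrite -scalemxAr [in RHS]mxE dJ // mulrCA; congr (_ * _).
rewrite mulmx_sumr summxE mulr_sumr; apply: eq_bigr => u _.
rewrite -!scalemxAl -!scalemxAr.
move: (adjmx (fn g v) *m J *m fn f u) => M; rewrite mxE [in LHS]mxE mxE.
by move: (M 0 0) (dr u)^-1 (u - v^*)^-1 (dr v)^*^-1 => m s t q; ring.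
Qed.

Let mod := space_model.
Let adjX : adjmx X = X. Proof. exact: (Xlist_adj N0 sizeP sizeQ rreal eB sJ Og). Qed.
Let uX : X \in unitmx. Proof. exact: (XU N0 sizeP sizeQ eB sJ Og). Qed.

Lemma kvec_kk w c : D w -> S (r w) -> kvec w c = kk (r w) (adjmx (Z w) *m c).
Proof.
move=> Dw Sw; apply: (ip_inj mod) => f.
by rewrite kvec_rep // (rk_rep mod) // -dot_mulmx -f_ev.
Qed.

Lemma kernel_kap z w : D z -> D w -> S (r z) -> S (r w) ->
  K z w = Z z *m kap ev kk (r z) (r w) *m adjmx (Z w).
Proof.
move=> Dz Dw Sz Sw; apply: mulmx_delta_inj => c.
by rewrite -kvecE // kvec_kk // f_ev // (ev_kk mod) // !mulmxA.
Qed.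

Lemma kap_kernel s t G : S s -> S t ->
  (forall u v, u \in rts s -> v \in rts t -> K u v = Z u *m G *m adjmx (Z v)) ->
  kap ev kk s t = G.
Proof.
move=> Ss St KE; apply: mulmx_delta_inj => c; rewrite -(ev_kk mod) //.
have Ot : Omega N r t by case: St.
apply: (value_atE N0 sizeP sizeQ eB sJ Og) => [|u ur]; first by case: Ss.
have [Du _] := rts_D Ss ur.
have -> : fn (kk t c) u = \sum_(v <- rts t) fn (kvec v (adjmx (wt v) *m c)) u.
  by rewrite /kk; elim/big_rec2: _ => [//|v x y _ <-].
rewrite -[c in RHS]mul1mx -(adjmxK 1%:M).
have -> : adjmx 1%:M = \sum_(v <- rts t) wt v *m Z v.
  rewrite (weight_sum N0 sizeP sizeQ eB sJ Og Ot).
  by apply/matrixP => i j; rewrite !mxE conjC_nat eq_sym.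
rewrite adjmx_sum mulmx_suml !mulmx_sumr big_seq [RHS]big_seq.
apply: eq_bigr => v vr; have [Dv _] := rts_D St vr.
by rewrite kvecE // KE // adjmxM !mulmxA.
Qed.

Lemma kernel_sym z w : D z -> D w -> K w z = adjmx (K z w).
Proof.
move=> Dz Dw; apply: mulmx_delta_inj => c; apply/eqP; rewrite -subr_eq0; apply/eqP.
apply: dot_eq0 => d; rewrite dotBr -kvecE // -kvec_rep // (ipC ipH) kvec_rep // kvecE //.
by rewrite -dotC -dot_mulmxl subrr.
Qed.

Definition operator_identities : Prop :=
  forall alpha beta : C,
    Omega N r alpha -> A alpha -> Omega N r beta -> A beta -> alpha != beta^* ->
    [/\ forall f, V f -> V (Rop D r alpha f),
        forall f, V f -> V (Rop D r beta f)
      & forall f g, V f -> V g ->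
        ip f g + beta^* * ip f (Rop D r beta g)
          + alpha * ip (Rop D r alpha f) g
          - (1 - alpha * beta^*) * ip (Rop D r alpha f) (Rop D r beta g)
        = (alpha - beta^*) *
          \sum_(u \in roots_of r alpha) \sum_(v \in roots_of r beta)
            (((derive1 r v)^*)^-1 *: adjmx (g v) *m J
               *m ((derive1 r u)^-1 *: f u)) 0 0 / (u - v^*)].

Definition kernel_has_form (Theta : C -> 'M[C]_(N * p)) : Prop :=
  forall z w, D z -> D w -> r z * (r w)^* != 1 ->
    K z w = Z z
      *m ((1 - r z * (r w)^*)^-1 *:
           (invmx X - Theta (r z) *m X *m adjmx (Theta (r w))))
      *m adjmx (Z w).

Lemma kernel_form_identities Theta : kernel_has_form Theta -> operator_identities.
Proof.
move=> KF; have [|Rex Rid] := kernel_formula_identity mod uX (Th := Theta).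
  move=> s t Ss St st; have st0 : 1 - s * t^* != 0 by rewrite subr_eq0 eq_sym.
  rewrite -[RHS](scalerKV st0); congr (_ *: _); apply: kap_kernel => // u v ur vr.
  have [Du ru] := rts_D Ss ur; have [Dv rv] := rts_D St vr.
  by rewrite KF ?ru ?rv.
have RV a f : S a -> V f -> V (Rop D r a f).
  move=> Sa Vf; have [h /(isR_Rop Sa) hE] := Rex a (to_subspace hV Vf) Sa.
  by have := subspaceP h; rewrite -[sval_of h]/(fn h) hE.
move=> a b Oa Aa Ob Ab ab; have Sa : S a by []. have Sb : S b by [].
split=> [f|f|f g Vf Vg]; [exact: RV | exact: RV | ].
pose f' := to_subspace hV Vf; pose g' := to_subspace hV Vg.
have := double_sum f' g' Sa Sb ab; rewrite /= => ->.
pose f1 := to_subspace hV (RV a f Sa Vf); pose g1 := to_subspace hV (RV b g Sb Vg).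
have If : isR S ev a f' f1 by exact: Rop_isR.
have Ig : isR S ev b g' g1 by exact: Rop_isR.
exact: (Rid a b f' f1 g' g1 If Ig).
Qed.

Lemma nbhs_Aset0 : nbhs (0 : C) A.
Proof.
have [d [d0 Hd]] := Aset_open N0 sizeP adm (Aset0 adm).
apply/nbhs_ballP; exists (real_complex R d); first by rewrite /= (@ltcR R 0).
move=> x; rewrite /ball /= sub0r normrN cabsE (@ltcR R) => xd.
by apply: Hd; rewrite subr0.
Qed.

(** The identity at one nonreal point [a0] of the circle gives the kernel
    formula with [Theta s = X^-1 + a0^* (s - a0) kap s a0]. The functions
    [s |-> kap s a0] extend analytically to the whole of [A], which contains
    the origin, and continuity first in one variable and then in the other
    extends the formula from the points over [Omega] to all of [D]. *)
Lemma identities_kernel_form : operator_identities -> exists Theta : C -> 'M[C]_(N * p),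
  (exists2 W, nbhs (0 : C) W & analytic_on W Theta) /\ kernel_has_form Theta.
Proof.
move=> OI; have [a0 [Sa ca a0J]] := S_circle_nonreal N0 sizeP sizeQ adm w01 Aw0.
have [Oa Aa] := Sa; have [RV _ RI] := OI a0 a0 Oa Aa Oa Aa a0J.
have Rex (f : U) : exists h, isR S ev a0 f h.
  by exists (to_subspace hV (RV _ (subspaceP f))); exact: Rop_isR.
have Rid (f f1 g g1 : U) : isR S ev a0 f f1 -> isR S ev a0 g g1 -> R_identity sip ev X a0 a0 f f1 g g1.
  move=> /(isR_Rop Sa) f1E /(isR_Rop Sa) g1E.
  rewrite /R_identity -(double_sum f g Sa Sa a0J) -(RI _ _ (subspaceP f) (subspaceP g)).
  by rewrite -f1E -g1E.
have KF := identity_kernel_formula mod uX adjX Sa ca Rex Rid.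
have [F HF] := boolp.choice (fun j => Vform (subspaceP (kk a0 (delta_mx j 0)))).
pose G s : 'M[C]_(N * p) := \matrix_(i, j) F j s i 0.
have GE s : S s -> G s = kap ev kk s a0.
  by move=> Ss; apply/matrixP => i j; rewrite !mxE (ev_form Ss (HF j).2).
pose Theta s : 'M[C]_(N * p) := invmx X + (a0^* * (s - a0)) *: G s.
have ThA : analytic_on A Theta.
  move=> c Ac i j; have -> : (fun z => Theta z i j) =
      (fun z => invmx X i j + a0^* * (z - a0) * F j z i 0).
    by apply/funext => z; rewrite /Theta !mxE.
  by apply: analytic_affine_mul; exact: (HF j).1.
exists Theta; split; first by exists A => //; exact: nbhs_Aset0.
pose Phi z w := (1 - r z * (r w)^*) *: K z w -
  Z z *m (invmx X - Theta (r z) *m X *m adjmx (Theta (r w))) *m adjmx (Z w).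
have PhiC w z : D w -> D z -> mcont (fun x => Phi x w) z.
  move=> Dw Dz; have rz : regular r z by case: Dz.
  have rc := rat_continuous rz.
  have Zc := ZI_mcont sizeP sizeQ eB (p := p) rz.
  have ThC : mcont (fun x => Theta (r x)) z.
    move=> i j; have Tc : {for r z, continuous (fun s => Theta s i j)}.
      by apply: analytic_continuous; apply: ThA; case: Dz.
    exact: (continuous_comp rc Tc).
  apply: mcontB.
    apply: mcontZ.
      by apply: continuousB; [exact: cst_continuous |
        apply: continuousM; [exact: rc | exact: cst_continuous]].
    have [d [d0 Hd]] := D_open N0 sizeP adm Dz.
    apply: (mcont_local d0 (F := fun x => \matrix_(i, j) fn (kvec w (delta_mx j 0)) x i 0)).
      by move=> x /Hd Dx; apply/matrixP => i j; rewrite mxE kvecE // -colE mxE.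
    move=> i j; have hc : {for z, continuous (fun y : C => fn (kvec w (delta_mx j 0)) y i 0)}.
      exact: f_mcont.
    apply: (continuous_local d0 _ hc) => x _; by rewrite mxE.
  have T1 := mcontM (mcontM ThC (@mcont_const R _ _ X z)) (@mcont_const R _ _ (adjmx (Theta (r w))) z).
  have T2 := mcontM Zc (mcontB (@mcont_const R _ _ (invmx X) z) T1).
  exact: (mcontM T2 (@mcont_const R _ _ (adjmx (Z w)) z)).
have Phi0 z w : D z -> D w -> S (r z) -> S (r w) -> Phi z w = 0.
  move=> Dz Dw Sz Sw; rewrite /Phi kernel_kap // scalemxAl scalemxAr KF // /Theta !GE //.
  by rewrite subrr.
have Phi1 z w : D z -> D w -> S (r w) -> Phi z w = 0.
  move=> Dz Dw Sw; apply: (D_ext N0 sizeP sizeQ adm Dz (PhiC w z Dw Dz)) => x Dx Sx.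
  exact: Phi0.
have PhiJ z w : D z -> D w -> Phi w z = adjmx (Phi z w).
  move=> Dz Dw; rewrite /Phi adjmxB adjmxZ (kernel_sym Dz Dw).
  rewrite !adjmxM adjmxB !adjmxM !adjmxK adjX adjmx_inv adjX !mulmxA.
  have -> // (s t : C) : (1 - s * t^*)^* = 1 - t * s^*.
  by rewrite rmorphB rmorph1 rmorphM /= conjCK mulrC.
have Phi2 z w : D z -> D w -> Phi z w = 0.
  move=> Dz Dw; apply: (D_ext N0 sizeP sizeQ adm Dz (PhiC w z Dw Dz)) => x Dx Sx.
  by rewrite PhiJ // Phi1 // adjmx0.
move=> z w Dz Dw rzw; have rzw0 : 1 - r z * (r w)^* != 0 by rewrite subr_eq0 eq_sym.
have /eqP := Phi2 z w Dz Dw; rewrite subr_eq0 => /eqP E.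
by rewrite -scalemxAr -scalemxAl -E scalerA mulVf // scale1r.
Qed.

End Correspondence.

Theorem theorem8p4 (R : realType) (N p L : nat) (r : ratfun (Cplx R))
  (J : 'M[R]_p) (e : 'I_N -> Cplx R -> Cplx R) (w0 gamma : Cplx R)
  (zeta delta : 'I_L -> Cplx R)
  (V : set (Cplx R -> 'cV[Cplx R]_p))
  (ip : (Cplx R -> 'cV[Cplx R]_p) -> (Cplx R -> 'cV[Cplx R]_p) -> Cplx R)
  (K : Cplx R -> Cplx R -> 'M[Cplx R]_p) :
  let JC : 'M[Cplx R]_p := map_mx (real_complex R) J in
  let A := Aset r zeta delta in
  let D := rat_preimage r A in
  let X := Xmx r JC e gamma in
  (0 < N)%N -> (0 < p)%N ->
  size (rnum r) = N.+1 -> (size (rden r) <= size (rnum r))%N ->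
  real_ratfun r -> real_basis r e -> signature_mx JC ->
  `|w0| = 1 -> regular r w0 ->
  admissible_disks r w0 zeta delta -> A w0 ->
  Omega N r gamma ->
  rk_pontryagin D V ip K ->
  (forall f, V f -> analytic_on D f) ->
  (forall f, V f -> exists F : Cplx R -> 'cV[Cplx R]_(N * p),
     analytic_on A F /\ forall z, D z -> f z = ZI p e z *m F (r z)) ->
  (forall alpha beta : Cplx R,
     Omega N r alpha -> A alpha -> Omega N r beta -> A beta ->
     alpha != beta^* ->
     [/\ forall f, V f -> V (Rop D r alpha f),
         forall f, V f -> V (Rop D r beta f)
       & forall f g, V f -> V g ->
         ip f g + beta^* * ip f (Rop D r beta g)
           + alpha * ip (Rop D r alpha f) g
           - (1 - alpha * beta^*) * ip (Rop D r alpha f) (Rop D r beta g)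
         = (alpha - beta^*) *
           \sum_(u \in roots_of r alpha) \sum_(v \in roots_of r beta)
             (((derive1 r v)^*)^-1 *: adjmx (g v) *m JC
                *m ((derive1 r u)^-1 *: f u)) 0 0 / (u - v^*)])
  <->
  (exists Theta : Cplx R -> 'M[Cplx R]_(N * p),
     (exists2 U, nbhs (0 : Cplx R) U & analytic_on U Theta) /\
     forall z w, D z -> D w -> r z * (r w)^* != 1 ->
       K z w = ZI p e z
         *m ((1 - r z * (r w)^*)^-1 *:
              (invmx X - Theta (r z) *m X *m adjmx (Theta (r w))))
         *m adjmx (ZI p e w)).
Proof.
move=> JC A D X N0 _ sizeP sizeQ rreal eB sJ w01 _ adm Aw0 Og [Vout pont rep] Vana Vform.
have hV : lin_subspace V by case: pont.
have -> : X = Xlist r e JC gamma := XmxE e JC Og.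
split.
  exact: (identities_kernel_form N0 sizeP sizeQ rreal eB sJ Og adm w01 Aw0 Vout pont rep
    Vana Vform hV).
move=> [Theta [_ KF]].
exact: (kernel_form_identities N0 sizeP sizeQ rreal eB sJ Og adm w01 Aw0 Vout pont rep
  Vana Vform hV KF).
Qed.
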